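(* Let $B>0$ and let $\phi\in L^1(\mathbb R)$ satisfy $\operatorname{supp}\phi\subset[-B,B]$, $\overline{\phi(-x)}=\phi(x)$, and $\phi(x)\ne 0$ for a.e. $x\in[-B,B]$. Let $\psi(x)=\phi(x)(e^{2\pi i xb}-1)$, where $0<b\le 1/(2B)$. Suppose that $\{\omega_n\}_{n\ge1}=\{k/(4B)\}_{k\in\mathbb Z}$, or that $\{\omega_n\}_{n\ge1}$ is a sequence of positive numbers satisfying $\limsup_{n\to\infty} n/\omega_n>4B$. Let $f\in L^1_{loc}(\mathbb R)$ be a function which is $2B$-nonseparable. Then $f$ is determined up to a global phase by the measurements $$\{|\mathcal V_\phi f(t,\omega_n)|,\ |\mathcal V_\psi f(t,\omega_n)| : t\in\mathbb R,\ n\ge1\}.$$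
   Context: Signals are complex-valued functions on $\mathbb R$. $\mathbb T=\{z\in\mathbb C:|z|=1\}$. $L^1_{loc}(\mathbb R)$ is the set of functions integrable on every interval of finite length. The short-time Fourier transform is $\mathcal V_\phi f(t,\omega)=\int_{\mathbb R} f(x)\overline{\phi(x-t)}e^{-2\pi i x\omega}\,dx$; for $f\in L^1_{loc}(\mathbb R)$ and an integrable compactly supported $\phi$, the function $f\phi(\cdot-t)$ is integrable for almost all $t$, so the transform is defined for almost all $t$. A function $f$ is called $L$-separable if there exists an interval of length $L$ on which $f$ vanishes, and $L$-nonseparable if there is no such interval. That $f$ is determined up to a global phase by the measurements means that every $g\in L^1_{loc}(\mathbb R)$ with the same measurements (for a.e. $t\in\mathbb R$ and all $n\ge1$) satisfies $f=\lambda g$ a.e. for some constant $\lambda\in\mathbb T$.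
   Formalization: In the case limsup n/ω_n > 4B, the positive frequencies ω_n are assumed to be numbered in strictly increasing order; without an order convention the claim fails, e.g. for the constant sequence ω_n = 1. *)

(* Defs.v *)
From HB Require Import structures.
From mathcomp Require Export all_boot all_order all_algebra.
From mathcomp Require Export all_classical all_reals all_analysis.
From mathcomp.real_closed Require Export complex.
Export Order.TTheory GRing.Theory Num.Theory.
Export numFieldNormedType.Exports.

Set Implicit Arguments.
Unset Strict Implicit.
Unset Printing Implicit Defensive.

Local Open Scope classical_set_scope.
Local Open Scope ring_scope.
Local Open Scope complex_scope.

(* Signals are functions R -> R[i]. Elements of L^1 and L^1_loc are handled
   through representatives measurable for the Borel sigma-algebra; equalities,
   supports and vanishing are therefore all taken almost everywhere. *)

(* e^{i theta} *)
Definition expi (R : realType) (theta : R) : R[i] := cos theta +i* sin theta.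

Definition cintegrable (R : realType) (D : set R) (f : R -> R[i]) : Prop :=
  (@lebesgue_measure R).-integrable D (EFin \o (fun x => complex.Re (f x))) /\
  (@lebesgue_measure R).-integrable D (EFin \o (fun x => complex.Im (f x))).

Definition cintegral (R : realType) (D : set R) (f : R -> R[i]) : R[i] :=
  (\int[@lebesgue_measure R]_(x in D) complex.Re (f x)) +i*
  (\int[@lebesgue_measure R]_(x in D) complex.Im (f x)).

Definition L1 (R : realType) (f : R -> R[i]) : Prop := cintegrable setT f.

Definition L1loc (R : realType) (f : R -> R[i]) : Prop :=
  forall a b : R, cintegrable `[a, b] f.

(* Complement of the largest open set on which f vanishes a.e.; this is the
   support that makes sense for a class of functions modulo a.e. equality. *)
Definition ess_support (R : realType) (f : R -> R[i]) : set R :=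
  [set x | forall U : set R, nbhs x U ->
     ~ {ae @lebesgue_measure R, forall y : R, U y -> f y = 0}].

(* When the integrand is not integrable (a null set of t in the situations of
   interest) the value is the junk value of Rintegral. *)
Definition stft (R : realType) (phi f : R -> R[i]) (t omega : R) : R[i] :=
  cintegral setT
    (fun x => f x * (phi (x - t))^* * expi (- (2 * pi * x * omega))).

Definition separable_signal (R : realType) (L : R) (f : R -> R[i]) : Prop :=
  exists a : R,
    {ae @lebesgue_measure R, forall x : R, x \in `[a, a + L] -> f x = 0}.

Definition nonseparable_signal (R : realType) (L : R) (f : R -> R[i]) : Prop :=
  ~ separable_signal L f.

Definition second_window (R : realType) (phi : R -> R[i]) (b : R) : R -> R[i] :=
  fun x => phi x * (expi (2 * pi * x * b) - 1).

(* The pointwise moduli of two windowed transforms along the frequencies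
   omega_1, omega_2, ... agree; omega 0 is ignored. *)
Definition same_measurements (R : realType) (phi psi : R -> R[i])
    (omega : nat -> R) (f g : R -> R[i]) : Prop :=
  {ae @lebesgue_measure R, forall t : R, forall n : nat, (1 <= n)%N ->
     `|stft phi f t (omega n)| = `|stft phi g t (omega n)| /\
     `|stft psi f t (omega n)| = `|stft psi g t (omega n)|}.

Definition determined_up_to_global_phase (R : realType) (phi psi : R -> R[i])
    (omega : nat -> R) (f : R -> R[i]) : Prop :=
  forall g : R -> R[i], L1loc g -> same_measurements phi psi omega f g ->
    exists lambda : R[i], `|lambda| = 1 /\
      {ae @lebesgue_measure R, forall x : R, f x = lambda * g x}.

(* omega_1, omega_2, ... lists the set {k/(4B) : k in Z}; order and
   repetitions are irrelevant. *)
Definition lattice_frequencies (R : realType) (B : R) (omega : nat -> R) :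
    Prop :=
  omega @` [set n | (1 <= n)%N] = range (fun k : int => k%:~R / (4 * B)).

(* The frequencies are numbered in strictly increasing order, so that
   limsup n/omega_n is a density of the set of frequencies. It says nothing
   about that set if repetitions or arbitrary enumerations are allowed: a
   constant sequence has n/omega_n -> +oo. *)
Definition dense_frequencies (R : realType) (B : R) (omega : nat -> R) : Prop :=
  [/\ forall n, (1 <= n)%N -> 0 < omega n,
      forall m n, (1 <= m)%N -> (m < n)%N -> omega m < omega n &
      ((4 * B)%:E < limn_esup (fun n => (n%:R / omega n)%:E))%E].

(* Main.v *)
(* Put u_t(x) = f(x + t) conj(phi(x)), and let U_t be its Fourier transform. The
   measurements at t are the moduli of U_t and of U_t(. + b) - U_t along the
   frequencies. Their squares extend to entire functions of exponential type
   4 pi B which are o(exp(4 pi B |y|)) along the imaginary axis, and such a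
   function is determined by its values on (1/(4B)) Z (divide by a sine and
   apply Liouville's theorem) as well as on frequencies of upper density more
   than 4B. In the latter case a function of the same type vanishing there is
   bounded, by Blaschke products, on the plane cut along the real axis outside
   a gap containing many zeros; this lowers its type by a fixed amount, and
   repeating it makes the function bounded, hence 0.

   If f and g have the same measurements, then |U_t| = |V_t| and
   |U_t(. + b) - U_t| = |V_t(. + b) - V_t| everywhere, so that
   U_t(. + b) conj(U_t) is V_t(. + b) conj(V_t) or its conjugate. Hence U_t is
   a constant multiple of V_t or of conj(V_t) along a + bZ, where a is chosen
   such that U_t has no zero there, and everywhere because b <= 1/(2B). Thus
   f = c g on [t - B, t + B] or f(x) = c conj(g(2t - x)) there. The second
   alternative cannot exclude the first for all t in an interval: composing
   reflections, |f| and f conj(g) would be locally constant. So the first holds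
   for a dense set of t, and c is the same for overlapping windows since f
   vanishes on no interval of length 2B. *)

(* The lattice has exactly the critical density: a sine of type 4 pi B vanishes on all of it, so a
   growth bound alone cannot give uniqueness. What excludes the sine is that u_t is a function and
   puts no mass at the ends of [-B, B]; this is the o(...) along the imaginary axis.

   For the other frequencies the zeros are positive and only their upper density is known. Counting
   them with Jensen's formula, which allows for zeros on both half-lines, would lose a constant
   factor. The Blaschke argument is sharp: a zero at the point c of a gap normalized to [-1, 1]
   weighs sqrt(1 - c^2), so zeros of density D in a gap of half-length L weigh about pi D L / 2; far
   from the gap this outweighs the cost of cutting the plane as soon as pi D exceeds the type.

   The bound b <= 1/(2B) is the critical spacing for transforms of functions on [-B, B].

   Complex analysis rests on the maximum principle alone: division by functions with simple zeros
   takes the place of power series and contour integrals. *)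
Require Import Defs.
From mathcomp Require Import ring lra zify measurable_realfun.

Set Implicit Arguments.
Unset Strict Implicit.
Unset Printing Implicit Defensive.

Local Open Scope classical_set_scope.
Local Open Scope ring_scope.
Local Open Scope complex_scope.

Local Notation nm := (@Normc.normc _).
Local Notation Re := (@complex.Re _).
Local Notation Im := (@complex.Im _).
Local Notation mu := (@lebesgue_measure _).

Ltac complex_ring :=
  apply/eqP; rewrite eq_complex /=; apply/andP; split; apply/eqP; ring.

(** * Complex differentiable functions *)

Section Slopes.
Variable K : numFieldType.
Implicit Types (f g : K -> K) (z c : K) (m : nat).

Lemma near_neq0 f z : {for z, continuous f} -> f z != 0 ->
  \forall w \near z, f w != 0.
Proof. by move=> cf f0; exact: (cvgr_neq0 (f z) cf f0). Qed.

(* [m]-fold differentiability by Caratheodory slopes: divided differences are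
   functions of the same kind, which stands in for power series expansions. *)
Fixpoint smooth m g z : Prop :=
  if m is m'.+1 then
    exists q : K -> K,
      (\forall w \near z, g w = g z + (w - z) * q w) /\ smooth m' q z
  else {for z, continuous g}.

Lemma smooth_cst m c z : smooth m (fun=> c) z.
Proof.
elim: m c => [|m IH] c /=; first exact: cst_continuous.
by exists (fun=> 0); split => //; near=> w; rewrite mulr0 addr0.
Unshelve. all: by end_near. Qed.

Lemma smooth_id m z : smooth m id z.
Proof.
case: m => [|m] /=; first exact: cvg_id.
exists (fun=> 1); split; last exact: smooth_cst.
by near=> w; rewrite mulr1 addrC subrK.
Unshelve. all: by end_near. Qed.

Lemma smooth_near m f g z : (\forall w \near z, f w = g w) ->
  smooth m f z -> smooth m g z.
Proof.
move=> fg; have fgz := nbhs_singleton fg.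
case: m => [|m] /=.
  move=> cf; have cg : g w @[w --> z] --> f z.
    by apply: cvg_trans cf; exact: (near_eq_cvg (F := nbhs z) fg).
  by rewrite fgz in cg.
move=> [q [qE sq]]; exists q; split => //.
by near=> w; rewrite -fgz -(near fg w)//; near: w.
Unshelve. all: by end_near. Qed.

Lemma smoothD m f g z : smooth m f z -> smooth m g z ->
  smooth m (fun w => f w + g w) z.
Proof.
elim: m f g => [|m IH] f g /=; first by move=> *; exact: continuousD.
move=> [p [pE sp]] [q [qE sq]]; exists (fun w => p w + q w).
split; last exact: IH.
near=> w; rewrite (near pE w)// (near qE w)//; ring.
Unshelve. all: by end_near. Qed.

(** The slope of a product at [z] is [p w * g w + f z * q w]; it contains [g] itself, at one order
    less than given. Hence lowering the order is carried along in the induction. *)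
Lemma smoothSM m : (forall g z, smooth m.+1 g z -> smooth m g z) /\
  (forall f g z, smooth m f z -> smooth m g z ->
    smooth m (fun w => f w * g w) z).
Proof.
elim: m => [|m [IHS IHM]].
  split => [g z [q [qE cq]]|f g z cf cg]; last exact: continuousM.
  have : smooth 0 (fun w => g z + (w - z) * q w) z.
    apply: continuousD; first exact: cst_continuous.
    apply: continuousM => //; apply: continuousB; last exact: cst_continuous.
    exact: cvg_id.
  by apply: smooth_near; near=> w; rewrite -(near qE w).
have S2 : forall g z, smooth m.+2 g z -> smooth m.+1 g z.
  by move=> g z [q [qE sq]]; exists q; split => //; exact: IHS.
split => // f g z sf sg.
have [p [pE sp]] := sf; have [q [qE sq]] := sg.
exists (fun w => p w * g w + f z * q w); split; last first.
  apply: smoothD; first by apply: IHM => //; exact: IHS.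
  by apply: IHM => //; exact: smooth_cst.
near=> w; rewrite (near pE w)// [in LHS](near qE w)//.
rewrite [in X in _ = X](near qE w)//; ring.
Unshelve. all: by end_near. Qed.

Lemma smoothS m g z : smooth m.+1 g z -> smooth m g z.
Proof. by move: g z; case: (smoothSM m). Qed.

Lemma smoothM m f g z : smooth m f z -> smooth m g z ->
  smooth m (fun w => f w * g w) z.
Proof. by move: f g z; case: (smoothSM m). Qed.

Lemma smooth_le n m g z : (n <= m)%N -> smooth m g z -> smooth n g z.
Proof.
move=> /subnK <-; elim: (m - n)%N => // k IH.
by rewrite addSn => /smoothS.
Qed.

Lemma smooth_continuous m g z : smooth m g z -> {for z, continuous g}.
Proof. exact: (@smooth_le 0). Qed.

Lemma smoothN m f z : smooth m f z -> smooth m (fun w => - f w) z.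
Proof.
move=> sf; have := smoothM (smooth_cst m (-1) z) sf.
by apply: smooth_near; near=> w; rewrite mulN1r.
Unshelve. all: by end_near. Qed.

Lemma smoothB m f g z : smooth m f z -> smooth m g z ->
  smooth m (fun w => f w - g w) z.
Proof. by move=> sf sg; apply: smoothD => //; exact: smoothN. Qed.

Lemma smooth_comp m f g z : smooth m f z -> smooth m g (f z) ->
  smooth m (fun w => g (f w)) z.
Proof.
elim: m f g => [|m IH] f g sf sg /=; first exact: continuous_comp.
have cf := smooth_continuous sf.
have sf' := smoothS sf.
move: sf sg => [p [pE sp]] [q [qE sq]].
exists (fun w => p w * q (f w)); split; last first.
  by apply: smoothM => //; exact: IH.
have {qE}qE : \forall w \near z, g (f w) = g (f z) + (f w - f z) * q (f w).
  exact: cf qE.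
near=> w; rewrite (near qE w)// mulrA; congr (_ + _ * _).
rewrite (near pE w) //; ring.
Unshelve. all: by end_near. Qed.

Lemma smooth_inv m z : z != 0 -> smooth m (fun w => w^-1) z.
Proof.
move=> z0; elim: m => [|m IH]; first exact: inv_continuous.
exists (fun w => - z^-1 * w^-1); split; last first.
  by apply: smoothM => //; exact: smooth_cst.
have nz : \forall w \near z, w != 0 by apply: (@near_neq0 id) => //; exact: cvg_id.
near=> w.
have w0 : w != 0 by near: w.
by field; rewrite z0 w0.
Unshelve. all: by end_near. Qed.

Lemma smoothV m f z : f z != 0 -> smooth m f z -> smooth m (fun w => (f w)^-1) z.
Proof. by move=> f0 sf; apply: smooth_comp sf _; exact: smooth_inv. Qed.

Lemma smoothX m f z n : smooth m f z -> smooth m (fun w => f w ^+ n) z.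
Proof.
move=> sf; elim: n => [|n IH].
  by apply: smooth_near (smooth_cst m 1 z); near=> w; rewrite expr0.
by apply: smooth_near (smoothM sf IH); near=> w; rewrite exprS.
Unshelve. all: by end_near. Qed.

(** Both slopes agree off [z], so continuity fixes their common value there, which is the
    derivative. *)
Lemma slope_uniq z (p q : K -> K) :
  {for z, continuous p} -> {for z, continuous q} ->
  (\forall w \near z, (w - z) * p w = (w - z) * q w) -> p z = q z.
Proof.
move=> cp cq pq.
have pq' : \forall w \near z^', q w = p w.
  near=> w; have wz : w - z != 0 by rewrite subr_eq0; near: w; exact: nbhs_dnbhs_neq.
  apply: (mulfI wz); apply/esym; near: w; exact: nbhs_dnbhs.
have H : forall h : K -> K, {for z, continuous h} -> h w @[w --> z^'] --> h z.
  by move=> h ch; exact: cvg_within_filter ch.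
apply: (@cvg_unique K (@norm_hausdorff _ K) (p @ z^')); first exact: H.
apply: cvg_trans (H _ cq); exact: (near_eq_cvg (F := z^') pq').
Unshelve. all: by end_near. Qed.

(** Removable singularities. At a zero of [S] both functions have the form [(w - z)] times a slope,
    so [F / S] is the quotient of the slopes nearby. This costs one order of differentiability,
    which is harmless when all orders are available. *)
Lemma division (D : set K) (F S : K -> K) :
  (forall z m, D z -> smooth m F z) -> (forall z m, D z -> smooth m S z) ->
  (forall z, D z -> S z = 0 -> F z = 0 /\
    exists q, [/\ {for z, continuous q}, q z != 0 &
      \forall w \near z, S w = (w - z) * q w]) ->
  exists G, (forall z, D z -> F z = S z * G z) /\
            (forall z m, D z -> smooth m G z).
Proof.
move=> sF sS zS.
(* The value of the quotient at a zero of [S]. By [slope_uniq] the set has at most one element, and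
   the default 0 is never reached where it matters. *)
pose val z := xget 0 [set c : K | exists p q,
  [/\ {for z, continuous p}, {for z, continuous q}, q z != 0,
      (\forall w \near z, F w = (w - z) * p w) /\
      (\forall w \near z, S w = (w - z) * q w) & c = p z / q z]].
exists (fun z => if S z == 0 then val z else F z / S z).
split=> [z Dz|z m Dz].
  case: eqP => [S0|/eqP S0]; last by rewrite mulrC divfK.
  by rewrite S0 mul0r; case: (zS _ Dz S0).
have [S0|S0] := eqVneq (S z) 0; last first.
  have nz : \forall w \near z, S w != 0.
    have cS : {for z, continuous S} by exact: (sS z 0%N).
    exact: near_neq0.
  apply: (@smooth_near _ (fun w => F w * (S w)^-1)).
    near=> w; have w0 : S w != 0 by near: w.
    by rewrite (negbTE w0).
  by apply: smoothM; [exact: sF|apply: smoothV => //; exact: sS].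
have [F0 [q0 [cq0 q0z S0E]]] := zS _ Dz S0.
have [p [pE sp]] := sF z m.+1 Dz.
have [q [qE sq]] := sS z m.+1 Dz.
have qz : q z != 0.
  rewrite (@slope_uniq z q q0)//; first exact: smooth_continuous sq.
  by near=> w; rewrite -(near S0E w)// (near qE w)// S0 add0r.
have nq : \forall w \near z, q w != 0.
  have cq := smooth_continuous sq.
  exact: near_neq0.
have valE : val z = p z / q z.
  rewrite /val; case: xgetP => [c -> [p1 [q1 [cp1 cq1 q1z [p1E q1E] ->]]]|].
    rewrite (@slope_uniq z p1 p)//; last 2 first.
    - exact: smooth_continuous sp.
    - by near=> w; rewrite -(near p1E w)// (near pE w)// F0 add0r.
    rewrite (@slope_uniq z q1 q)//; first exact: smooth_continuous sq.
    by near=> w; rewrite -(near q1E w)// (near qE w)// S0 add0r.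
  move=> /(_ (p z / q z)) []; exists p, q; split => //.
  - exact: smooth_continuous sp.
  - exact: smooth_continuous sq.
  - split; near=> w.
      by rewrite (near pE w)// F0 add0r.
    by rewrite (near qE w)// S0 add0r.
apply: (@smooth_near _ (fun w => p w * (q w)^-1)).
  near=> w; have q0w : q w != 0 by near: w.
  have SE : S w = (w - z) * q w by rewrite (near qE w)// S0 add0r.
  have FE : F w = (w - z) * p w by rewrite (near pE w)// F0 add0r.
  have [->|wz] := eqVneq w z; first by rewrite S0 eqxx valE.
  have wz' : w - z != 0 by rewrite subr_eq0.
  rewrite SE mulf_eq0 (negbTE wz') (negbTE q0w)/= FE.
  by field; rewrite q0w wz'.
by apply: smoothM => //; exact: smoothV.
Unshelve. all: by end_near. Qed.

End Slopes.

(* [R[i]] seen as a [numFieldType], which carries the norm topology. *)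
Definition cplx (R : realType) : numFieldType := (R[i] : numFieldType).

(** * The modulus and the maximum principle *)

Section ComplexModulus.
Variable R : realType.
Local Notation C := (cplx R).
Implicit Types z w : R[i].

Lemma nmE z : `|z| = (nm z)%:C.
Proof. by []. Qed.

Lemma nm_ge0 z : 0 <= nm z.
Proof. by case: z => a b; exact: sqrtr_ge0. Qed.

Lemma nmM z w : nm (z * w) = nm z * nm w.
Proof. exact: Normc.normcM. Qed.

Lemma nmD z w : nm (z + w) <= nm z + nm w.
Proof. exact: le_normcD. Qed.

Lemma nmN z : nm (- z) = nm z.
Proof. exact: normcN. Qed.

Lemma nmB z w : nm (z - w) <= nm z + nm w.
Proof. by rewrite -(nmN w) nmD. Qed.

Lemma nmC z w : nm (z - w) = nm (w - z).
Proof. by rewrite -nmN opprB. Qed.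

Lemma nm_dist z w : nm z <= nm w + nm (z - w).
Proof. by rewrite -{1}(subrK w z) addrC nmD. Qed.

Lemma nmV z : nm z^-1 = (nm z)^-1.
Proof. exact: Normc.normcV. Qed.

Lemma nm0 : nm (0 : R[i]) = 0. Proof. exact: Normc.normc0. Qed.
Lemma nm1 : nm (1 : R[i]) = 1. Proof. exact: Normc.normc1. Qed.

Lemma nmX z n : nm (z ^+ n) = nm z ^+ n.
Proof. by elim: n => [|n IH]; rewrite ?expr0 ?nm1// !exprS nmM IH. Qed.

Lemma nm_eq0 z : (nm z == 0) = (z == 0).
Proof.
by apply/eqP/eqP => [|->]; [exact: Normc.eq0_normc|exact: nm0].
Qed.

Lemma nm_gt0 z : (0 < nm z) = (z != 0).
Proof. by rewrite lt_def nm_ge0 andbT nm_eq0. Qed.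

Lemma sqr_nm z : nm z ^+ 2 = Re z ^+ 2 + Im z ^+ 2.
Proof. by case: z => a b /=; rewrite sqr_sqrtr// addr_ge0 ?sqr_ge0. Qed.

Lemma nm_real (x : R) : nm x%:C = `|x|.
Proof. by rewrite /= expr0n addr0 sqrtr_sqr. Qed.

Lemma nm_conj z : nm z^* = nm z.
Proof. by case: z => a b /=; rewrite sqrrN. Qed.

Lemma nm_i : nm ('i : R[i]) = 1.
Proof. by rewrite /= expr0n add0r expr1n sqrtr1. Qed.

Lemma Re_le_nm z : `|Re z| <= nm z.
Proof.
rewrite -(@ler_pXn2r _ 2)// ?nnegrE ?nm_ge0// sqr_nm -normrX ger0_norm ?sqr_ge0//.
by rewrite lerDl sqr_ge0.
Qed.

Lemma Im_le_nm z : `|Im z| <= nm z.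
Proof.
rewrite -(@ler_pXn2r _ 2)// ?nnegrE ?nm_ge0// sqr_nm -normrX ger0_norm ?sqr_ge0//.
by rewrite lerDr sqr_ge0.
Qed.

Lemma nm_le_ReIm z : nm z <= `|Re z| + `|Im z|.
Proof.
rewrite -(@ler_pXn2r _ 2)// ?nnegrE ?nm_ge0 ?addr_ge0//.
rewrite sqr_nm sqrrD !real_normK ?num_real// addrAC lerDl mulrn_wge0// mulr_ge0//.
Qed.

Lemma mulcc z : z * z^* = (nm z ^+ 2)%:C.
Proof.
rewrite sqr_nm; case: z => a b; apply/eqP.
by rewrite eq_complex /=; apply/andP; split; apply/eqP; ring.
Qed.

Lemma cnbhsP (z : C) (A : set C) :
  nbhs z A <-> exists2 e : R, 0 < e & forall w : R[i], nm (w - z) < e -> A w.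
Proof.
rewrite -nbhs_nbhs_norm; split => [[e /= e0 eA]|[e e0 eA]].
  have eE : e = (Re e)%:C.
    by case: e e0 {eA} => a b; rewrite ltcE /= => /andP[/eqP -> _].
  exists (Re e); first by rewrite eE ltcR in e0.
  move=> w wz; apply: eA => /=; rewrite eE distrC nmE ltcR; exact: wz.
exists e%:C => /=; first by rewrite ltcR.
by move=> w /=; rewrite distrC nmE ltcR; exact: eA.
Qed.

Lemma cpair_continuous (p : R * R) :
  (fun q : R * R => (q.1 +i* q.2 : C)) q @[q --> p] --> (p.1 +i* p.2 : C).
Proof.
move=> A /cnbhsP[e e0 eA].
have e20 : 0 < e / 2 by rewrite divr_gt0.
near=> q; apply: eA.
rewrite (le_lt_trans (nm_le_ReIm _))// [ltRHS]splitr /= ltrD//; near: q.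
  have : q.1 @[q --> p] --> p.1 by exact: cvg_fst.
  by move/cvgr_dist_lt => /(_ _ e20); apply: filterS => q; rewrite distrC.
have : q.2 @[q --> p] --> p.2 by exact: cvg_snd.
by move/cvgr_dist_lt => /(_ _ e20); apply: filterS => q; rewrite distrC.
Unshelve. all: by end_near. Qed.

Lemma nm_continuous (z : C) : (nm : C -> R) w @[w --> z] --> nm z.
Proof.
apply/(@cvgrPdist_lt _ _ _ (nbhs z)) => e e0; apply/cnbhsP; exists e => // w wz.
rewrite (le_lt_trans _ wz)// ler_norml; apply/andP; split.
  by rewrite lerNl opprB lerBlDl nm_dist.
by rewrite lerBlDl nmC nm_dist.
Qed.

(** The four points are [z + h] with h = t, it, -t, -it. After |k + l|^2 >= |k|^2 + 2 Re (conj(k) l)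
    the terms in [a] cancel, and h^2 = t^2, -t^2, t^2, -t^2 leaves only differences of the [r]'s,
    which are at most [d *+ 2]. The term with [e] gains 4 e t^2, which is more than they can take
    away. *)
Lemma nm_split4 (g0 a r0 r1 r2 r3 : R[i]) (t d e : R) (z : R[i]) :
  0 < t -> nm g0 * d *+ 8 < e *+ 4 ->
  nm (r0 - r1) <= d *+ 2 -> nm (r2 - r3) <= d *+ 2 ->
  (nm g0 ^+ 2 + e * nm z ^+ 2) *+ 4 <
   (nm (g0 + t%:C * (a + t%:C * r0)) ^+ 2 + e * nm (z + t%:C) ^+ 2) +
   (nm (g0 + t *i * (a + t *i * r1)) ^+ 2 + e * nm (z + t *i) ^+ 2) +
   (nm (g0 - t%:C * (a - t%:C * r2)) ^+ 2 + e * nm (z - t%:C) ^+ 2) +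
   (nm (g0 - t *i * (a - t *i * r3)) ^+ 2 + e * nm (z - t *i) ^+ 2).
Proof.
move=> t0 de r01 r23.
have : `|Re (g0^* * ((r0 - r1) + (r2 - r3)))| <= nm g0 * (d *+ 4).
  rewrite (le_trans (Re_le_nm _))// nmM nm_conj ler_wpM2l ?nm_ge0//.
  rewrite (le_trans (nmD _ _))//; lra.
rewrite ler_norml => /andP[h _].
have tde : t ^+ 2 * (nm g0 * d *+ 8) < t ^+ 2 * (e *+ 4).
  by rewrite ltr_pM2l// exprn_gt0.
have {}h : t ^+ 2 * - (nm g0 * (d *+ 4)) <=
    t ^+ 2 * Re (g0^* * ((r0 - r1) + (r2 - r3))).
  by rewrite ler_wpM2l// sqr_ge0.
have H : t ^+ 2 * (Re (g0^* * ((r0 - r1) + (r2 - r3))) *+ 2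
   + e *+ 4) <=
   (nm (g0 + t%:C * (a + t%:C * r0)) ^+ 2 + e * nm (z + t%:C) ^+ 2) +
   (nm (g0 + t *i * (a + t *i * r1)) ^+ 2 + e * nm (z + t *i) ^+ 2) +
   (nm (g0 - t%:C * (a - t%:C * r2)) ^+ 2 + e * nm (z - t%:C) ^+ 2) +
   (nm (g0 - t *i * (a - t *i * r3)) ^+ 2 + e * nm (z - t *i) ^+ 2)
   - (nm g0 ^+ 2 + e * nm z ^+ 2) *+ 4.
  have P (k l : R[i]) : nm k ^+ 2 + Re (k^* * l) *+ 2 <= nm (k + l) ^+ 2.
    rewrite !sqr_nm; case: k l => [k1 k2] [h1 h2] /=.
    by rewrite -subr_ge0; apply: le_trans (addr_ge0 (sqr_ge0 h1) (sqr_ge0 h2)) _;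
      rewrite le_eqVlt; apply/orP; left; apply/eqP; ring.
  have := P g0 (t%:C * (a + t%:C * r0)).
  have := P g0 (t *i * (a + t *i * r1)).
  have := P g0 (- (t%:C * (a - t%:C * r2))).
  have := P g0 (- (t *i * (a - t *i * r3))).
  rewrite !(sqr_nm (z + _)) !(sqr_nm z).
  move: g0 a r0 r1 r2 r3 z {P h tde r01 r23 de} => [A B] [a b] [r0 s0] [r1 s1] [r2 s2] [r3 s3] [x y].
  set k0 := nm _; set k1 := nm _; set k2 := nm _; set k3 := nm _; set k4 := nm _.
  move: k0 k1 k2 k3 k4 => k0 k1 k2 k3 k4 /=.
  lra.
lra.
Qed.

Lemma nm_nbhs_continuous (f : C -> C) (z : C) : {for z, continuous f} <->
  forall e : R, 0 < e -> \forall w \near z, nm (f w - f z) < e.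
Proof.
split => [cf e e0|H A /cnbhsP[e e0 eA]].
  have : nbhs (f z) [set w : C | nm (w - f z) < e] by apply/cnbhsP; exists e.
  by move/cf.
by apply: filterS (H e e0) => w; exact: eA.
Qed.

(* Averaging over [z + h], [z + ih], [z - h], [z - ih] cancels the terms of
   the expansion of [|g|^2] that are linear or quadratic in [h]. *)
Lemma smooth_not_local_max (g : C -> C) (z : C) (A : set C) (e : R) :
  smooth 2 g z -> nbhs z A -> 0 < e -> exists2 w : C, A w &
    nm (g z) ^+ 2 + e * nm z ^+ 2 < nm (g w) ^+ 2 + e * nm w ^+ 2.
Proof.
move=> [p [pE [r [rE cr]]]] Az e0.
have n0 := nm_ge0 (g z).
pose d := e / (4 * (nm (g z) + 1)).
have d0 : 0 < d by rewrite divr_gt0// mulr_gt0// ltr_wpDl.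
have nr : \forall w \near z, nm (r w - r z) < d.
  by move/nm_nbhs_continuous : cr; exact.
have : \forall w \near z, [/\ A w, g w = g z + (w - z) * p w,
   p w = p z + (w - z) * r w & nm (r w - r z) < d] by near=> w; split; near: w.
move=> /cnbhsP[x x0 H]; pose t := x / 2.
have t0 : 0 < t by rewrite divr_gt0.
have tx : t < x by rewrite /t; lra.
have pt (h : R[i]) : nm h < x -> [/\ A (z + h),
  g (z + h) = g z + h * (p z + h * r (z + h)) & nm (r (z + h) - r z) < d].
  move=> hx; have [|Ah gE p_E rd] := H (z + h); first by rewrite addrAC subrr add0r.
  by split => //; rewrite gE p_E [z + h - z]addrAC subrr add0r.
have nt : nm t%:C < x by rewrite nm_real gtr0_norm.
have nti : nm t *i < x by rewrite /= expr0n add0r sqrtr_sqr gtr0_norm.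
have [A0 g0 r0] := pt _ nt; have [A1 g1 r1] := pt _ nti.
have [A2 g2 r2] := pt (- t%:C) ltac:(by rewrite nmN).
have [A3 g3 r3] := pt (- t *i) ltac:(by rewrite nmN).
have tri (a b c : R[i]) : nm (a - c) < d -> nm (b - c) < d -> nm (a - b) <= d *+ 2.
  move=> ac bc; rewrite (_ : a - b = (a - c) - (b - c)); last by ring.
  by rewrite (le_trans (nmB _ _))// mulr2n lerD// ltW.
have de : nm (g z) * d *+ 8 < e *+ 4.
  have -> : nm (g z) * d *+ 8 = e * (nm (g z) / (nm (g z) + 1)) *+ 2.
    by rewrite /d; field; rewrite lt0r_neq0// ltr_wpDl.
  have : nm (g z) / (nm (g z) + 1) < 1 by rewrite ltr_pdivrMr ?ltr_wpDl//; lra.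
  by move=> q1; have : e * (nm (g z) / (nm (g z) + 1)) < e * 1; [rewrite ltr_pM2l|lra].
have := nm_split4 (p z) z t0 de (tri _ _ _ r0 r1) (tri _ _ _ r2 r3).
rewrite !mulNr in g2 g3; rewrite -g0 -g1 -g2 -g3.
move: A0 A1 A2 A3 => A0 A1 A2 A3.
have [h0|h0] := ltP (nm (g z) ^+ 2 + e * nm z ^+ 2)
  (nm (g (z + t%:C)) ^+ 2 + e * nm (z + t%:C) ^+ 2); first by exists (z + t%:C).
have [h1|h1] := ltP (nm (g z) ^+ 2 + e * nm z ^+ 2)
  (nm (g (z + t *i)) ^+ 2 + e * nm (z + t *i) ^+ 2); first by exists (z + t *i).
have [h2|h2] := ltP (nm (g z) ^+ 2 + e * nm z ^+ 2)
  (nm (g (z - t%:C)) ^+ 2 + e * nm (z - t%:C) ^+ 2); first by exists (z - t%:C).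
have [h3|h3] := ltP (nm (g z) ^+ 2 + e * nm z ^+ 2)
  (nm (g (z - t *i)) ^+ 2 + e * nm (z - t *i) ^+ 2); first by exists (z - t *i).
lra.
Unshelve. all: by end_near. Qed.

(** [O] marks the points that are treated as interior. Adding [e * |z|^2] to [|g|^2] makes an
    interior maximum impossible, so the maximum over the compact set is attained where [M] is known
    to be a bound. *)
Lemma maximum_principle (g : C -> C) (A O : set C) (M : R) :
  0 <= M ->
  compact [set q : R * R | A (q.1 +i* q.2)] ->
  (forall z : C, A z -> {for z, continuous g}) ->
  (forall z : C, A z -> O z -> nbhs z A /\ smooth 2 g z) ->
  (forall z, A z -> ~ O z -> nm (g z) <= M) ->
  forall z, A z -> nm (g z) <= M.
Proof.
move=> M0 cA cg gO gM z Az; rewrite leNgt; apply/negP => Mz.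
set A' := [set q | _] in cA.
have A0 : A' !=set0.
  by exists (Re z, Im z); rewrite /A' /=; case: (z) Az.
have cnt (e : R) : {in A', continuous (fun q : R * R =>
    nm (g (q.1 +i* q.2)) ^+ 2 + e * nm (q.1 +i* q.2) ^+ 2)}.
  move=> q /set_mem Aq.
  have c1 : nm (p.1 +i* p.2) @[p --> q] --> nm (q.1 +i* q.2).
    exact: cvg_comp (@cpair_continuous q) (@nm_continuous _).
  have c2 : nm (g (p.1 +i* p.2)) @[p --> q] --> nm (g (q.1 +i* q.2)).
    have c3 : g (p.1 +i* p.2) @[p --> q] --> g (q.1 +i* q.2).
      exact: cvg_comp (@cpair_continuous q) (cg _ Aq).
    exact: cvg_comp c3 (@nm_continuous _).
  apply: cvgD; first by rewrite expr2; apply: cvgM.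
  by apply: cvgM; [exact: cvg_cst|rewrite expr2; apply: cvgM].
have wcnt (e : R) : {within A', continuous (fun q : R * R =>
    nm (g (q.1 +i* q.2)) ^+ 2 + e * nm (q.1 +i* q.2) ^+ 2)}.
  by apply: continuous_in_subspaceT; exact: cnt.
pose N q : R := nm (q.1 +i* q.2) ^+ 2.
have [q0 /set_mem A'q0 q0max] : exists2 c : R * R, c \in A' &
    forall t, t \in A' -> N t <= N c.
  apply: compact_EVT_max => //; apply: continuous_in_subspaceT => q _.
  have c1 : nm (p.1 +i* p.2) @[p --> q] --> nm (q.1 +i* q.2).
    exact: cvg_comp (@cpair_continuous q) (@nm_continuous _).
  exact: (cvgM c1 c1).
have zE : forall w : R[i], w = Re w +i* Im w by case.
have Nmax w : A w -> nm w ^+ 2 <= N q0.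
  move=> Aw; have := q0max (Re w, Im w).
  by rewrite /N -zE; apply; apply/mem_set; rewrite /A' /= -zE.
have NM0 : 0 <= N q0 by rewrite sqr_ge0.
(* Small enough that the added term, at most [e * N q0] on [A], cannot make up for the excess of
   [|g z|^2] over [M^2]. *)
pose e := (nm (g z) ^+ 2 - M ^+ 2) / (2 * (N q0 + 1)).
have Me : 0 < nm (g z) ^+ 2 - M ^+ 2.
  by rewrite subr_gt0 ltr_pXn2r// ?nnegrE// nm_ge0.
have e0 : 0 < e by rewrite divr_gt0// mulr_gt0// ltr_wpDl.
have eN : e * N q0 < nm (g z) ^+ 2 - M ^+ 2.
  rewrite /e mulrAC ltr_pdivrMr ?mulr_gt0 ?ltr_wpDl//.
  by rewrite ltr_pM2l//; lra.
have [q1 /set_mem A'q1 q1max] := compact_EVT_max A0 cA (wcnt e).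
have q1M w : A w -> nm (g w) ^+ 2 + e * nm w ^+ 2 <=
    nm (g (q1.1 +i* q1.2)) ^+ 2 + e * nm (q1.1 +i* q1.2) ^+ 2.
  move=> Aw; have := q1max (Re w, Im w).
  by rewrite -zE; apply; apply/mem_set; rewrite /A' /= -zE.
set w1 := q1.1 +i* q1.2 in q1M.
have Aw1 : A w1 by [].
have [Ow1|nO] := pselect (O w1).
  have [nA sg] := gO _ Aw1 Ow1.
  have [w Aw] := smooth_not_local_max sg nA e0.
  by rewrite ltNge q1M.
have := q1M _ Az; have := gM _ Aw1 nO => gwM.
have : e * nm w1 ^+ 2 <= e * N q0 by rewrite ler_pM2l// Nmax.
have : nm (g w1) ^+ 2 <= M ^+ 2 by rewrite ler_pXn2r ?nnegrE// nm_ge0.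
have : 0 <= e * nm z ^+ 2 by rewrite mulr_ge0 ?sqr_ge0// ltW.
lra.
Qed.

Lemma closed_nm_le (x : R) : closed [set q : R * R | nm (q.1 +i* q.2) <= x].
Proof.
apply: (@closed_comp _ _ (fun q : R * R => nm (q.1 +i* q.2)) [set y | y <= x]).
  by move=> q _; exact: cvg_comp (@cpair_continuous q) (@nm_continuous _).
exact: closed_le.
Qed.

Lemma compact_disc (x : R) : compact [set q : R * R | nm (q.1 +i* q.2) <= x].
Proof.
apply: (@subclosed_compact _ _ (`[- x, x] `*` `[- x, x])).
- exact: closed_nm_le.
- by apply: compact_setX; exact: segment_compact.
- move=> [a b] /= ab; rewrite !in_itv/= -!ler_norml.
  by split; apply: le_trans ab; [exact: (Re_le_nm (a +i* b))|exact: (Im_le_nm (a +i* b))].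
Qed.

Lemma nbhs_nm_lt (z : C) (x : R) : nm z < x -> nbhs z [set w : C | nm w < x].
Proof.
move=> zx; apply/cnbhsP; exists (x - nm z); first by rewrite subr_gt0.
by move=> w wz /=; rewrite (le_lt_trans (nm_dist w z))// -ltrBrDl.
Qed.

Lemma maximum_disc (g : C -> C) (x M : R) : 0 <= M ->
  (forall z m, nm z <= x -> smooth m g z) ->
  (forall z, nm z = x -> nm (g z) <= M) ->
  forall z, nm z <= x -> nm (g z) <= M.
Proof.
move=> M0 sg gM.
apply: (@maximum_principle g _ [set w | nm w < x] M M0 (@compact_disc x)).
- by move=> z zx; apply: (@smooth_continuous _ 0); exact: sg.
- move=> z zx zx'; split; last exact: sg.
  by apply: filterS (nbhs_nm_lt zx') => w /= /ltW.
- move=> z /= zx zx'; apply: gM; apply/eqP; rewrite eq_le zx leNgt.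
  exact/negP.
Qed.

Lemma maximum_rectangle (g : C -> C) (x y M : R) : 0 <= M ->
  (forall z m, smooth m g z) ->
  (forall a b, `|a| <= x -> `|b| <= y -> `|a| = x \/ `|b| = y ->
    nm (g (a +i* b)) <= M) ->
  forall a b, `|a| <= x -> `|b| <= y -> nm (g (a +i* b)) <= M.
Proof.
move=> M0 sg gM a b ax byy.
pose A := [set w : C | `|Re w| <= x /\ `|Im w| <= y].
pose O := [set w : C | `|Re w| < x /\ `|Im w| < y].
apply: (@maximum_principle g A O M M0) => //.
- have -> : [set q : R * R | A (q.1 +i* q.2)] = `[- x, x] `*` `[- y, y].
    by apply/seteqP; split => -[p q] /=; rewrite /A/= !in_itv/= -!ler_norml.
  by apply: compact_setX; exact: segment_compact.
- by move=> z _; exact: (@smooth_continuous _ 0).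
- move=> z _ [zx zy]; split; last exact: sg.
  apply/cnbhsP; exists (Num.min (x - `|Re z|) (y - `|Im z|)).
    by rewrite lt_min !subr_gt0 zx zy.
  move=> w; rewrite lt_min => /andP[wx wy]; split.
    rewrite -(subrK (Re z) (Re w)) (le_trans (ler_normD _ _))//.
    rewrite -lerBrDr (le_trans _ (ltW wx))// (le_trans _ (Re_le_nm _))//.
    by case: (w) (z) => ? ? [].
  rewrite -(subrK (Im z) (Im w)) (le_trans (ler_normD _ _))//.
  rewrite -lerBrDr (le_trans _ (ltW wy))// (le_trans _ (Im_le_nm _))//.
  by case: (w) (z) => ? ? [].
- move=> [c d] [/= cx dy] nO; apply: gM => //.
  have [cx'|cx'] := eqVneq `|c| x; first by left.
  right; apply/eqP; rewrite eq_le dy leNgt; apply/negP => dy'; apply: nO.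
  by split => //=; rewrite lt_neqAle cx' cx.
Qed.

End ComplexModulus.

(** * The complex exponential and its Taylor remainders *)

Section ComplexExp.
Variable R : realType.
Local Notation C := (cplx R).
Implicit Types z w h : R[i].

Definition cexp z : R[i] :=
  (expR (Re z) * cos (Im z)) +i* (expR (Re z) * sin (Im z)).

Lemma cexpD z w : cexp (z + w) = cexp z * cexp w.
Proof.
case: z w => [a b] [c d]; rewrite /cexp /= expRD cosD sinD.
by complex_ring.
Qed.

Lemma cexp0 : cexp 0 = 1.
Proof. by rewrite /cexp /= expR0 cos0 sin0 mulr1 mulr0. Qed.

Lemma nm_cexp z : nm (cexp z) = expR (Re z).
Proof.
rewrite /= !exprMn -mulrDr cos2Dsin2 mulr1 sqrtr_sqr ger0_norm//.
Qed.

Lemma cexp_neq0 z : cexp z != 0.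
Proof. by rewrite -nm_gt0 nm_cexp expR_gt0. Qed.

Lemma cexp_conj z : (cexp z)^* = cexp z^*.
Proof. by case: z => a b; rewrite /cexp /= cosN sinN mulrN. Qed.

Lemma cexp_expi (x : R) : cexp x *i = expi x.
Proof. by rewrite /cexp /expi /= expR0 !mul1r. Qed.

Lemma is_derive_expRl (a x : R) :
  is_derive x 1 (fun t => expR (t * a)) (a * expR (x * a)).
Proof.
have := @is_derive1_comp R expR (fun t => t * a) x _ _ (is_derive_expR _)
  (@is_deriveM _ _ id (cst a) x 1 _ _ (is_derive_id _ _) (is_derive_cst _ _ _)).
by move/is_derive_eq; apply; rewrite scaler0 add0r /= [_ *: _]mulr1 mulrC.
Qed.

Lemma is_derive_cosl (a x : R) :
  is_derive x 1 (fun t => cos (t * a)) (- a * sin (x * a)).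
Proof.
have := @is_derive1_comp R cos (fun t => t * a) x _ _ (is_derive_cos _)
  (@is_deriveM _ _ id (cst a) x 1 _ _ (is_derive_id _ _) (is_derive_cst _ _ _)).
by move/is_derive_eq; apply; rewrite scaler0 add0r /= [_ *: _]mulr1 mulrC mulrN mulNr.
Qed.

Lemma is_derive_sinl (a x : R) :
  is_derive x 1 (fun t => sin (t * a)) (a * cos (x * a)).
Proof.
have := @is_derive1_comp R sin (fun t => t * a) x _ _ (is_derive_sin _)
  (@is_deriveM _ _ id (cst a) x 1 _ _ (is_derive_id _ _) (is_derive_cst _ _ _)).
by move/is_derive_eq; apply; rewrite scaler0 add0r /= [_ *: _]mulr1 mulrC.
Qed.

Lemma is_derive_Xl (a x : R) n :
  is_derive x 1 (fun t => t ^+ n.+1 * a) (n.+1%:R * x ^+ n * a).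
Proof.
have idX : is_derive x 1 (fun t : R => t ^+ n.+1) (n.+1%:R * x ^+ n).
  have := @is_deriveX _ _ id n.+1 x 1 _ (is_derive_id _ _).
  rewrite (_ : id ^+ _ = fun t : R => t ^+ n.+1)%R; last first.
    by apply/funext => t; rewrite exprfctE.
  by move/is_derive_eq; apply; rewrite /= [_ *: _]mulr1.
have := @is_deriveM _ _ _ (cst a) x 1 _ _ idX (is_derive_cst _ _ _).
by move/is_derive_eq; apply; rewrite scaler0 add0r /= [_ *: _]mulrC.
Qed.

Definition is_cderive (u : R -> R[i]) (t : R) (d : R[i]) : Prop :=
  is_derive t 1 (fun s => Re (u s)) (Re d) /\
  is_derive t 1 (fun s => Im (u s)) (Im d).

Lemma is_cderive_cexp h t :
  is_cderive (fun s => cexp (s%:C * h)) t (h * cexp (t%:C * h)).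
Proof.
case: h => a b; split => /=.
  rewrite (_ : (fun s => _) = (fun s => expR (s * a)) * (fun s => cos (s * b))).
    have := is_deriveM (is_derive_expRl a t) (is_derive_cosl b t).
    move/is_derive_eq; apply.
    by rewrite !mul0r subr0 addr0 /GRing.scale/=; ring.
  by apply/funext => s; rewrite !mul0r subr0 addr0.
rewrite (_ : (fun s => _) = (fun s => expR (s * a)) * (fun s => sin (s * b))).
  have := is_deriveM (is_derive_expRl a t) (is_derive_sinl b t).
    move/is_derive_eq; apply.
  by rewrite !mul0r subr0 addr0 /GRing.scale/=; ring.
by apply/funext => s; rewrite !mul0r subr0 addr0.
Qed.

Lemma is_cderiveB (u v : R -> R[i]) t d e :
  is_cderive u t d -> is_cderive v t e -> is_cderive (fun s => u s - v s) t (d - e).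
Proof.
have ReB z w : Re (z - w) = Re z - Re w by case: z w => ? ? [].
have ImB z w : Im (z - w) = Im z - Im w by case: z w => ? ? [].
move=> [u1 u2] [v1 v2]; split.
  rewrite ReB (_ : (fun s => _) = (fun s => Re (u s)) - (fun s => Re (v s))).
    exact: is_deriveB u1 v1.
  by apply/funext => s; rewrite ReB.
rewrite ImB (_ : (fun s => _) = (fun s => Im (u s)) - (fun s => Im (v s))).
  exact: is_deriveB u2 v2.
by apply/funext => s; rewrite ImB.
Qed.

Lemma is_cderive_X (c : R[i]) t n :
  is_cderive (fun s => (s ^+ n.+1)%:C * c) t ((n.+1%:R * t ^+ n)%:C * c).
Proof.
case: c => a b; split => /=.
  rewrite (_ : (fun s => _) = (fun s => s ^+ n.+1 * a)).
    by rewrite mul0r subr0; exact: is_derive_Xl.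
  by apply/funext => s; rewrite mul0r subr0.
rewrite (_ : (fun s => _) = (fun s => s ^+ n.+1 * b)).
  by rewrite mul0r addr0; exact: is_derive_Xl.
by apply/funext => s; rewrite mul0r addr0.
Qed.

Lemma mean_value_bound (f df : R -> R) (M : R) :
  (forall x : R, is_derive x 1 f (df x)) ->
  (forall x, 0 <= x <= 1 -> `|df x| <= M) -> f 0 = 0 ->
  forall t, 0 <= t <= 1 -> `|f t| <= M.
Proof.
move=> fd dM f0 t /andP[t0 t1].
have cf : {within `[0, t], continuous f}.
  apply: derivable_within_continuous => x _.
  exact: (@ex_derive _ _ _ _ _ _ _ (fd x)).
have [c] := @MVT_segment R f df 0 t t0 (fun x _ => fd x) cf.
rewrite in_itv /= f0 !subr0 => /andP[c0 ct] ->.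
rewrite normrM (ger0_norm t0).
have dc : `|df c| <= M by apply: dM; rewrite c0 (le_trans ct).
by rewrite -[leRHS]mulr1 ler_pM.
Qed.

(** The Taylor remainder of s -> exp(s h). In this form the derivative of the remainder of order m +
    1 is [h] times the one of order m, see [is_cderive_exp_rem]. *)
Fixpoint exp_rem (m : nat) (h : R[i]) (t : R) : R[i] :=
  if m is m'.+1 then exp_rem m' h t - (t ^+ m')%:C * (h ^+ m' / m'`!%:R)
  else cexp (t%:C * h).

Lemma exp_remE m h t :
  exp_rem m h t = cexp (t%:C * h) - \sum_(k < m) (t%:C * h) ^+ k / k`!%:R.
Proof.
elim: m => [|m IH] /=; first by rewrite big_ord0 subr0.
rewrite IH big_ord_recr /= opprD addrA; congr (_ - _).
by rewrite exprMn rmorphXn /= mulrA.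
Qed.

Lemma exp_rem0 m h : exp_rem m.+1 h 0 = 0.
Proof.
rewrite exp_remE mul0r cexp0 big_ord_recl big1 /=.
  by rewrite expr0 fact0 divr1 addr0 subrr.
by move=> i _; rewrite exprS !mul0r.
Qed.

Lemma is_cderive_exp_rem m h t :
  is_cderive (exp_rem m.+1 h) t (h * exp_rem m h t).
Proof.
elim: m => [|m IH].
  have -> : h * exp_rem 0 h t = h * cexp (t%:C * h) - 0 by rewrite subr0.
  apply: is_cderiveB; first exact: is_cderive_cexp.
  rewrite (_ : (fun s : R => (s ^+ 0)%:C * _) = fun=> 1).
    by split; exact: is_derive_cst.
  by apply/funext => s; rewrite !expr0 fact0 divr1 mulr1.
rewrite [X in is_cderive _ _ X](_ : _ =
    h * exp_rem m h t - (m.+1%:R * t ^+ m)%:C * (h ^+ m.+1 / m.+1`!%:R)).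
  by apply: is_cderiveB => //; exact: is_cderive_X.
rewrite /= mulrBr; congr (_ - _); rewrite rmorphM /= rmorph_nat factS natrM exprS.
have a0 : (m.+1%:R : R[i]) != 0 by rewrite pnatr_eq0.
have b0 : (m`!%:R : R[i]) != 0 by rewrite pnatr_eq0 -lt0n fact_gt0.
move: a0 b0 (t ^+ m)%:C (h ^+ m); set a := m.+1%:R; set b := m`!%:R.
move: a b => a b a0 b0 c d; by field; rewrite a0 b0.
Qed.

(** The mean value theorem is applied to real and imaginary parts separately, whence a factor 2 at
    each order. No factorial is gained; only the power of [nm h] is needed. *)
Lemma exp_rem_bound m h t : 0 <= t <= 1 ->
  nm (exp_rem m h t) <= (2 * nm h) ^+ m * expR (nm h).
Proof.
have n0 := nm_ge0 h.
elim: m t => [|m IH] t t01.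
  rewrite expr0 mul1r [exp_rem _ _ _]/(cexp _) nm_cexp ler_expR.
  have : Re (t%:C * h) = t * Re h.
    by case: (h) => a b /=; rewrite mul0r subr0.
  move=> ->; case/andP: t01 => t0 t1.
  rewrite (le_trans (ler_norm _))// normrM (ger0_norm t0).
  by rewrite -[leRHS]mul1r ler_pM// Re_le_nm.
pose M := nm h * ((2 * nm h) ^+ m * expR (nm h)).
have dM x : 0 <= x <= 1 -> nm (h * exp_rem m h x) <= M.
  by move=> x01; rewrite nmM ler_wpM2l// IH.
have RM : `|Re (exp_rem m.+1 h t)| <= M.
  apply: (@mean_value_bound (fun t => Re (exp_rem m.+1 h t))
    (fun t => Re (h * exp_rem m h t))) t01 => //.
  - by move=> x; case: (is_cderive_exp_rem m h x).
  - by move=> x x01; rewrite (le_trans (Re_le_nm _))// dM.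
  - by rewrite exp_rem0.
have IM : `|Im (exp_rem m.+1 h t)| <= M.
  apply: (@mean_value_bound (fun t => Im (exp_rem m.+1 h t))
    (fun t => Im (h * exp_rem m h t))) t01 => //.
  - by move=> x; case: (is_cderive_exp_rem m h x).
  - by move=> x x01; rewrite (le_trans (Im_le_nm _))// dM.
  - by rewrite exp_rem0.
rewrite (le_trans (nm_le_ReIm _))// (le_trans (lerD RM IM))//.
by rewrite exprS /M le_eqVlt; apply/orP; left; apply/eqP; ring.
Qed.

Lemma cexp_taylor m h :
  nm (cexp h - \sum_(k < m) h ^+ k / k`!%:R) <= (2 * nm h) ^+ m * expR (nm h).
Proof.
by have := @exp_rem_bound m h 1; rewrite exp_remE mul1r; apply; rewrite ler01 lexx.
Qed.

(** The divided difference at [z] satisfies the same estimate with the coefficients shifted by one,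
    so the induction passes to it. This is how differentiability is proved for functions that are
    not built from differentiable ones, such as Fourier transforms. *)
Lemma taylor_smooth m (g : C -> C) (z : C) (a : nat -> R[i]) (A : R) :
  (forall h, nm h <= 1 ->
    nm (g (z + h) - \sum_(k < m.+1) a k * h ^+ k) <= A * nm h ^+ m.+1) ->
  smooth m g z.
Proof.
elim: m g a => [|m IH] g a gA.
  have gz : g z = a 0%N.
    have := gA 0; rewrite nm0 ler01 => /(_ isT).
    rewrite big_ord1 expr0 mulr1 addr0 expr1 mulr0 => g0.
    by apply/eqP; rewrite -subr_eq0 -nm_eq0 eq_le g0 nm_ge0.
  apply/nm_nbhs_continuous => e e0; apply/cnbhsP.
  exists (Num.min 1 (e / (`|A| + 1))).
    by rewrite lt_min ltr01 divr_gt0// ltr_wpDl.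
  move=> w; rewrite lt_min => /andP[/ltW w1].
  rewrite ltr_pdivlMr ?ltr_wpDl// => wA.
  have := gA (w - z) w1; rewrite big_ord1 expr0 mulr1 expr1 [z + _]addrC subrK gz.
  move=> /le_lt_trans; apply; apply: le_lt_trans wA.
  rewrite mulrC ler_wpM2l ?nm_ge0// (le_trans (ler_norm _))//; lra.
have gz : g z = a 0%N.
  have := gA 0; rewrite nm0 ler01 => /(_ isT).
  rewrite big_ord_recl expr0 mulr1 addr0 exprS mul0r mulr0 big1 ?addr0 => [g0|].
    by apply/eqP; rewrite -subr_eq0 -nm_eq0 eq_le g0 nm_ge0.
  by move=> i _; rewrite /= exprS mul0r mulr0.
pose q (w : C) : C := if w == z then a 1%N else (g w - a 0%N) / (w - z).
exists q; split.
  near=> w; rewrite /q; have [->|wz] := eqVneq w z; first by rewrite subrr mul0r addr0.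
  by rewrite [_ * (_ / _)]mulrC divfK ?subr_eq0// gz addrC subrK.
apply: (IH q (fun k => a k.+1)) => h h1.
have [->|h0] := eqVneq h 0.
  rewrite /q addr0 eqxx big_ord_recl expr0 mulr1 big1 ?addr0 ?subrr ?nm0.
    by rewrite expr0n mulr0.
  by move=> i _; rewrite /= exprS mul0r mulr0.
rewrite /q; have -> : (z + h == z) = false.
  by apply/negbTE; rewrite -subr_eq0 addrAC subrr add0r.
have hh : z + h - z = h by rewrite addrAC subrr add0r.
rewrite hh -(@ler_pM2r _ (nm h)) ?nm_gt0// -nmM mulrBl divfK//.
have := gA h h1; rewrite big_ord_recl expr0 mulr1 opprD addrA.
rewrite mulr_suml (eq_bigr (fun i : 'I_m.+1 => a i.+1 * h ^+ i * h)).
  by rewrite -mulrA -exprSr.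
by move=> i _; rewrite /= exprSr mulrA.
Unshelve. all: by end_near. Qed.

Lemma smooth_cexp m (z : C) : smooth m (cexp : C -> C) z.
Proof.
apply: (@taylor_smooth _ _ _ (fun k => cexp z / k`!%:R)
  (expR (Re z) * (2 ^+ m.+1 * expR 1))) => h h1.
have -> : cexp (z + h) - \sum_(k < m.+1) cexp z / k`!%:R * h ^+ k =
    cexp z * (cexp h - \sum_(k < m.+1) h ^+ k / k`!%:R).
  rewrite cexpD mulrBr mulr_sumr; congr (_ - _); apply: eq_bigr => i _.
  by rewrite mulrAC mulrA.
rewrite nmM nm_cexp -mulrA ler_wpM2l ?expR_ge0//.
rewrite (le_trans (cexp_taylor _ _))// exprMn mulrAC ler_wpM2r ?exprn_ge0 ?nm_ge0//.
by rewrite ler_wpM2l ?exprn_ge0// ler_expR.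
Qed.

End ComplexExp.

(** * Entire functions: Liouville's theorem and the identity theorem *)

Section Entire.
Variable R : realType.
Local Notation C := (cplx R).
Implicit Types z w h : R[i].

Definition entire (F : R[i] -> R[i]) : Prop :=
  forall z m, smooth (K := C) m F z.

Lemma growth_ge0 (F : R[i] -> R[i]) (C0 tau : R) :
  (forall z, nm (F z) <= C0 * expR (tau * `|Im z|)) -> 0 <= C0.
Proof. by move=> /(_ 0)/(le_trans (nm_ge0 _)); rewrite pmulr_lge0// expR_gt0. Qed.

Lemma divide_linear (F : R[i] -> R[i]) a : entire F -> F a = 0 ->
  exists2 G, entire G & forall z, F z = (z - a) * G z.
Proof.
move=> eF Fa.
have eS : forall z m, smooth (K := C) m (fun z => z - a) z.
  by move=> z m; apply: smoothB; [exact: smooth_id|exact: smooth_cst].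
have [|G [FG sG]] := @division C setT F (fun z => z - a)
  (fun z m _ => eF z m) (fun z m _ => eS z m).
  move=> z _ /eqP; rewrite subr_eq0 => /eqP ->; split => //.
  exists (fun=> 1); split; [exact: cst_continuous|exact: oner_neq0|].
  by near=> w; rewrite mulr1.
by exists G => [z m|z]; [exact: sG|exact: FG].
Unshelve. all: by end_near. Qed.

Lemma entire_shift (F : R[i] -> R[i]) a : entire F -> entire (fun z => F (a + z)).
Proof.
move=> eF z m; apply: (@smooth_comp C m (fun z => a + z) F) => //.
by apply: smoothD; [exact: smooth_cst|exact: smooth_id].
Qed.

Lemma maximum_entire (F : R[i] -> R[i]) a (x M : R) : 0 <= M -> entire F ->
  (forall z, nm (z - a) = x -> nm (F z) <= M) ->
  forall z, nm (z - a) <= x -> nm (F z) <= M.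
Proof.
move=> M0 eF FM z zx.
have := @maximum_disc R (fun z => F (a + z)) x M M0.
have aE w : F w = F (a + (w - a)) by rewrite addrC subrK.
rewrite aE; apply => // [w m _|w wx]; first exact: entire_shift.
by apply: FM; rewrite addrAC subrr add0r.
Qed.

Lemma entire_bounded_disc (F : R[i] -> R[i]) (x : R) : entire F ->
  exists2 M, 0 <= M & forall z, nm z <= x -> nm (F z) <= M.
Proof.
move=> eF; have [x0|x0] := ltP x 0.
  by exists 0 => // z zx; have := nm_ge0 z; lra.
have A0 : [set q : R * R | nm (q.1 +i* q.2) <= x] !=set0.
  by exists (0, 0) => /=; rewrite !expr0n addr0 sqrtr0.
have cF : {within [set q : R * R | nm (q.1 +i* q.2) <= x],
    continuous (fun q : R * R => nm (F (q.1 +i* q.2)))}.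
  apply: continuous_in_subspaceT => q _.
  have c3 : (F : C -> C) (p.1 +i* p.2) @[p --> q] --> (F (q.1 +i* q.2) : C).
    exact: cvg_comp (@cpair_continuous R q) (eF (q.1 +i* q.2) 0%N).
  exact: cvg_comp c3 (@nm_continuous _ _).
have [c _ cM] := compact_EVT_max A0 (@compact_disc R x) cF.
exists (nm (F (c.1 +i* c.2))) => [|[a b] zx]; first exact: nm_ge0.
by apply: (cM (a, b)); apply/mem_set.
Qed.

Lemma nm_le_eps_eq0 z : (forall e : R, 0 < e -> nm z <= e) -> z = 0.
Proof.
move=> ze; apply/eqP; rewrite -nm_eq0 eq_le nm_ge0 andbT.
by apply/ler_addgt0Pl => e e0; rewrite addr0; exact: ze.
Qed.

Lemma liouville (F : R[i] -> R[i]) (M : R) : entire F ->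
  (forall z, nm (F z) <= M) -> forall z, F z = F 0.
Proof.
move=> eF FM z.
have M0 : 0 <= M by rewrite (le_trans (nm_ge0 _) (FM 0)).
have eF0 : entire (fun z => F z - F 0).
  by move=> w m; apply: smoothB; [exact: eF|exact: smooth_cst].
have [|G eG FG] := @divide_linear _ 0 eF0; first by rewrite subrr.
suff G0 : G z = 0 by apply/eqP; rewrite -subr_eq0 FG G0 mulr0.
apply: nm_le_eps_eq0 => e e0.
(* A circle around 0 that encloses [z] and on which the quotient [G] of F - F(0) by z is at most 2 M
   / x <= e. *)
pose x := nm z + 2 * M / e + 1.
have nz := nm_ge0 z.
have x0 : 0 < x by rewrite /x ltr_wpDl// addr_ge0// divr_ge0 ?mulr_ge0// ltW.
apply: (@maximum_entire G 0 x e) => //; first exact: ltW.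
  move=> w; rewrite subr0 => wx.
  rewrite -(@ler_pM2l _ x)// -{1}wx -nmM -[X in nm (X * _)]subr0 -FG.
  rewrite (le_trans (nmB _ _))// (le_trans (lerD (FM w) (FM 0)))//.
  rewrite -ler_pdivrMr// /x.
  have : M + M = 2 * M by ring.
  lra.
rewrite subr0 /x -addrA lerDl addr_ge0// divr_ge0 ?mulr_ge0//; exact: ltW.
Qed.

Lemma liouville0 (F : R[i] -> R[i]) (M : R) : entire F ->
  (forall z, nm (F z) <= M) ->
  (forall e : R, 0 < e -> exists z, nm (F z) <= e) -> forall z, F z = 0.
Proof.
move=> eF FM Fe z; apply: nm_le_eps_eq0 => e /Fe[w].
by rewrite (liouville eF FM z) (liouville eF FM w).
Qed.

(** An accumulation point of zeros can be divided out any number of times, F = (z - a)^N G. The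
    maximum principle for [G] on a circle of radius more than twice |z - a| then gives |F(z)| <=
    2^-N M for all N. *)
Lemma identity_theorem (F : R[i] -> R[i]) a : entire F ->
  (forall e : R, 0 < e -> exists w, [/\ w != a, nm (w - a) < e & F w = 0]) ->
  forall z, F z = 0.
Proof.
move=> eF Fa z.
have FN N : exists2 G, entire G & forall z, F z = (z - a) ^+ N * G z.
  elim: N => [|N [G eG FG]]; first by exists F => // w; rewrite expr0 mul1r.
  have G0 : G a = 0.
    apply: nm_le_eps_eq0 => e e0.
    have /nm_nbhs_continuous/(_ e e0) := eG a 0%N.
    move=> /cnbhsP[d d0 dG]; have [w [wa wd Fw]] := Fa d d0.
    have : G w = 0.
      apply/eqP; move/eqP : Fw; rewrite FG mulf_eq0 expf_eq0 subr_eq0.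
      by rewrite (negbTE wa) andbF.
    by move=> Gw; have := dG w wd; rewrite Gw sub0r nmN => /ltW.
  have [G' eG' GG'] := divide_linear eG G0.
  by exists G' => // w; rewrite FG GG' mulrA -exprSr.
pose x := nm (z - a); have x0 : 0 <= x := nm_ge0 _.
have [M M0 FM] := @entire_bounded_disc _ (nm a + (2 * x + 1)) eF.
have FzN N : nm (F z) <= 2^-1 ^+ N * M.
  have [G eG FG] := FN N.
  have y0 : 0 < 2 * x + 1 by rewrite ltr_wpDl// mulr_ge0.
  have GM : nm (G z) <= M / (2 * x + 1) ^+ N.
    apply: (@maximum_entire G a (2 * x + 1)) => //.
    - by rewrite divr_ge0// exprn_ge0// ltW.
    - move=> w wx; rewrite ler_pdivlMr ?exprn_gt0// mulrC -wx -nmX -nmM -FG.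
      by apply: FM; rewrite (le_trans (nm_dist w a))// wx.
    - rewrite -/x; lra.
  rewrite FG nmM nmX -/x (le_trans (ler_wpM2l _ GM)) ?exprn_ge0//.
  rewrite mulrCA mulrC ler_wpM2r// -exprVn -exprMn lerXn2r ?nnegrE//.
    by rewrite divr_ge0// ltW.
  by rewrite ler_pdivrMr//; lra.
apply: nm_le_eps_eq0 => e e0.
have h : `|2^-1 : R| < 1 by rewrite ger0_norm//; lra.
have M1 : 0 < M + 1 by rewrite ltr_wpDl.
have e1 : 0 < e / (M + 1) by rewrite divr_gt0.
have /cvgr0Pnorm_lt /(_ _ e1) [n0 _ /(_ n0 (leqnn _))] /= := cvg_expr h.
rewrite ltr_pdivlMr// => He; rewrite (le_trans (FzN n0))// (le_trans _ (ltW He))//.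
by rewrite ler_pM ?exprn_ge0// ?ler_norm//; lra.
Qed.

End Entire.

(** * Zeros on a lattice *)

Section Lattice.
Variable R : realType.
Local Notation C := (cplx R).
Implicit Types z w h : R[i].

Lemma sin_intpi (k : int) : sin (k%:~R * pi) = 0 :> R.
Proof.
have nat_case (n : nat) : sin (n%:R * pi) = 0 :> R.
  elim: n => [|n IH]; first by rewrite mul0r sin0.
  by rewrite -addn1 natrD mulrDl mul1r sinDpi IH oppr0.
case: k => n; first exact: nat_case.
by rewrite NegzE mulrNz mulNr sinN nat_case oppr0.
Qed.

Lemma sin_eq0 (u : R) : sin u = 0 -> exists k : int, u = k%:~R * pi.
Proof.
move=> su; exists (Num.floor (u / pi)); set k := Num.floor _.
have /andP[] := floor_itv (u / pi); rewrite -/k.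
have pi0 := pi_gt0 R.
rewrite ler_pdivlMr// ltr_pdivrMr// intrD mulrDl mul1r => k1 k2.
have : sin (u - k%:~R * pi) = 0 by rewrite sinB su sin_intpi mul0r mulr0 subrr.
move=> s0; apply/eqP; rewrite -subr_eq0 eq_le subr_ge0 k1 andbT leNgt.
apply/negP => uk; have : 0 < sin (u - k%:~R * pi).
  by apply: sin_gt0_pi; rewrite uk ltrBlDl.
by rewrite s0 ltxx.
Qed.

(* [csin w = 2i sin w] *)
Definition csin w : R[i] := cexp (w * 'i) - cexp (- (w * 'i)).

Lemma csinE (u v : R) : csin (u +i* v) =
  (cos u * (expR (- v) - expR v)) +i* (sin u * (expR (- v) + expR v)).
Proof.
rewrite /csin /cexp /= !(mulr0, mulr1, sub0r, add0r, addr0) opprK sinN cosN.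
by complex_ring.
Qed.

Lemma csin_eq0 w : csin w = 0 -> exists k : int, w = (k%:~R * pi)%:C.
Proof.
case: w => u v; rewrite csinE => -[]; have := cos2Dsin2 u => cs c0 s0.
have e0 : 0 < expR (- v) + expR v by rewrite addr_gt0 ?expR_gt0.
have su : sin u = 0.
  by apply/eqP; move/eqP: s0; rewrite mulf_eq0 (gt_eqF e0) orbF.
have cu : cos u != 0.
  apply/eqP => c; move: cs; rewrite su c expr0n addr0 => /eqP.
  by rewrite eq_sym oner_eq0.
have [k ->] := sin_eq0 su; exists k.
suff -> : v = 0 by [].
move/eqP: c0; rewrite mulf_eq0 (negbTE cu)/= subr_eq0 => /eqP/expR_inj.
lra.
Qed.

Lemma cexp_slope : exists p : R[i] -> R[i], [/\ {for (0 : C), continuous (p : C -> C)},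
  p 0 = 1 & forall h, cexp h = 1 + h * p h].
Proof.
exists (fun h => if h == 0 then 1 else (cexp h - 1) / h); split => [||h]; last 2 first.
- by rewrite eqxx.
- have [->|h0] := eqVneq; first by rewrite cexp0 mul0r addr0.
  by rewrite mulrC divfK// addrC subrK.
apply: (@taylor_smooth R 0 _ _ (fun=> 1) (4 * expR 1)) => h h1.
rewrite add0r big_ord1 mul1r expr0 expr1; have [->|h0] := eqVneq h 0.
  by rewrite subrr nm0 mulr0.
have hE : (cexp h - 1) / h - 1 = (cexp h - \sum_(k < 2) h ^+ k / k`!%:R) / h.
  by rewrite !big_ord_recl big_ord0 /= expr0 expr1 fact0 factS fact0 !divr1; field.
rewrite hE nmM nmV ler_pdivrMr ?nm_gt0//.
rewrite (le_trans (cexp_taylor 2 h))// exprMn.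
have -> : 4 * expR 1 * nm h * nm h = 2 ^+ 2 * nm h ^+ 2 * expR 1 by ring.
by rewrite ler_wpM2l ?mulr_ge0 ?exprn_ge0 ?nm_ge0// ler_expR.
Qed.

(** At a zero the two exponentials agree, so they can be factored out; with h = w - z what remains
    is exp(c h) - exp(- c h), of slope 2 c at h = 0. *)
Lemma csin_simple_zero (t : R) (a z : R[i]) : t != 0 ->
  csin (t%:C * (z - a)) = 0 ->
  exists q : C -> C, [/\ {for z, continuous q}, q z != 0 &
    \forall w \near (z : C), csin (t%:C * (w - a)) = (w - z) * q w].
Proof.
move=> t0 sz; have [p [cp p0 pE]] := cexp_slope.
pose c := t%:C * 'i.
have ez : cexp (- (t%:C * (z - a) * 'i)) = cexp (t%:C * (z - a) * 'i).
  by apply/esym/eqP; rewrite -subr_eq0; apply/eqP.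
pose q (w : C) : C := cexp (t%:C * (z - a) * 'i) * (c * (p (c * (w - z)) + p (- c * (w - z)))).
have lin (d : R[i]) : {for (z : C), continuous (fun w : C => d * (w - z) : C)}.
  apply: (@smooth_continuous C 0); apply: smoothM; first exact: smooth_cst.
  by apply: smoothB; [exact: smooth_id|exact: smooth_cst].
have cpl (d : R[i]) : {for (z : C), continuous (fun w : C => p (d * (w - z)) : C)}.
  apply: (@continuous_comp _ _ _ (fun w : C => d * (w - z) : C) (p : C -> C)).
    exact: lin.
  by rewrite /= subrr mulr0.
have c0 : c != 0 by rewrite -nm_gt0 nmM nm_real nm_i mulr1 normr_gt0.
exists q; split.
- apply: continuousM; first exact: cst_continuous.
  by apply: continuousM; [exact: cst_continuous|apply: continuousD; exact: cpl].
- have -> : q z = cexp (t%:C * (z - a) * 'i) * (c * 2%:R).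
    by rewrite /q subrr !mulr0 p0.
  apply: mulf_neq0; first exact: cexp_neq0.
  by apply: mulf_neq0; [exact: c0|rewrite pnatr_eq0].
- near=> w; rewrite /csin /q.
  have -> : t%:C * (w - a) * 'i = t%:C * (z - a) * 'i + c * (w - z) by rewrite /c; ring.
  rewrite opprD !cexpD ez -[- (c * _)]mulNr (pE (c * _)) (pE (- c * _)); ring.
Unshelve. all: by end_near. Qed.

(** Divide by the sine [S] that vanishes on the lattice. On the boundary of suitable rectangles |S|
    is at least half of exp(t |Im z|), so the quotient is bounded, hence constant. When
    [tau * beta = pi] the sine itself meets the growth bound and vanishes on the lattice; the decay
    along the imaginary axis makes the constant 0. *)
Lemma lattice_zero (F : R[i] -> R[i]) (C0 tau beta a : R) :
  entire F -> 0 < beta -> 0 <= tau -> tau * beta <= pi ->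
  (forall z, nm (F z) <= C0 * expR (tau * `|Im z|)) ->
  (forall k : int, F (a + k%:~R * beta)%:C = 0) ->
  (forall e : R, 0 < e -> \forall n \near \oo,
     nm (F n%:R *i) <= e * expR (tau * n%:R)) ->
  forall z, F z = 0.
Proof.
move=> eF b0 tau0 tb FC Fk Finf z0.
pose t : R := pi / beta.
have pi0 := pi_gt0 R.
have t0 : 0 < t by rewrite divr_gt0.
have taut : tau <= t by rewrite ler_pdivlMr.
have C00 : 0 <= C0.
  exact: growth_ge0 FC.
pose S z : R[i] := csin (t%:C * (z - a%:C)).
have eS : entire S.
  move=> z m; apply: smoothB.
    apply: (@smooth_comp C m (fun w => t%:C * (w - a%:C) * 'i) (@cexp R)); last exact: smooth_cexp.
    apply: smoothM; last exact: smooth_cst.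
    apply: smoothM; first exact: smooth_cst.
    by apply: smoothB; [exact: smooth_id|exact: smooth_cst].
  apply: (@smooth_comp C m (fun w => - (t%:C * (w - a%:C) * 'i)) (@cexp R)); last exact: smooth_cexp.
  apply: smoothN; apply: smoothM; last exact: smooth_cst.
  apply: smoothM; first exact: smooth_cst.
  by apply: smoothB; [exact: smooth_id|exact: smooth_cst].
have SE (u v : R) : S ((a + u) +i* v) = csin ((t * u) +i* (t * v)).
  rewrite /S; congr csin; apply/eqP; rewrite eq_complex /=.
  by apply/andP; split; apply/eqP; ring.
have [|G [FG sG]] := @division C setT F S (fun z m _ => eF z m) (fun z m _ => eS z m).
  move=> z _ Sz; split; last by apply: csin_simple_zero => //; rewrite gt_eqF.
  have [k kE] := csin_eq0 Sz.
  suff -> : z = (a + k%:~R * beta)%:C by exact: Fk.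
  have tC : t%:C != 0 :> R[i] by rewrite eq_complex /= gt_eqF.
  apply: (addIr (- a%:C)); apply: (mulfI tC); rewrite kE.
  apply/eqP; rewrite eq_complex /= /t; apply/andP; split; apply/eqP; last by ring.
  by field; rewrite gt_eqF.
have eG : entire G by move=> z m; exact: sG.
have FCt z : nm (F z) <= C0 * expR (t * `|Im z|).
  by rewrite (le_trans (FC z))// ler_wpM2l// ler_expR ler_wpM2r.
have Gle (z : R[i]) (K : R) : 0 < K -> nm (F z) <= K * expR (t * `|Im z|) ->
    expR (t * `|Im z|) <= 2 * nm (S z) -> nm (G z) <= 2 * K.
  move=> K0 FK Sz.
  have e0 : 0 < expR (t * `|Im z|) := expR_gt0 _.
  have S0 : 0 < nm (S z) by lra.
  rewrite -(ler_pM2l S0) -nmM -FG// (le_trans FK)//.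
  by have := ler_wpM2l (ltW K0) Sz; lra.
have Svert (u v : R) : cos (t * u) = 0 -> expR (t * `|v|) <= 2 * nm (S ((a + u) +i* v)).
  move=> cu; rewrite SE csinE cu mul0r.
  have := cos2Dsin2 (t * u); rewrite cu expr0n add0r => /eqP; rewrite sqrf_eq1 => su.
  have -> : nm (0 +i* (sin (t * u) * (expR (- (t * v)) + expR (t * v)))) =
    expR (- (t * v)) + expR (t * v).
    rewrite /= expr0n add0r sqrtr_sqr normrM (ger0_norm (addr_ge0 (expR_ge0 _) (expR_ge0 _))).
    by case/orP : su => /eqP ->; rewrite ?normrN normr1 mul1r.
  case: (ger0P v) => [vp|vn].
    by have := expR_ge0 (- (t * v)); have := expR_ge0 (t * v); lra.
  by rewrite mulrN; have := expR_ge0 (- (t * v)); have := expR_ge0 (t * v); lra.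
have Shor (u v : R) : 1 <= t * `|v| -> expR (t * `|v|) <= 2 * nm (S ((a + u) +i* v)).
  move=> tv1.
  have E2 : 2 <= expR (t * `|v|).
    by have := expR_ge1Dx (t * `|v|); lra.
  have eN : expR (- (t * `|v|)) <= 2^-1 by rewrite expRN lef_pV2 ?posrE// expR_gt0.
  have : expR (t * `|v|) - expR (- (t * `|v|)) <= nm (S ((a + u) +i* v)).
    rewrite SE /csin.
    have ReE : Re (((t * u) +i* (t * v)) * 'i) = - (t * v) by rewrite /=; ring.
    have ReE' : Re (- (((t * u) +i* (t * v)) * 'i)) = t * v by rewrite /=; ring.
    have h1 := nm_dist (cexp (((t * u) +i* (t * v)) * 'i)) (cexp (- (((t * u) +i* (t * v)) * 'i))).
    have h2 := nm_dist (cexp (- (((t * u) +i* (t * v)) * 'i))) (cexp (((t * u) +i* (t * v)) * 'i)).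
    rewrite nmC in h2; move: h1 h2; rewrite !nm_cexp ReE ReE'.
    by case: (ger0P v) => [vp|vn]; rewrite ?mulrN ?opprK; lra.
  lra.
have GM : forall z, nm (G z) <= 2 * (C0 + 1).
  move=> z; pose u := Re z - a; pose v := Im z.
  have zE : z = a%:C + (u +i* v).
    by rewrite /u /v; case: (z) => p q /=; complex_ring.
  (* The vertical sides run halfway between lattice points, where [cos (t * x) = 0]; the horizontal
     ones have [t * y >= 1]. *)
  pose k := Num.bound (`|u| / beta); pose x := (k%:R + 2^-1) * beta.
  pose y := `|v| + t^-1.
  have ux : `|u| <= x.
    have : `|u| / beta < k%:R by apply: archi_boundP; rewrite divr_ge0// ltW.
    by rewrite ltr_pdivrMr// /x; lra.
  have vy : `|v| <= y by rewrite lerDl invr_ge0 ltW.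
  rewrite zE.
  apply: (@maximum_rectangle R (fun w => G (a%:C + w)) x y) => //.
  - by rewrite mulr_ge0// addr_ge0.
  - by move=> w m; exact: entire_shift.
  move=> p q px qy pq.
  have aE : a%:C + (p +i* q) = (a + p) +i* q by apply/eqP; rewrite eq_complex /= add0r !eqxx.
  rewrite aE; apply: Gle; first by rewrite ltr_wpDl.
    rewrite (le_trans (FCt _))//= ler_wpM2r ?expR_ge0//; lra.
  case: pq => [pq|pq] /=; last first.
    apply: Shor; rewrite pq /y mulrDr mulfV ?gt_eqF//.
    by have := mulr_ge0 (ltW t0) (normr_ge0 v); lra.
  apply: Svert.
  have cx : cos (t * x) = 0.
    have -> : t * x = k%:R * pi + pi / 2 by rewrite /t /x; field; rewrite gt_eqF.
    by rewrite cosDpihalf (sin_intpi k) oppr0.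
  by move: pq; rewrite -[x]ger0_norm ?(le_trans _ ux)// => /eqP; rewrite eqr_norm2 => /orP[/eqP ->//|/eqP ->]; rewrite mulrN cosN.
have G0 : forall z, G z = 0.
  apply: (liouville0 eG GM) => e e0.
  have e2 : 0 < e / 2 by rewrite divr_gt0.
  have [n0 _ Hn] := Finf _ e2.
  pose n := maxn n0 (Num.bound t^-1).
  exists (n%:R *i).
  have nE : (n%:R : R) *i = (a + - a) +i* n%:R by rewrite subrr.
  have -> : e = 2 * (e / 2) by field.
  apply: Gle => //.
    have /= nF := Hn n (leq_maxl _ _).
    rewrite (le_trans nF)//= ler_wpM2l ?(ltW e2)// ler_expR.
    by rewrite (@ger0_norm _ n%:R)// ler_wpM2r.
  rewrite nE; apply: Shor; rewrite ger0_norm//.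
  rewrite -ler_pdivrMl// mulr1 (le_trans (ltW (archi_boundP _)))//.
    by rewrite invr_ge0 ltW.
  by rewrite ler_nat leq_maxr.
by rewrite FG// G0 mulr0.
Qed.

End Lattice.

(** * Zeros with large upper density *)

Section Slit.
Variable R : realType.
Local Notation C := (cplx R).
Implicit Types z w h : R[i].

Lemma nm_moebius (a : R) w :
  nm (1 - a%:C * w) ^+ 2 = nm (w - a%:C) ^+ 2 + (1 - a ^+ 2) * (1 - nm w ^+ 2).
Proof. by rewrite !sqr_nm; case: w => p q /=; ring. Qed.

Definition disc_smooth (K : R[i] -> R[i]) : Prop :=
  forall z m, nm z < 1 -> smooth (K := C) m K z.

(** A Blaschke factor has modulus 1 on the unit circle, so dividing it out does not raise the bound.
    Since [K] is only given in the open disc, the maximum principle is applied on slightly smaller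
    circles, at the price of an arbitrary [e]. *)
Lemma blaschke_step (K : R[i] -> R[i]) (C0 a : R) : 0 <= C0 -> `|a| < 1 ->
  disc_smooth K -> (forall z, nm z < 1 -> nm (K z) <= C0) -> K a%:C = 0 ->
  exists K', [/\ disc_smooth K', forall z, nm z < 1 -> nm (K' z) <= C0 &
    forall z, nm z < 1 -> K z * (1 - a%:C * z) = (z - a%:C) * K' z].
Proof.
move=> C00 a1 sK KC Ka.
pose D := [set z : C | nm z < 1].
have sS : forall z m, D z -> smooth (K := C) m (fun z => z - a%:C) z.
  by move=> z m _; apply: smoothB; [exact: smooth_id|exact: smooth_cst].
have [|G [KG sG]] := @division C D K (fun z => z - a%:C) (fun z m Dz => sK z m Dz) sS.
  move=> z _ /eqP; rewrite subr_eq0 => /eqP ->; split => //.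
  exists (fun=> 1); split; [exact: cst_continuous|exact: oner_neq0|].
  by near=> w; rewrite mulr1.
pose K' z : R[i] := (1 - a%:C * z) * G z.
have sK' : disc_smooth K'.
  move=> z m z1; apply: smoothM; last exact: sG.
  apply: smoothB; first exact: smooth_cst.
  by apply: smoothM; [exact: smooth_cst|exact: smooth_id].
exists K'; split => // [|z z1]; last by rewrite /K' (KG _ z1); ring.
move=> z z1; apply/ler_addgt0Pr => e e0.
(* the Blaschke factor has modulus at least [1 - o(1)] on the circle of
   radius [1 - d] *)
pose b := (1 - `|a|) / 2; have b0 : 0 < b by rewrite divr_gt0// subr_gt0.
pose e1 := e / (C0 + 1); have C1 : 0 < C0 + 1 by rewrite ltr_wpDl.
have e10 : 0 < e1 by rewrite divr_gt0.
(* The circle of radius 1 - d must enclose [z], stay at distance at least [b] from [a], and keep the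
   inverse factor below 1 + e1. *)
pose d := Num.min (Num.min b ((1 - nm z) / 2)) (e1 * b ^+ 2).
have d0 : 0 < d.
  by rewrite !lt_min b0/= divr_gt0 ?subr_gt0//= mulr_gt0// exprn_gt0.
have db : d <= b by rewrite !ge_min lexx.
have dz : d <= (1 - nm z) / 2 by rewrite !ge_min lexx !orbT.
have de : d <= e1 * b ^+ 2 by rewrite ge_min lexx orbT.
have a0 := normr_ge0 a; have z0 := nm_ge0 z.
have Ce : C0 * (1 + e1) <= C0 + e.
  rewrite mulrDr mulr1 lerD2l /e1 mulrCA -[leRHS]mulr1 ler_wpM2l ?(ltW e0)//.
  by rewrite ler_pdivrMr// mul1r lerDl.
have Ce0 : 0 <= C0 * (1 + e1) by rewrite mulr_ge0//; lra.
apply: le_trans Ce.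
refine (@maximum_disc R K' (1 - d) _ Ce0 _ _ z _); last by lra.
  by move=> w m wd; apply: sK'; lra.
move=> w wd; have w1 : nm w < 1 by lra.
have wa : b <= nm (w - a%:C).
  have := nm_dist w a%:C; rewrite wd nm_real.
  have : `|a| = 1 - 2 * b by rewrite /b; field.
  by lra.
have wa0 : 0 < nm (w - a%:C) by lra.
have fac : nm (1 - a%:C * w) <= (1 + e1) * nm (w - a%:C).
  rewrite -(@ler_pXn2r _ 2)// ?nnegrE ?nm_ge0 ?mulr_ge0 ?nm_ge0//; last by lra.
  rewrite nm_moebius wd exprMn.
  have h1 : (1 - a ^+ 2) * (1 - (1 - d) ^+ 2) <= 2 * e1 * b ^+ 2.
    have -> : 1 - (1 - d) ^+ 2 = 2 * d - d ^+ 2 by ring.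
    have h2 : (1 - a ^+ 2) * (2 * d - d ^+ 2) <= 1 * (2 * d).
      have a2 : a ^+ 2 <= 1 by rewrite -real_normK ?num_real// expr_le1// ltW.
      have := sqr_ge0 a; have := sqr_ge0 d => dd aa.
      rewrite ler_pM//; [lra| |lra|lra].
      by rewrite subr_ge0 expr2 ler_wpM2r//; lra.
    by rewrite (le_trans h2)//; lra.
  have h3 : b ^+ 2 <= nm (w - a%:C) ^+ 2 by rewrite ler_pXn2r ?nnegrE// ltW.
  have h4 : e1 * b ^+ 2 <= e1 * nm (w - a%:C) ^+ 2 by rewrite ler_pM2l.
  have h5 : 0 <= e1 ^+ 2 * nm (w - a%:C) ^+ 2 by rewrite mulr_ge0 ?sqr_ge0.
  by lra.
rewrite /K' nmM -(ler_pM2l wa0).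
have KwG : nm (w - a%:C) * nm (G w) = nm (K w) by rewrite -nmM -KG.
rewrite mulrCA KwG mulrC mulrA.
have := ler_pM (nm_ge0 _) (nm_ge0 _) (KC w w1) fac.
by move=> H; lra.
Unshelve. all: by end_near. Qed.

Lemma blaschke (s : seq R) (K : R[i] -> R[i]) (C0 : R) : 0 <= C0 -> uniq s ->
  {in s, forall a, `|a| < 1 /\ K a%:C = 0} ->
  disc_smooth K -> (forall z, nm z < 1 -> nm (K z) <= C0) ->
  forall z, nm z < 1 ->
    nm (K z) * \prod_(a <- s) nm (1 - a%:C * z) <= C0 * \prod_(a <- s) nm (z - a%:C).
Proof.
move=> C00; elim: s K => [|a s IH] K /=.
  by move=> _ _ _ KC z z1; rewrite !big_nil !mulr1 KC.
move=> /andP[ias us] sa sK KC z z1.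
have [a1 Ka] : `|a| < 1 /\ K a%:C = 0 by apply: sa; rewrite mem_head.
have [K' [sK' K'C K'E]] := blaschke_step C00 a1 sK KC Ka.
have {}IH := IH K' us _ sK' K'C z z1.
have : nm (K' z) * \prod_(a <- s) nm (1 - a%:C * z) <= C0 * \prod_(a <- s) nm (z - a%:C).
  apply: IH => c cs; have [|c1 Kc] := sa c; first by rewrite inE cs orbT.
  split => //; have := K'E c%:C; rewrite nm_real Kc mul0r => /(_ c1)/esym/eqP.
  rewrite mulf_eq0 subr_eq0 => /orP[/eqP[ca]|/eqP//].
  by move: ias; rewrite -ca cs.
move=> h; rewrite !big_cons mulrA -nmM K'E// nmM -mulrA.
by rewrite [leRHS]mulrCA ler_wpM2l ?nm_ge0.
Qed.

(** This is 1 - x <= exp(- x) for the squared modulus of the Blaschke factor; it turns the product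
    over the zeros into a sum in the exponent. *)
Lemma moebius_exp (a : R) w : `|a| < 1 -> nm w < 1 ->
  nm (w - a%:C) <= nm (1 - a%:C * w) *
    expR (- ((1 - nm w ^+ 2) * (1 - a ^+ 2) / nm (1 - a%:C * w) ^+ 2 / 2)).
Proof.
move=> a1 w1; set n := nm (1 - a%:C * w).
have n0 : 0 < n.
  rewrite nm_gt0; apply/eqP => h.
  have : nm (a%:C * w) = 1 by rewrite (_ : a%:C * w = 1) ?nm1//; apply/esym/eqP; rewrite -subr_eq0 h.
  rewrite nmM nm_real => h1; have := normr_ge0 a; have := nm_ge0 w => w0 a0.
  suff : `|a| * nm w < 1 by rewrite h1 ltxx.
  by apply: le_lt_trans a1; rewrite -[leRHS]mulr1 ler_wpM2l// ltW.
rewrite -(@ler_pXn2r _ 2)// ?nnegrE ?nm_ge0 ?mulr_ge0 ?expR_ge0 ?(ltW n0)//.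
rewrite exprMn -expRM_natl -mulNr mulrCA divff ?mulr1//.
have nE : nm (w - a%:C) ^+ 2 = n ^+ 2 * (1 + - ((1 - nm w ^+ 2) * (1 - a ^+ 2) / n ^+ 2)).
  by have := nm_moebius a w; rewrite -/n => h; rewrite h; field; rewrite -h; rewrite expf_neq0 ?gt_eqF.
rewrite nE ler_wpM2l ?exprn_ge0 ?(ltW n0)//.
exact: expR_ge1Dx.
Qed.

(* [slit] maps the unit disc onto the plane cut along the real rays
   [|x| >= 1]; [slit_sqrt] is [sqrt (1 - slit^2)], whose real part dominates
   [|Im slit|]. *)
Definition slit w : R[i] := 2 * w / (1 + w ^+ 2).

Definition slit_sqrt w : R[i] := (1 - w ^+ 2) / (1 + w ^+ 2).

Lemma slit_den_neq0 w : nm w < 1 -> 1 + w ^+ 2 != 0.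
Proof.
move=> w1; apply/eqP => h.
have : nm (w ^+ 2) = 1.
  by rewrite -nmN (_ : - w ^+ 2 = 1) ?nm1//; apply/esym/eqP; rewrite -subr_eq0 opprK h.
rewrite nmX => /eqP; rewrite -[X in _ == X](expr1n _ 2) eqrXn2// ?nm_ge0//.
by rewrite lt_eqF.
Qed.

Lemma ImslitE w : nm w < 1 -> Im (slit w) =
  2 * Im w * (1 - nm w ^+ 2) / nm (1 + w ^+ 2) ^+ 2.
Proof.
move=> /slit_den_neq0 d; have : 0 < nm (1 + w ^+ 2) ^+ 2 by rewrite exprn_gt0// nm_gt0.
rewrite !sqr_nm /slit !expr2; case: w {d} => p q /= /lt0r_neq0 d0; field.
by move: d0; rewrite add0r.
Qed.

End Slit.

(** * Estimates in the slit plane *)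

Section SlitBound.
Variable R : realType.
Local Notation C := (cplx R).
Implicit Types z w h : R[i].

Lemma Reslit_sqrtE w : nm w < 1 -> Re (slit_sqrt w) =
  (1 - nm w ^+ 2) * (1 + nm w ^+ 2) / nm (1 + w ^+ 2) ^+ 2.
Proof.
move=> /slit_den_neq0 d; have : 0 < nm (1 + w ^+ 2) ^+ 2 by rewrite exprn_gt0// nm_gt0.
rewrite !sqr_nm /slit_sqrt !expr2; case: w {d} => p q /= /lt0r_neq0 d0; field.
by move: d0; rewrite add0r.
Qed.

Lemma Imslit_le w : nm w < 1 -> `|Im (slit w)| <= Re (slit_sqrt w).
Proof.
move=> w1; have w0 := nm_ge0 w.
have d0 : 0 < nm (1 + w ^+ 2) ^+ 2 by rewrite exprn_gt0// nm_gt0 slit_den_neq0.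
have r1 : 0 <= 1 - nm w ^+ 2 by rewrite subr_ge0 expr_le1// ltW.
rewrite ImslitE// Reslit_sqrtE// !normrM normfV [`|_ ^+ 2|]ger0_norm ?(ltW d0)//.
rewrite ler_pM2r ?invr_gt0// [`|1 - _|]ger0_norm// mulrC ler_wpM2l//.
rewrite [`|2|]ger0_norm// (le_trans (_ : _ <= 2 * nm w)) ?ler_pM2l ?Im_le_nm//.
by have := sqr_ge0 (1 - nm w); lra.
Qed.

(* preimage under the slit map of the real point [c] of the gap [[-1, 1]] *)
Definition gap_point (c : R) : R := c / (1 + Num.sqrt (1 - c ^+ 2)).

(** The last equation is the origin of the semicircle weights: (1 - a^2) / (1 + a^2) governs the
    gain from a Blaschke zero at [a], and it equals sqrt(1 - c^2). *)
Lemma gap_pointP (c : R) : `|c| < 1 -> [/\ `|gap_point c| < 1,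
  c = 2 * gap_point c / (1 + gap_point c ^+ 2) &
  1 - gap_point c ^+ 2 = Num.sqrt (1 - c ^+ 2) * (1 + gap_point c ^+ 2)].
Proof.
move=> c1; have c2 : c ^+ 2 < 1 by rewrite -real_normK ?num_real// expr_lt1.
set s := Num.sqrt (1 - c ^+ 2).
have s0 : 0 < s by rewrite sqrtr_gt0 subr_gt0.
have cs : c ^+ 2 = 1 - s ^+ 2 by rewrite sqr_sqrtr ?subr_ge0 1?ltW//; ring.
have s1 : 1 + s != 0 by rewrite gt_eqF// ltr_wpDl.
rewrite /gap_point -/s.
have a2 : (c / (1 + s)) ^+ 2 = (1 - s) / (1 + s) by rewrite exprMn cs; field.
split.
- rewrite normrM normfV [`|1 + s|]gtr0_norm ?ltr_wpDl// ltr_pdivrMr ?ltr_wpDl//.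
  by rewrite mul1r (lt_trans c1)// ltrDl.
- rewrite a2; field.
  by rewrite s1 /= (_ : 1 + s + (1 - s) = 2) ?pnatr_eq0//; ring.
- by rewrite a2; field.
Qed.

Lemma smooth_slit m w : nm w < 1 -> smooth (K := C) m (@slit R) w.
Proof.
move=> w1; apply: smoothM.
  by apply: smoothM; [exact: smooth_cst|exact: smooth_id].
apply: smoothV; first exact: slit_den_neq0.
by apply: smoothD; [exact: smooth_cst|apply: smoothX; exact: smooth_id].
Qed.

Lemma smooth_slit_sqrt m w : nm w < 1 -> smooth (K := C) m (@slit_sqrt R) w.
Proof.
move=> w1; apply: smoothM.
  by apply: smoothB; [exact: smooth_cst|apply: smoothX; exact: smooth_id].
apply: smoothV; first exact: slit_den_neq0.
by apply: smoothD; [exact: smooth_cst|apply: smoothX; exact: smooth_id].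
Qed.

Lemma slit_real (a : R) : slit a%:C = (2 * a / (1 + a ^+ 2))%:C.
Proof.
by rewrite /slit !rmorphM /= rmorph_nat fmorphV rmorphD rmorph1 rmorphXn.
Qed.

(* Dividing by the Blaschke factors of the zeros in the gap
   [[x - L, x + L]] improves the trivial bound. *)
Lemma slit_bound (F : R[i] -> R[i]) (C0 tau x L : R) (s : seq R) w :
  entire F -> 0 <= tau -> 0 < L ->
  (forall z, nm (F z) <= C0 * expR (tau * `|Im z|)) ->
  uniq s -> {in s, forall c, `|c| < 1 /\ F (x + L * c)%:C = 0} -> nm w < 1 ->
  nm (F (x%:C + L%:C * slit w)) <= C0 * expR (tau * L * Re (slit_sqrt w)
    - \sum_(c <- s) (1 - nm w ^+ 2) * (1 - gap_point c ^+ 2)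
         / nm (1 - (gap_point c)%:C * w) ^+ 2 / 2).
Proof.
move=> eF tau0 L0 FC us sF w1.
have C00 : 0 <= C0.
  exact: growth_ge0 FC.
(* The real part of [slit_sqrt] is a harmonic majorant of |Im slit|, so the second factor absorbs
   the exponential growth of [F] and [K] is bounded by [C0] on the whole disc. *)
pose K z : R[i] := F (x%:C + L%:C * slit z) * cexp (- (tau * L)%:C * slit_sqrt z).
have sK : disc_smooth K.
  move=> z m z1; apply: smoothM.
    apply: (@smooth_comp C m (fun z => x%:C + L%:C * slit z) F); last exact: eF.
    apply: smoothD; first exact: smooth_cst.
    by apply: smoothM; [exact: smooth_cst|exact: smooth_slit].
  apply: (@smooth_comp C m (fun z => - (tau * L)%:C * slit_sqrt z) (@cexp R)); last exact: smooth_cexp.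
  by apply: smoothM; [exact: smooth_cst|exact: smooth_slit_sqrt].
have ReM (k : R) z : Re (- k%:C * z) = - (k * Re z).
  by case: z => p q /=; ring.
have KC z : nm z < 1 -> nm (K z) <= C0.
  move=> z1; rewrite /K nmM nm_cexp ReM.
  apply: le_trans (ler_wpM2r (expR_ge0 _) (FC _)) _; rewrite -(mulrA C0) -expRD.
  rewrite -[leRHS]mulr1 ler_wpM2l// -[X in _ <= X]expR0 ler_expR.
  have -> : Im (x%:C + L%:C * slit z) = L * Im (slit z).
    by case: (slit z) => p q /=; ring.
  rewrite normrM (gtr0_norm L0) mulrA subr_le0 ler_wpM2l ?Imslit_le//.
  by rewrite mulr_ge0// ltW.
have us' : uniq [seq gap_point c | c <- s].
  rewrite map_inj_in_uniq// => c d cs ds cd.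
  have [c1 _] := sF _ cs; have [d1 _] := sF _ ds.
  have [_ cE _] := gap_pointP c1; have [_ dE _] := gap_pointP d1.
  by rewrite cE dE cd.
have sK0 : {in [seq gap_point c | c <- s], forall a, `|a| < 1 /\ K a%:C = 0}.
  move=> _ /mapP[c cs ->]; have [c1 Fc] := sF _ cs.
  have [a1 cE _] := gap_pointP c1; split => //.
  rewrite /K slit_real -cE -rmorphM -rmorphD /= Fc mul0r//.
have := blaschke C00 us' sK0 sK KC w1.
rewrite !big_map => H.
have Kw : nm (K w) = nm (F (x%:C + L%:C * slit w)) * expR (- (tau * L * Re (slit_sqrt w))).
  by rewrite /K nmM nm_cexp ReM.
have P0 : 0 < \prod_(c <- s) nm (1 - (gap_point c)%:C * w).
  rewrite big_seq prodr_gt0// => c cs; have [c1 _] := sF _ cs.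
  have [a1 _ _] := gap_pointP c1; rewrite nm_gt0.
  apply/eqP => h; have := nm_moebius (gap_point c) w.
  have a2 : 0 < 1 - gap_point c ^+ 2.
    by rewrite subr_gt0 -real_normK ?num_real// expr_lt1.
  have r2 : 0 < 1 - nm w ^+ 2 by rewrite subr_gt0 expr_lt1// nm_ge0.
  rewrite h nm0 expr0n /= => /esym/eqP; rewrite gt_eqF//.
  by rewrite ltr_wpDl ?sqr_ge0// mulr_gt0.
have PE : \prod_(c <- s) nm (w - (gap_point c)%:C) <=
   \prod_(c <- s) nm (1 - (gap_point c)%:C * w) *
   expR (- \sum_(c <- s) (1 - nm w ^+ 2) * (1 - gap_point c ^+ 2)
         / nm (1 - (gap_point c)%:C * w) ^+ 2 / 2).
  rewrite -sumrN expR_sum -big_split /=.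
  rewrite big_seq [leRHS]big_seq; apply: ler_prod => c cs.
  rewrite nm_ge0/=; apply: moebius_exp => //.
  by have [c1 _] := sF _ cs; have [] := gap_pointP c1.
move: H; rewrite Kw => H.
have {}H : nm (F (x%:C + L%:C * slit w)) *
    expR (- (tau * L * Re (slit_sqrt w))) <= C0 *
    expR (- \sum_(c <- s) (1 - nm w ^+ 2) * (1 - gap_point c ^+ 2)
         / nm (1 - (gap_point c)%:C * w) ^+ 2 / 2).
  rewrite -(ler_pM2r P0) (le_trans H)// -mulrA ler_wpM2l//.
  by rewrite mulrC.
move: H; rewrite [X in _ * X <= _]expRN ler_pdivrMr ?expR_gt0// -(mulrA C0) -expRD.
by rewrite [- _ + _]addrC.
Qed.

End SlitBound.

Section SlitEstimate.
Variable R : realType.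
Local Notation C := (cplx R).

(** The preimages solve zeta w^2 - 2 w + zeta = 0. The roots zeta / (1 + s) and zeta / (1 - s) have
    product 1, so one lies in the open disc unless both have modulus 1; but |w| = 1 would make
    [slit w] the real number 1 / Re w. *)
Lemma slit_surj (zeta : R[i]) : Im zeta != 0 ->
  exists2 w, nm w < 1 & slit w = zeta.
Proof.
move=> y0.
have z0 : zeta != 0 by apply: contraNneq y0 => ->.
pose s := sqrtc (1 - zeta ^+ 2).
have s2 : s ^+ 2 = 1 - zeta ^+ 2 by rewrite sqr_sqrtc.
have s1 : (1 + s) * (1 - s) = zeta ^+ 2.
  by rewrite (_ : (1 + s) * (1 - s) = 1 - s ^+ 2); [rewrite s2|]; ring.
have [sp sn] : 1 + s != 0 /\ 1 - s != 0.
  by apply/andP; rewrite -negb_or -mulf_eq0 s1 expf_eq0.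
have slitE w : w != 0 -> zeta * (1 + w ^+ 2) = 2 * w -> slit w = zeta.
  move=> w0 h; rewrite /slit -h mulfK//; apply: contra_eqN h => /eqP ->.
  by rewrite mulr0 eq_sym mulf_neq0// pnatr_eq0.
have Er (e : R[i]) : e ^+ 2 = s ^+ 2 -> 1 + e != 0 ->
    slit (zeta / (1 + e)) = zeta /\ zeta / (1 + e) != 0.
  move=> e2 e1; have w0 : zeta / (1 + e) != 0 by rewrite mulf_neq0// invr_neq0.
  split=> //; apply: slitE => //.
  have zz : zeta ^+ 2 = (1 - e) * (1 + e).
    have -> : zeta ^+ 2 = 1 - e ^+ 2 by rewrite e2 s2; ring.
    by ring.
  rewrite exprMn zz; field.
  exact: e1.
have [E1 w1] := Er s erefl sp; have [E2 w2] := Er (- s) (sqrrN s) sn.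
have nn : nm (zeta / (1 + s)) * nm (zeta / (1 - s)) = 1.
  rewrite -nmM -nm1; congr nm; rewrite mulrACA -invfM s1 -expr2 divff//.
  by rewrite expf_eq0.
have noteq w : w != 0 -> slit w = zeta -> nm w != 1.
  move=> w0 we; apply/eqP => n1; move: y0; rewrite -we.
  have ww : w * w^* = 1 by rewrite mulcc n1 expr1n.
  have -> : slit w = ((Re w)^-1)%:C.
    have wd : 1 + w ^+ 2 = w * (2 * (Re w))%:C.
      rewrite -ww expr2 -mulrDr; congr (w * _); case: (w) => p q.
      by complex_ring.
    rewrite /slit wd rmorphM /= rmorph_nat fmorphV /=.
    have [->|p0] := eqVneq (Re w) 0; first by rewrite !(mulr0, invr0).
    have p0' : (Re w)%:C != 0 :> R[i] by rewrite -nm_gt0 nm_real normr_gt0.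
    by field; rewrite p0' w0.
  by rewrite eqxx.
have [h|h] := ltP (nm (zeta / (1 + s))) 1; first by exists (zeta / (1 + s)).
exists (zeta / (1 - s)) => //.
rewrite lt_neqAle noteq//= leNgt; apply/negP => h2.
suff : 1 < nm (zeta / (1 + s)) * nm (zeta / (1 - s)) by rewrite nn ltxx.
by rewrite (lt_le_trans h2)// ler_peMl// nm_ge0.
Qed.

(** For w in the disc and zeta = slit w, read r = |w|, p = Re w, v = |Im w|, Q = |1 + w^2|^2, Z =
    |zeta| and e = |Im zeta|. For zeta far from the gap and close to the real axis, w is close to
    the unit circle, and its distance to the imaginary axis is at most 1 / Z. *)
Lemma slit_parameters (r p v P Q Z e rho : R) :
  0 <= r < 1 -> 0 <= v <= 1 -> v ^+ 2 = r ^+ 2 - p ^+ 2 -> P = 1 - r ^+ 2 ->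
  Q = P ^+ 2 + 4 * p ^+ 2 -> Z ^+ 2 * Q = 4 * r ^+ 2 -> 0 < Q -> 2 <= Z ->
  0 < e -> e * Q = 2 * v * P -> 0 < rho -> rho <= 1 - 4 * e ->
  [/\ 0 < v, Num.sqrt (rho * (1 - Z ^- 2)) <= v, P / Q = e / (2 * v),
      e * r ^+ 2 * Z ^- 2 <= P / 2 & `|p| <= Z^-1 /\ rho <= r ^+ 2].
Proof.
move=> /andP[r0 r1] /andP[v0 v1] v2 PE QE ZQ Q0 Z2 e0 yE rho0 rhoy.
have Zp : 0 < Z by exact: lt_le_trans Z2.
have rr : 0 < r ^+ 2.
  have : 0 < Z ^+ 2 * Q by rewrite mulr_gt0// exprn_gt0.
  by rewrite ZQ pmulr_rgt0.
have rp : 0 < r by rewrite lt_def r0 andbT -sqrf_eq0 gt_eqF.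
have r21 : r ^+ 2 < 1 by rewrite expr_lt1.
have P0 : 0 < P by rewrite PE subr_gt0.
have Zi : Z ^- 2 <= 4^-1.
  rewrite lef_pV2 ?posrE ?exprn_gt0// (_ : 4 = 2 ^+ 2); last by ring.
  by rewrite ler_pXn2r ?nnegrE// ltW.
have Zi0 : 0 < Z ^- 2 by rewrite invr_gt0 exprn_gt0.
have QZ : Q = 4 * r ^+ 2 * Z ^- 2.
  by rewrite -ZQ mulrAC mulfV ?mul1r// gt_eqF// exprn_gt0.
have p2 : p ^+ 2 <= r ^+ 2 * Z ^- 2.
  have : 0 <= P ^+ 2 := sqr_ge0 _.
  by move: QE; rewrite QZ; clear; lra.
have v2r : r ^+ 2 * (1 - Z ^- 2) <= v ^+ 2 by rewrite v2; move: p2; clear; lra.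
have vr : r / 2 <= v.
  rewrite -(@ler_pXn2r _ 2)// ?nnegrE//; last by rewrite divr_ge0.
  rewrite (le_trans _ v2r)// exprMn ler_wpM2l ?sqr_ge0// exprVn.
  by rewrite (_ : (2 : R) ^+ 2 = 4); [move: Zi; clear; lra|ring].
have vp : 0 < v by rewrite (lt_le_trans _ vr)// divr_gt0.
have Pe : P <= 4 * e.
  have h1 : v * P = 2 * e * r ^+ 2 * Z ^- 2 by move: yE; rewrite QZ; clear; lra.
  have h2 : r / 2 * P <= v * P by rewrite ler_pM2r.
  have h3 : 2 * e * r ^+ 2 * Z ^- 2 <= 2 * e * r ^+ 2 * 4^-1.
    by rewrite ler_wpM2l// mulr_ge0 ?(ltW rr)// mulr_ge0 ?(ltW e0).
  have re0 : 0 <= r * e by rewrite mulr_ge0// ltW.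
  have h4 : r * (r * e) <= r * e := ler_piMl re0 (ltW r1).
  have h5 : r * P <= r * e by move: h1 h2 h3 h4; rewrite expr2; clear; lra.
  by move: h5; rewrite ler_pM2l// => /le_trans; apply; move: e0; clear; lra.
have rrho : rho <= r ^+ 2 by move: rhoy Pe; rewrite PE; clear; lra.
split => //.
- have Zi1 : Z ^- 2 < 1 by apply: le_lt_trans Zi _; rewrite invf_lt1 ?ltr1n.
  have X0 : 0 < rho * (1 - Z ^- 2) by rewrite mulr_gt0// subr_gt0.
  rewrite -(@ler_pXn2r _ 2)// ?nnegrE// ?sqrtr_ge0// sqr_sqrtr ?(ltW X0)//.
  by rewrite (le_trans _ v2r)// ler_wpM2r// subr_ge0 ltW.
- have Qn : Q != 0 by rewrite gt_eqF.
  have vn : 2 * v != 0 by rewrite gt_eqF// mulr_gt0.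
  by apply/eqP; rewrite eqr_div//; apply/eqP; rewrite yE; ring.
- have : e * Q <= 2 * P by rewrite yE ler_pM2r// ler_piMr.
  by rewrite QZ; clear; lra.
- split => //; have Zi1 : 0 < Z^-1 by rewrite invr_gt0.
  rewrite -(@ler_pXn2r _ 2)// ?nnegrE ?(ltW Zi1)// real_normK ?num_real//.
  by rewrite (le_trans p2)// exprVn ler_piMl ?(ltW Zi0)// ltW.
Qed.

(** The contribution of a single zero, [S] being its semicircle weight: |1 - a w|^2 = 1 - 2 a p +
    a^2 r^2 is at most (1 + a^2) (1 + 1/Z), because 2 |a| <= 1 + a^2 and |p| <= 1/Z. *)
Lemma gap_term (a p r P Z : R) w : p = Re w -> r = nm w -> r < 1 ->
  P = 1 - r ^+ 2 -> `|a| < 1 -> `|p| <= Z^-1 -> 0 < Z ->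
  forall S : R, 1 - a ^+ 2 = S * (1 + a ^+ 2) -> 0 <= S ->
  P / 2 * (S / (1 + Z^-1)) <= P * (1 - a ^+ 2) / nm (1 - a%:C * w) ^+ 2 / 2.
Proof.
move=> pE rE r1 PE a1 pZ Zp S aE S0.
have r21 : r ^+ 2 < 1 by rewrite expr_lt1// rE nm_ge0.
have P0 : 0 < P by rewrite PE subr_gt0.
have nE : nm (1 - a%:C * w) ^+ 2 = 1 - 2 * a * p + a ^+ 2 * r ^+ 2.
  by rewrite rE pE !sqr_nm; case: (w) => ? ? /=; ring.
have Zi1 : 0 < Z^-1 by rewrite invr_gt0.
have a20 : 0 < 1 + a ^+ 2 by rewrite ltr_wpDr ?sqr_ge0.
have nle : nm (1 - a%:C * w) ^+ 2 <= (1 + a ^+ 2) * (1 + Z^-1).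
  rewrite nE.
  have h1 : - (2 * a * p) <= (1 + a ^+ 2) * Z^-1.
    rewrite (le_trans (ler_norm _))// normrN normrM.
    rewrite ler_pM// normrM [`|2|]ger0_norm//.
    have := sqr_ge0 (1 - `|a|); rewrite sqrrB expr1n mul1r real_normK ?num_real//.
    by clear; lra.
  have h2 : a ^+ 2 * r ^+ 2 <= a ^+ 2 by rewrite ler_piMr ?sqr_ge0// ltW.
  by move: h1 h2; clear; lra.
have n0 : 0 < nm (1 - a%:C * w) ^+ 2.
  rewrite nm_moebius ltr_wpDl ?sqr_ge0// mulr_gt0//; last by rewrite -rE subr_gt0.
  by rewrite subr_gt0 -real_normK ?num_real// expr_lt1.
rewrite aE; move: nle n0; set N : R := nm _ ^+ 2; move: N => N nle n0.
have -> : P * (S * (1 + a ^+ 2)) / N / 2 = P / 2 * (S * ((1 + a ^+ 2) / N)) by ring.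
rewrite ler_wpM2l ?divr_ge0 ?(ltW P0)// ler_wpM2l//.
by rewrite ler_pdivlMr// mulrC ler_pdivrMr// ltr_wpDr// ltW.
Qed.

(** [slit_bound] in the coordinates of the plane. The exponent is proportional to the height [y], so
    it can be compared with a type: cutting the plane raises [tau] to [tau / sqrt(1 - Z^-2)], the
    zeros lower it by about K / Z^2, and [rho] < 1 covers errors that vanish as the gap grows. *)
Lemma slit_estimate (F : R[i] -> R[i]) (C0 tau x L rho K : R) (s : seq R) (z0 : R[i]) :
  let y : R := `|Im z0| in let Z : R := nm (z0 - x%:C) / L in
  entire F -> 0 <= tau -> 0 < L ->
  (forall z, nm (F z) <= C0 * expR (tau * `|Im z|)) ->
  uniq s -> {in s, forall c, `|c| < 1 /\ F (x + L * c)%:C = 0} ->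
  0 < y -> 2 <= Z -> 0 <= K -> K * L <= \sum_(c <- s) Num.sqrt (1 - c ^+ 2) ->
  0 < rho -> rho <= 1 - 4 * y / L ->
  nm (F z0) <= C0 * expR (y * (tau / Num.sqrt (rho * (1 - Z ^- 2))
      - rho * K / (Z ^+ 2 + Z))).
Proof.
move=> y Z eF tau0 L0 FC us sF y0 Z2 K0 sK rho0 rhoy.
have C00 : 0 <= C0.
  exact: growth_ge0 FC.
pose zeta : R[i] := (L^-1)%:C * (z0 - x%:C).
have Imz : Im zeta = Im z0 / L by rewrite /zeta; case: (z0) => p q /=; ring.
have [|w w1 wE] := @slit_surj zeta.
  by rewrite Imz mulf_neq0 ?invr_neq0 ?(gt_eqF L0)// -normr_gt0.
have z0E : z0 = x%:C + L%:C * slit w.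
  have LC : L%:C != 0 :> R[i] by rewrite -nm_gt0 nm_real normr_gt0 gt_eqF.
  by rewrite wE /zeta fmorphV mulrA divff// mul1r addrC subrK.
have := slit_bound eF tau0 L0 FC us sF w1; rewrite -z0E => /le_trans; apply.
rewrite ler_wpM2l// ler_expR.
pose r : R := nm w; pose p : R := Re w; pose q : R := Im w; pose v : R := `|q|.
pose Q : R := nm (1 + w ^+ 2) ^+ 2; pose P : R := 1 - r ^+ 2.
have nzeta : nm zeta = Z by rewrite nmM nm_real ger0_norm ?invr_ge0 ?(ltW L0)// mulrC.
have Zp : 0 < Z by exact: lt_le_trans Z2.
have r0 : 0 <= r := nm_ge0 w.
have Q0 : 0 < Q by rewrite exprn_gt0// nm_gt0 slit_den_neq0.
have rpq : r ^+ 2 = p ^+ 2 + q ^+ 2 by rewrite /r sqr_nm.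
have QE : Q = P ^+ 2 + 4 * p ^+ 2.
  by rewrite /Q /P rpq /p /q sqr_nm expr2; case: (w) => ? ? /=; ring.
have ZQ : Z ^+ 2 * Q = 4 * r ^+ 2.
  rewrite -nzeta -wE /Q -exprMn -nmM /slit divfK ?slit_den_neq0// nmM exprMn.
  by congr (_ * _); rewrite -[2]/(2%:R : R[i]) -[2%:R](rmorph_nat (real_complex R)) nm_real ger0_norm//; ring.
have P0 : 0 < P by rewrite subr_gt0 expr_lt1.
pose e : R := y / L.
have yE : e * Q = 2 * v * P.
  rewrite /e /y; have -> : `|Im z0| / L = `|Im zeta|.
    by rewrite Imz normrM normfV [`|L|]gtr0_norm.
  rewrite -wE ImslitE// -/Q -/P -/q !normrM normfV [`|Q|]gtr0_norm// [`|P|]gtr0_norm//.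
  by rewrite [`|2|]ger0_norm// divfK// gt_eqF.
have e0 : 0 < e by rewrite divr_gt0.
have v2 : v ^+ 2 = r ^+ 2 - p ^+ 2 by rewrite real_normK ?num_real// rpq addrAC subrr add0r.
have r01 : 0 <= r < 1 by rewrite r0.
have v01 : 0 <= v <= 1 by rewrite normr_ge0 (le_trans (Im_le_nm w))// ltW.
have rhoe : rho <= 1 - 4 * e by rewrite mulrA.
have [vp vX PQ eP [pZ rrho]] := slit_parameters r01 v01 v2 erefl QE ZQ Q0 Z2 e0 yE rho0 rhoe.
pose X : R := rho * (1 - Z ^- 2).
have X0 : 0 < X.
  rewrite mulr_gt0// subr_gt0 invf_lt1 ?exprn_gt0// exprn_egt1//.
  by apply: lt_le_trans Z2; rewrite ltr1n.
have main1 : tau * L * Re (slit_sqrt w) <= y * (tau / Num.sqrt X).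
  have -> : Re (slit_sqrt w) = P / Q * (1 + r ^+ 2).
    by rewrite Reslit_sqrtE// mulrAC.
  rewrite PQ.
  have r1 : 1 + r ^+ 2 <= 2 by move: P0; rewrite /P; clear; lra.
  have -> : tau * L * (e / (2 * v) * (1 + r ^+ 2)) = (y * tau) * ((1 + r ^+ 2) / 2 / v).
    by rewrite /e; field; rewrite !gt_eqF.
  rewrite [leRHS]mulrA ler_wpM2l ?mulr_ge0 ?(ltW y0)//.
  have h1 : (1 + r ^+ 2) / 2 <= 1 by rewrite ler_pdivrMr// mul1r.
  have h2 : 1 <= (Num.sqrt X)^-1 * v by rewrite ler_pdivlMl ?sqrtr_gt0// mulr1.
  by rewrite ler_pdivrMr// (le_trans h1).
have term c : `|c| < 1 -> P / 2 * (Num.sqrt (1 - c ^+ 2) / (1 + Z^-1)) <=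
    P * (1 - gap_point c ^+ 2) / nm (1 - (gap_point c)%:C * w) ^+ 2 / 2.
  move=> c1; have [a1 cE aE] := gap_pointP c1.
  exact: (@gap_term _ p r P Z w) (sqrtr_ge0 _).
have main2 : y * (rho * K / (Z ^+ 2 + Z)) <= \sum_(c <- s) P * (1 - gap_point c ^+ 2)
   / nm (1 - (gap_point c)%:C * w) ^+ 2 / 2.
  apply: (@le_trans _ _ (\sum_(c <- s) P / 2 * (Num.sqrt (1 - c ^+ 2) / (1 + Z^-1)))); last first.
    rewrite big_seq [leRHS]big_seq; apply: ler_sum => c cs; apply: term.
    by case: (sF _ cs).
  rewrite -mulr_sumr -mulr_suml.
  have Z1 : 0 < 1 + Z^-1 by rewrite ltr_wpDr ?invr_ge0 ?ltW.
  have h1 : K * L / (1 + Z^-1) <= (\sum_(c <- s) Num.sqrt (1 - c ^+ 2)) / (1 + Z^-1).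
    by rewrite ler_pM2r// invr_gt0.
  have h3 : e * r ^+ 2 * Z ^- 2 * (K * L / (1 + Z^-1)) <=
      P / 2 * ((\sum_(c <- s) Num.sqrt (1 - c ^+ 2)) / (1 + Z^-1)).
    apply: ler_pM => //.
      by rewrite mulr_ge0 ?invr_ge0 ?sqr_ge0// mulr_ge0 ?sqr_ge0// ltW.
    by rewrite divr_ge0 ?(ltW Z1)// mulr_ge0// ltW.
  apply: le_trans h3.
  have -> : e * r ^+ 2 * Z ^- 2 * (K * L / (1 + Z^-1)) =
    r ^+ 2 * (y * (K / (Z ^+ 2 + Z))).
    have ZZ : 0 < Z ^+ 2 + Z by rewrite ltr_wpDr ?(ltW Zp)// exprn_gt0.
    have Zp1 : 0 < Z + 1 by rewrite addr_gt0.
    by rewrite /e; field; rewrite !gt_eqF.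
  have -> : y * (rho * K / (Z ^+ 2 + Z)) = rho * (y * (K / (Z ^+ 2 + Z))) by ring.
  rewrite ler_wpM2r// mulr_ge0 ?(ltW y0)// divr_ge0// addr_ge0 ?sqr_ge0// ltW//.
rewrite -/r -/P -/X.
have -> : y * (tau / Num.sqrt X - rho * K / (Z ^+ 2 + Z)) =
  y * (tau / Num.sqrt X) - y * (rho * K / (Z ^+ 2 + Z)) by ring.
by move: main1 main2; clear; lra.
Qed.

End SlitEstimate.

(** * Lowering the exponential type *)

Section TypeLowering.
Variable R : realType.
Local Notation C := (cplx R).

Lemma inv_sqrt_le (X t : R) : 0 <= t <= 2^-1 -> 1 - t <= X ->
  (Num.sqrt X)^-1 <= 1 + t / 2 + t ^+ 2.
Proof.
move=> /andP[t0 t1] tX.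
have t1' : 0 < 1 - t by rewrite subr_gt0 (le_lt_trans t1)// invf_lt1 ?ltr1n.
have X0 : 0 < X by exact: lt_le_trans tX.
have u0 : 0 < 1 + t / 2 + t ^+ 2.
  by rewrite ltr_wpDr ?sqr_ge0// ltr_wpDr// divr_ge0.
rewrite -[leRHS]invrK lef_pV2 ?posrE ?sqrtr_gt0 ?invr_gt0//.
rewrite -(@ler_pXn2r _ 2)// ?nnegrE ?sqrtr_ge0 ?invr_ge0 ?(ltW u0)//.
rewrite sqr_sqrtr ?(ltW X0)// (le_trans _ tX)// exprVn.
rewrite invf_ple ?posrE ?exprn_gt0// -[leLHS]mul1r ler_pdivrMr//.
have -> : (1 + t / 2 + t ^+ 2) ^+ 2 * (1 - t) =
  1 + t ^+ 2 * (5 / 4 * (1 - t) - t ^+ 3) by field.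
rewrite lerDl mulr_ge0 ?sqr_ge0// subr_ge0.
have t3 : t ^+ 3 <= 2^-1.
  rewrite exprSr -[leRHS]mul1r ler_pM ?sqr_ge0// expr_le1//.
  by rewrite (le_trans t1)// invf_le1 ?ler1n.
by apply: le_trans t3 _; move: t1; clear; lra.
Qed.

(** For Z close to 1/e the gain K / (Z^2 + Z) is K e^2 and the loss tau0 (1 / sqrt(1 - Z^-2) - 1) is
    tau0 e^2 / 2, up to terms of order e^3. Thus tau0 < 2 K suffices for small e. *)
Lemma lowering_constant (K tau0 : R) : 0 <= tau0 -> tau0 < 2 * K ->
  exists2 e0 : R, 0 < e0 <= 10^-1 & forall e, 0 < e < e0 ->
  exists rho c : R, [/\ 0 < rho < 1, 0 < c & forall Z, e^-1 - 1 <= Z <= e^-1 + 1 ->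
    c <= rho * K / (Z ^+ 2 + Z)
       - tau0 * ((Num.sqrt (rho * (1 - Z ^- 2)))^-1 - 1)].
Proof.
move=> t0 tK; have K0 : 0 < K by move: t0 tK; clear; lra.
have d0 : 0 < 4 * K + 3 * tau0 by rewrite ltr_wpDr ?mulr_ge0// mulr_gt0.
exists (Num.min 10^-1 ((K - tau0 / 2) / (4 * K + 3 * tau0))).
  rewrite ge_min lexx lt_min invr_gt0 ltr0n divr_gt0// subr_gt0.
  by move: tK; clear; lra.
move=> e /andP[e0]; rewrite lt_min => /andP[e1].
rewrite ltr_pdivlMr// => e2.
have e3 : e ^+ 3 <= e ^+ 2 * 10^-1 by rewrite exprSr ler_wpM2l ?sqr_ge0// ltW.
have e22 : e ^+ 2 <= e * 10^-1 by rewrite expr2 ler_wpM2l// ltW.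
have e2p : 0 < e ^+ 2 by rewrite exprn_gt0.
have e3p : 0 < e ^+ 3 by rewrite exprn_gt0.
exists (1 - e ^+ 3), (e ^+ 2 * (K - tau0 / 2 - e * (4 * K + 3 * tau0))); split.
(* [rho] differs from 1 by e^3 only, which is negligible against the gain of order e^2. *)
- by apply/andP; split; move: e3 e22 e1 e3p; clear; lra.
- by rewrite mulr_gt0// subr_gt0.
move=> Z /andP[Z1 Z2].
have ei : 10 < e^-1 by rewrite -[ltLHS]invrK ltf_pV2 ?posrE ?invr_gt0 ?ltr0n.
have Zp : 9 < Z by move: ei Z1; clear; lra.
have Z0 : 0 < Z by move: Zp; clear; lra.
have eZ : 1 - e <= e * Z.
  by have := ler_wpM2l (ltW e0) Z1; rewrite mulrBr mulr1 mulfV// gt_eqF.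
have eZ2 : e * Z <= 1 + e.
  by have := ler_wpM2l (ltW e0) Z2; rewrite mulrDr mulr1 mulfV// gt_eqF.
have e10 : 0 < 1 - e by move: e1; clear; lra.
have ZV : Z ^- 2 <= e ^+ 2 * (1 + 3 * e).
  have h1 : (1 - e) ^+ 2 <= (e * Z) ^+ 2.
    by rewrite ler_pXn2r// ?nnegrE ?(ltW e10)// mulr_ge0// ltW.
  have h2 : 1 <= (1 - e) ^+ 2 * (1 + 3 * e).
    have -> : (1 - e) ^+ 2 * (1 + 3 * e) = 1 + e - 5 * e ^+ 2 + 3 * e ^+ 3 by ring.
    by move: e22 e0 e3p e1; clear; lra.
  have e13 : 0 <= 1 + 3 * e by move: e0; clear; lra.
  have h3 := ler_wpM2r e13 h1.
  have Z2p : 0 < Z ^+ 2 by rewrite exprn_gt0.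
  rewrite -[leLHS]mul1r ler_pdivrMr// (le_trans h2)// (le_trans h3)//.
  by rewrite exprMn; move: (e ^+ 2) (Z ^+ 2); clear => a c; lra.
pose T := e ^+ 2 * (1 + 4 * e).
have T0 : 0 <= T by rewrite mulr_ge0 ?sqr_ge0//; move: e0; clear; lra.
have T1 : T <= e ^+ 2 * (14 / 10).
  by rewrite ler_wpM2l ?sqr_ge0//; move: e1; clear; lra.
have T2 : T <= 2^-1 by move: T1 e22 e1; clear; lra.
have sqb : (Num.sqrt ((1 - e ^+ 3) * (1 - Z ^- 2)))^-1 <= 1 + T / 2 + T ^+ 2.
  apply: inv_sqrt_le; first by rewrite T0.
  have : 0 <= e ^+ 3 * Z ^- 2 by rewrite mulr_ge0 ?(ltW e3p)// invr_ge0 sqr_ge0.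
  have -> : T = e ^+ 2 * (1 + 3 * e) + e ^+ 3 by rewrite /T; ring.
  by move: ZV; clear; lra.
have TT : T / 2 + T ^+ 2 <= e ^+ 2 / 2 + e ^+ 2 * e * 3.
  have h1 : T ^+ 2 <= T * (e ^+ 2 * (14 / 10)) by rewrite expr2 ler_wpM2l.
  have h2 : T * (e ^+ 2 * (14 / 10)) <= e ^+ 2 * (14 / 10) * (e * 10^-1 * (14 / 10)).
    have q0 : 0 <= 14 / 10 :> R by rewrite divr_ge0.
    by apply: ler_pM => //; [rewrite mulr_ge0// ltW|rewrite ler_wpM2r].
  have h3 : 0 <= e ^+ 2 * e by rewrite mulr_ge0 ?sqr_ge0// ltW.
  by move: h1 h2 h3; rewrite /T; clear; lra.
have main : e ^+ 2 * (K - e * (4 * K)) <= (1 - e ^+ 3) * K / (Z ^+ 2 + Z).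
  have ZZ : 0 < Z ^+ 2 + Z by rewrite ltr_wpDr ?(ltW Z0)// exprn_gt0.
  rewrite ler_pdivlMr//.
  have h1 : e ^+ 2 * (Z ^+ 2 + Z) <= (1 + e) * (1 + 2 * e).
    have -> : e ^+ 2 * (Z ^+ 2 + Z) = (e * Z) * (e * Z + e) by ring.
    have eZ0 : 0 <= e * Z by rewrite mulr_ge0// ltW.
    rewrite ler_pM//; first by rewrite addr_ge0// ltW.
    by move: eZ2; clear; lra.
  have e4 : 0 <= 1 - 4 * e by move: e1; clear; lra.
  have h2 : (1 - 4 * e) * ((1 + e) * (1 + 2 * e)) <= 1 - e ^+ 3.
    have -> : (1 - 4 * e) * ((1 + e) * (1 + 2 * e)) = 1 - e - 10 * e ^+ 2 - 8 * e ^+ 3 by ring.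
    by move: e0 e2p e3p; clear; lra.
  have h3 := ler_wpM2l e4 h1; have h4 := le_trans h3 h2.
  have h5 := ler_wpM2r (ltW K0) h4.
  by move: h5; clear; lra.
have h6 := ler_wpM2l t0 sqb; have h7 := ler_wpM2l t0 TT.
by move: h6 h7 main; set q := (Num.sqrt _)^-1; set m := _ / (_ + _); clear; lra.
Qed.

(* The gain [c] does not depend on [tau], so that finitely many applications
   bring the type down to 0. *)
Lemma type_lowering (F : R[i] -> R[i]) (C0 tau0 kappa K rho c : R) :
  entire F -> 3 <= kappa -> 0 <= K -> 0 < rho < 1 ->
  (forall Z, kappa - 1 <= Z <= kappa + 1 -> c <= rho * K / (Z ^+ 2 + Z)
       - tau0 * ((Num.sqrt (rho * (1 - Z ^- 2)))^-1 - 1)) ->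
  (forall L0 : R, 0 < L0 -> exists (L : R) (s : seq R), [/\ L0 <= L, uniq s,
     {in s, forall d, `|d| < 1 /\ F (kappa * L + L * d)%:C = 0} &
     K * L <= \sum_(d <- s) Num.sqrt (1 - d ^+ 2)]) ->
  forall tau, 0 <= tau <= tau0 ->
  (forall z, nm (F z) <= C0 * expR (tau * `|Im z|)) ->
  forall z, Im z != 0 -> nm (F z) <= C0 * expR ((tau - c) * `|Im z|).
Proof.
move=> eF k3 K0 /andP[r0 r1] cZ gap tau /andP[t0 t1] FC z yz.
have C00 : 0 <= C0.
  exact: growth_ge0 FC.
pose y : R := `|Im z|; have y0 : 0 < y by rewrite normr_gt0.
have r10 : 0 < 1 - rho by rewrite subr_gt0.
(* With [z] fixed, the gap is taken at a scale [L] beyond |z| and such that rho <= 1 - 4 y / L. The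
   gap is centred at [kappa * L], so [Z] stays within 1 of [kappa]. *)
pose L0 := nm z + 4 * y / (1 - rho).
have L00 : 0 < L0 by rewrite ltr_wpDl ?nm_ge0// divr_gt0// mulr_gt0.
have [L [s [LL0 us sF sK]]] := gap L0 L00.
have Lp : 0 < L by exact: lt_le_trans LL0.
have zL : nm z <= L.
  by apply: le_trans LL0; rewrite lerDl divr_ge0 ?(ltW r10)// mulr_ge0// ltW.
have yL : 4 * y / L <= 1 - rho.
  rewrite ler_pdivrMr// [leRHS]mulrC -ler_pdivrMr//.
  by apply: le_trans LL0; rewrite lerDr nm_ge0.
pose Z : R := nm (z - (kappa * L)%:C) / L.
have kL : 0 <= kappa * L by rewrite mulr_ge0 ?(ltW Lp)//; move: k3; clear; lra.
have Zk : kappa - 1 <= Z <= kappa + 1.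
  rewrite ler_pdivlMr// ler_pdivrMr//.
  have h1 := nm_dist (kappa * L)%:C z; have h2 := nmB z (kappa * L)%:C.
  move: h1 h2; rewrite nmC nm_real ger0_norm// => h1 h2.
  by rewrite nmC; apply/andP; split; move: h1 h2 zL; rewrite ?(nmC z); clear; lra.
have Z2 : 2 <= Z by case/andP: Zk => + _; move: k3; clear; lra.
have := @slit_estimate R F C0 tau (kappa * L) L rho K s z eF t0 Lp FC us sF y0 Z2 K0 sK r0.
move=> /(_ ltac:(by move: yL; rewrite -/y; clear; lra)) /le_trans; apply.
rewrite ler_wpM2l// ler_expR -/Z -/y [leRHS]mulrC ler_wpM2l ?(ltW y0)//.
have := cZ Z Zk; set q := (Num.sqrt _)^-1; set m := _ / (_ + _) => cm.
have q1 : 1 <= q.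
  have Zi : Z ^- 2 < 1.
    by rewrite invf_lt1 ?exprn_gt0 ?exprn_egt1//; apply: lt_le_trans Z2; rewrite ?ltr0n ?ltr1n.
  have Zi0 : 0 <= Z ^- 2 by rewrite invr_ge0 sqr_ge0.
  have X0 : 0 < rho * (1 - Z ^- 2) by rewrite mulr_gt0 ?subr_gt0.
  rewrite -[leLHS]invr1 lef_pV2 ?posrE ?sqrtr_gt0//.
  rewrite -[leRHS]sqrtr1 ler_sqrt// -[leRHS]mul1r ler_pM ?(ltW r0) ?(ltW r1)//.
    by rewrite subr_ge0 ltW.
  by move: Zi0; clear; lra.
have tq : tau * (q - 1) <= tau0 * (q - 1) by rewrite ler_wpM2r// subr_ge0.
by move: tq cm; clear; lra.
Qed.

End TypeLowering.

(** * Zeros counted with semicircle weights *)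

Section Semicircle.
Variable R : realType.

(** As [Num.sqrt] is 0 on negative numbers, this is continuous on the whole line and vanishes
    outside [-1, 1]; sums may thus run over all zeros, whether or not they lie in the gap. *)
Definition semicircle (x : R) : R := Num.sqrt (1 - x ^+ 2).

Lemma semicircle_eq0 x : 1 <= `|x| -> semicircle x = 0.
Proof.
move=> x1; apply/eqP; rewrite sqrtr_eq0 subr_le0 -real_normK ?num_real//.
by rewrite expr_ge1.
Qed.

Lemma continuous_semicircle : continuous semicircle.
Proof.
move=> x; apply: continuous_comp; last exact: sqrt_continuous.
apply: continuousB; first exact: cst_continuous.
exact: exprn_continuous.
Qed.

Definition halfdisc (a x : R) : R := \int[mu]_(t in `[a, x]) semicircle t.

Lemma is_derive_halfdisc (a x : R) : a < x -> is_derive x 1 (halfdisc a) (semicircle x).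
Proof.
move=> ax; have xx : x < x + 1 by rewrite ltrDl.
have int : mu.-integrable `[a, x + 1] (EFin \o semicircle).
  apply: continuous_compact_integrable; first exact: segment_compact.
  by apply: continuous_subspaceT; exact: continuous_semicircle.
have [d e] := continuous_FTC1_closed xx int ax (@continuous_semicircle x).
by apply: DeriveDef; [exact: d|rewrite -derive1E; exact: e].
Qed.

Lemma halfdisc_le (a x y : R) : a < x -> x <= y -> halfdisc a x <= halfdisc a y.
Proof.
move=> ax xy.
have d t : t \in `[x, y] -> is_derive t 1 (halfdisc a) (semicircle t).
  by rewrite in_itv /= => /andP[xt _]; apply: is_derive_halfdisc; exact: lt_le_trans xt.
have cf : {within `[x, y], continuous (halfdisc a)}.
  apply: derivable_within_continuous => t /d dt.
  exact: (@ex_derive _ _ _ _ _ _ _ dt).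
have doo t : t \in `]x, y[ -> is_derive t 1 (halfdisc a) (semicircle t).
  by move=> tt; apply: d; exact: subset_itv_oo_cc tt.
have [c _ cE] := @MVT_segment R (halfdisc a) semicircle x y xy doo cf.
by rewrite -subr_ge0 cE mulr_ge0 ?sqrtr_ge0// subr_ge0.
Qed.

Lemma halfdisc_eq0 (a x : R) : a < x -> x <= -1 -> halfdisc a x = 0.
Proof.
move=> ax x1; rewrite /halfdisc (@eq_Rintegral _ _ _ mu _ (fun=> 0)).
  by rewrite Rintegral_cst//= mul0r.
move=> t; rewrite inE /= in_itv /= => /andP[_ tx].
rewrite semicircle_eq0// ler0_norm; last first.
  by rewrite (le_trans tx)// (le_trans x1)// lerN10.
by rewrite lerNr (le_trans tx).
Qed.

(** Under x = sin t the area up to x minus (t + sin t cos t) / 2 has derivative 0 on [-pi/2, pi/2],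
    where cos t is the semicircle ordinate. *)
Lemma halfdisc_total (a : R) : a < -1 -> halfdisc a 1 = pi / 2.
Proof.
move=> a1.
have asin_ t : a < sin t by rewrite (lt_le_trans a1)// sin_geN1.
pose B t : R := halfdisc a (sin t) - (t + sin t * cos t) / 2.
have dB (t : R) : is_derive t 1 B (semicircle (sin t) * cos t -
    2^-1 * (1 + (- (sin t ^+ 2) + cos t ^+ 2))).
  have h1 : is_derive t 1 (halfdisc a \o sin) (semicircle (sin t) * cos t).
    by apply: is_derive1_comp; exact: is_derive_halfdisc.
  have h2 := is_deriveM (is_derive_sin t) (is_derive_cos t).
  have h3 := is_deriveD (is_derive_id t 1) h2.
  have h4 := is_deriveB h1 (is_deriveZ 2^-1 h3).
  have <- : halfdisc a \o sin - 2^-1 \*: (id + sin * cos) = B.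
    by apply/funext => u; rewrite /B [_ / 2]mulrC.
  by apply: is_derive_eq; rewrite /GRing.scale /= mulrN.
have cB : {within `[- (pi / 2), pi / 2], continuous B}.
  apply: derivable_within_continuous => t _.
  exact: (@ex_derive _ _ _ _ _ _ _ (dB t)).
have pi0 := pi_gt0 R.
have pile : - (pi / 2) <= pi / 2 :> R by rewrite ge0_cp// divr_ge0// ltW.
have [c] := @MVT_segment R B _ _ _ pile (fun t _ => dB t) cB.
rewrite in_itv /= => cpi; have cc := cos_ge0_pihalf cpi.
have -> : semicircle (sin c) = cos c.
  by rewrite /semicircle -(cos2Dsin2 c) addrK sqrtr_sqr ger0_norm.
have -> : cos c * cos c - 2^-1 * (1 + (- sin c ^+ 2 + cos c ^+ 2)) = 0.
  by have := cos2Dsin2 c; clear; lra.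
rewrite mul0r /B sinN cosN sin_pihalf cos_pihalf !mulr0 !addr0 (halfdisc_eq0 a1 (lexx (-1))).
by move=> /eqP; rewrite subr_eq0 => /eqP; clear; lra.
Qed.

End Semicircle.

Section SemicircleSums.
Variable R : realType.

(* If the sums were small for all [L >= L0], then
   [f L = \sum_(i < N) halfdisc (om i.+1 / L - kappa)] would have slope at
   least [- pi / 2 * D2 * (kappa + 1)], whereas it drops from about
   [N * pi / 2] to 0 between [L0] and [om N / (kappa - 1)]; this contradicts
   [D * om N < N]. *)
Lemma semicircle_sum_large (om : nat -> R) (kappa D D2 : R) :
  (forall n, (1 <= n)%N -> 0 < om n) ->
  (forall m n, (1 <= m)%N -> (m < n)%N -> om m < om n) ->
  (forall X : R, exists2 n, (1 <= n)%N & X <= om n) ->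
  1 < kappa -> 0 <= D2 -> D2 * (kappa + 1) / (kappa - 1) < D ->
  (forall N, exists2 n, (N <= n)%N & D * om n < n%:R) ->
  forall L0 : R, 0 < L0 -> exists (L : R) (N : nat), L0 <= L /\
    pi / 2 * D2 * L <= \sum_(i < N) semicircle (om i.+1 / L - kappa).
Proof.
move=> om0 omS omX k1 D20 D2D Dom L0 L00; apply: contrapT => none.
have small L N : L0 <= L ->
    \sum_(i < N) semicircle (om i.+1 / L - kappa) <= pi / 2 * D2 * L.
  by move=> LL; rewrite leNgt; apply/negP => h; apply: none; exists L, N; split; rewrite // ltW.
have pi2 : 0 < pi / 2 :> R by rewrite divr_gt0 ?pi_gt0.
have k10 : 0 < kappa - 1 by rewrite subr_gt0.
have kp : 0 < kappa by exact: lt_trans k1.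
(* Left of -1 and of every number om i / L - kappa, so that [halfdisc a] is differentiable at each
   of them. *)
pose a := - kappa - 1.
have aom i (L : R) : 0 < L -> a < om i.+1 / L - kappa.
  move=> Lp; have := divr_gt0 (om0 i.+1 isT) Lp; rewrite /a; set q := _ / _.
  by move: q; clear; move=> q; lra.
have a1 : a < -1 by rewrite /a; move: kp; clear; lra.
(* From index [n0] on, the points lie to the right of the gap at scale [L0], so their half-discs are
   complete. *)
have [n0 n01 Xn0] := omX ((kappa + 1) * L0).
pose D1 := D2 * (kappa + 1) / (kappa - 1).
have D10 : 0 <= D1 by rewrite divr_ge0 ?(ltW k10)// mulr_ge0// addr_ge0// ltW.
have Dp : 0 < D by exact: le_lt_trans D2D.
(* So large that the fewer than [n0] initial terms, for which no drop is claimed, do not spoil the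
   comparison of D1 with D. *)
have [N] := Dom (maxn n0 (Num.bound (n0%:R / (1 - D1 / D)))).
rewrite geq_max => /andP[n0N NN] DN.
have N1 : (1 <= N)%N by exact: leq_trans n0N.
have omN : om n0 <= om N.
  by move: n0N; rewrite leq_eqVlt => /predU1P[->//|nN]; rewrite ltW// omS.
(* The scale at which the first [N] points have all passed to the left of the gap. *)
pose La := om N / (kappa - 1).
have LaL0 : L0 <= La.
  rewrite ler_pdivlMr// (le_trans _ omN)// (le_trans _ Xn0)// mulrC ler_pM2r//.
  by clear; lra.
pose f (L : R) : R := \sum_(i < N) halfdisc a (om i.+1 / L - kappa).
have df (L : R) : 0 < L -> is_derive L 1 f
    (\sum_(i < N) (semicircle (om i.+1 / L - kappa) * - (om i.+1 / L ^+ 2))).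
  move=> Lp; have -> : f = \sum_(i < N) (fun L => halfdisc a (om i.+1 / L - kappa)).
    by apply/funext => x; rewrite fct_sumE.
  apply: is_derive_sum => i.
  have h0 : is_derive L 1 (fun y : R => y^-1) (- L ^- 2 *: 1).
    exact: (@is_deriveV R id L 1 1 (lt0r_neq0 Lp) (is_derive_id _ _)).
  have h1 : is_derive L 1 (fun y : R => om i.+1 / y - kappa) (- (om i.+1 / L ^+ 2)).
    have h2 := is_deriveB (is_deriveZ (om i.+1) h0) (is_derive_cst kappa L 1).
    by move/is_derive_eq : h2; apply; rewrite /GRing.scale /= mulr1 subr0 mulrN.
  have h3 := is_derive_halfdisc (aom i L Lp).
  exact: (@is_derive1_comp R (halfdisc a) (fun y : R => om i.+1 / y - kappa) L _ _ h3 h1).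
have La0 : 0 < La by exact: lt_le_trans LaL0.
have dfin t : t \in `[L0, La] -> is_derive t 1 f
    (\sum_(i < N) (semicircle (om i.+1 / t - kappa) * - (om i.+1 / t ^+ 2))).
  by rewrite in_itv /= => /andP[tL _]; apply: df; exact: lt_le_trans tL.
have cf : {within `[L0, La], continuous f}.
  apply: derivable_within_continuous => t /dfin dt.
  exact: (@ex_derive _ _ _ _ _ _ _ dt).
have dfoo t : t \in `]L0, La[ -> is_derive t 1 f
    (\sum_(i < N) (semicircle (om i.+1 / t - kappa) * - (om i.+1 / t ^+ 2))).
  by move=> tt; apply: dfin; exact: subset_itv_oo_cc tt.
have [c] := @MVT_segment R f _ L0 La LaL0 dfoo cf.
rewrite in_itv /= => /andP[cL0 cLa] fE.
have cp : 0 < c by exact: lt_le_trans cL0.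
have dle : - ((kappa + 1) * (pi / 2 * D2)) <=
    \sum_(i < N) (semicircle (om i.+1 / c - kappa) * - (om i.+1 / c ^+ 2)).
  have h1 : \sum_(i < N) (semicircle (om i.+1 / c - kappa) * (om i.+1 / c ^+ 2)) <=
      (kappa + 1) / c * \sum_(i < N) semicircle (om i.+1 / c - kappa).
    rewrite mulr_sumr; apply: ler_sum => i _; rewrite mulrC.
    have [h|h] := leP 1 `|om i.+1 / c - kappa|.
      by rewrite semicircle_eq0// !mulr0.
    rewrite ler_wpM2r ?sqrtr_ge0// expr2 invfM mulrA ler_pM2r ?invr_gt0//.
    by move: h; rewrite ltr_norml => /andP[_]; rewrite ltrBlDl => /ltW.
  have h2 := small c N cL0.
  have h3 : (kappa + 1) / c * \sum_(i < N) semicircle (om i.+1 / c - kappa) <=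
      (kappa + 1) / c * (pi / 2 * D2 * c).
    by rewrite ler_wpM2l// divr_ge0 ?(ltW cp)// addr_ge0// ltW.
  have h4 : (kappa + 1) / c * (pi / 2 * D2 * c) = (kappa + 1) * (pi / 2 * D2).
    by field; rewrite gt_eqF.
  under eq_bigr => i _ do rewrite mulrN.
  rewrite sumrN lerN2; apply: le_trans h1 _; apply: le_trans h3 _.
  by rewrite h4.
have fLa : f L0 - f La <= (kappa + 1) * (pi / 2 * D2) * La.
  have h : - ((kappa + 1) * (pi / 2 * D2)) * (La - L0) <= f La - f L0.
    by rewrite fE ler_wpM2r// subr_ge0.
  have h2 : 0 <= (kappa + 1) * (pi / 2 * D2) * L0.
    have kp1 : 0 <= kappa + 1 by rewrite addr_ge0// ltW.
    by rewrite mulr_ge0 ?(ltW L00)// mulr_ge0// mulr_ge0// ltW.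
  by move: h h2; clear; lra.
pose g (i : nat) : R := halfdisc a (om i.+1 / L0 - kappa) - halfdisc a (om i.+1 / La - kappa).
have g0 i : 0 <= g i.
  rewrite subr_ge0; apply: halfdisc_le; first exact: aom.
  by rewrite lerD2r ler_pM2l ?om0// lef_pV2 ?posrE.
have gbig i : (n0.-1 <= i < N)%N -> pi / 2 <= g i.
  move=> /andP[ni iN]; have {}ni : (n0 <= i.+1)%N by rewrite -(prednK n01).
  have omi : om n0 <= om i.+1.
    by move: ni; rewrite leq_eqVlt => /predU1P[->//|nN]; rewrite ltW// omS.
  have omi2 : om i.+1 <= om N.
    by move: iN; rewrite leq_eqVlt => /predU1P[->//|nN]; rewrite ltW// omS.
  rewrite /g [X in _ - X]halfdisc_eq0 ?aom// ?subr0; last first.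
    have : om i.+1 / La <= kappa - 1.
      by rewrite ler_pdivrMr// /La mulrC divfK ?gt_eqF.
    by clear; lra.
  rewrite -(halfdisc_total a1); apply: halfdisc_le.
    by move: a1; clear; lra.
  have : kappa + 1 <= om i.+1 / L0 by rewrite ler_pdivlMr// (le_trans Xn0).
  by clear; lra.
have fge : pi / 2 * (N - n0.-1)%:R <= f L0 - f La.
  rewrite /f -sumrB -(big_mkord xpredT g) (@big_cat_nat _ _ _ n0.-1)//=; last first.
    by rewrite (leq_trans (leq_pred _)).
  rewrite -[leLHS]add0r lerD ?sumr_ge0//.
  rewrite mulr_natr -sumr_const_nat; apply: ler_sum_nat => i; exact: gbig.
have D1D : D1 / D < 1 by rewrite ltr_pdivrMr// mul1r.
have key : (N - n0.-1)%:R <= D1 * om N.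
  have h := le_trans fge fLa.
  have h2 : (kappa + 1) * (pi / 2 * D2) * La = pi / 2 * (D1 * om N).
    by rewrite /La /D1; field; rewrite gt_eqF.
  by move: h; rewrite h2 ler_pM2l.
have key2 : D1 * om N <= D1 / D * N%:R.
  have : D1 / D * (D * om N) <= D1 / D * N%:R.
    have dd : 0 <= D1 / D by apply: divr_ge0 => //; exact: ltW.
    by apply: ler_wpM2l => //; exact: ltW.
  by rewrite mulrA divfK// gt_eqF.
have key3 : n0%:R < (1 - D1 / D) * N%:R.
  have d10 : 0 < 1 - D1 / D by rewrite subr_gt0.
  rewrite mulrC -ltr_pdivrMr//.
  apply: (lt_le_trans (archi_boundP _)); first by rewrite divr_ge0// ltW.
  by rewrite ler_nat.
have key4 : N%:R <= (N - n0.-1)%:R + n0%:R :> R.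
  by rewrite -natrD ler_nat; move: n01 n0N; clear; lia.
by move: key key2 key3 key4; set A := D1 / D; set X := D1 * om N; clear; lra.
Qed.

End SemicircleSums.

(** * Uniqueness for zeros of large upper density *)

Section DenseZeros.
Variable R : realType.

Lemma bounded_zeros (F : R[i] -> R[i]) (om : nat -> R) (X : R) : entire F ->
  (forall n, (1 <= n)%N -> 0 < om n) ->
  (forall m n, (1 <= m)%N -> (m < n)%N -> om m < om n) ->
  (forall n, (1 <= n)%N -> om n <= X) ->
  (forall n, (1 <= n)%N -> F (om n)%:C = 0) -> forall z, F z = 0.
Proof.
move=> eF om0 omS omX Fom.
pose E := range (fun n => om n.+1).
have supE : has_sup E.
  split; first by exists (om 1%N); exists 0%N.
  by exists X => _ [n _ <-]; exact: omX.
have ltsup n : om n.+1 < sup E.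
  apply: (@lt_le_trans _ _ (om n.+2)); first exact: omS.
  by apply: (ub_le_sup supE.2); exists n.+1.
apply: (@identity_theorem R F (sup E)%:C eF) => e e0.
have [_ [n _ <-] h] := sup_adherent e0 supE.
have hn := ltsup n.
have nE : nm ((om n.+1)%:C - (sup E)%:C) = sup E - om n.+1.
  by rewrite -rmorphB nm_real distrC ger0_norm// subr_ge0 ltW.
exists (om n.+1)%:C; split; last exact: Fom.
- by rewrite -subr_eq0 -nm_gt0 nE subr_gt0.
- by rewrite nE; move: h; clear; lra.
Qed.

Lemma dense_zeros (F : R[i] -> R[i]) (C0 tau D : R) (om : nat -> R) :
  entire F -> 0 <= tau -> tau < pi * D ->
  (forall z, nm (F z) <= C0 * expR (tau * `|Im z|)) ->
  (forall n, (1 <= n)%N -> 0 < om n) ->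
  (forall m n, (1 <= m)%N -> (m < n)%N -> om m < om n) ->
  (forall N, exists2 n, (N <= n)%N & D * om n < n%:R) ->
  (forall n, (1 <= n)%N -> F (om n)%:C = 0) -> forall z, F z = 0.
Proof.
move=> eF tau0 tauD FC om0 omS Dom Fom.
(* Infinitely many distinct zeros in a bounded interval accumulate; only an unbounded sequence needs
   the density argument. *)
have [[X omX]|unb] := pselect (exists X, forall n, (1 <= n)%N -> om n <= X).
  exact: (bounded_zeros eF om0 omS omX Fom).
have omX X : exists2 n, (1 <= n)%N & X <= om n.
  apply: contrapT => h; apply: unb; exists X => n n1; rewrite leNgt; apply/negP => hn.
  by apply: h; exists n => //; exact: ltW.
have C00 : 0 <= C0.
  exact: growth_ge0 FC.
have pi0 := pi_gt0 R.
have Dp : 0 < D by rewrite -(pmulr_rgt0 _ pi0) (le_lt_trans tau0).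
(* A density strictly between tau / pi and D: the first inequality gives tau < 2 K, the second
   leaves room for the factor (kappa + 1) / (kappa - 1). *)
pose D2 := (tau / pi + D) / 2.
have tp : tau / pi < D by rewrite ltr_pdivrMr// mulrC.
have tp0 : 0 <= tau / pi by rewrite divr_ge0// ltW.
have D2D : D2 < D by rewrite /D2; move: tp; clear; lra.
have D20 : 0 < D2 by rewrite /D2; move: tp0 Dp; clear; lra.
pose K := pi / 2 * D2.
have K0 : 0 <= K by apply: mulr_ge0; [apply: divr_ge0|]; rewrite // ltW.
have tauK : tau < 2 * K.
  have -> : 2 * K = pi * D2 by rewrite /K; field.
  rewrite -ltr_pdivrMl// mulrC /D2; move: tp; clear; lra.
have [e0 /andP[e00 e01] He] := lowering_constant tau0 tauK.
(* The second entry makes kappa = 1/e so large that D2 (kappa + 1) < D (kappa - 1). *)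
pose e := Num.min (e0 / 2) ((D - D2) / (2 * (D + D2))).
have DD2 : 0 < 2 * (D + D2) by rewrite mulr_gt0// addr_gt0.
have ep : 0 < e by rewrite lt_min !divr_gt0// subr_gt0.
have ee0 : e < e0 by rewrite gt_min ltr_pdivrMr// ltr_pMr// ltr1n.
have eD : e * (2 * (D + D2)) <= D - D2.
  by rewrite -ler_pdivlMr// ge_min lexx orbT.
have [rho [c [rho01 c0 cZ]]] := He e ltac:(by rewrite ep).
pose kappa := e^-1.
have e10 : e < 10^-1 by exact: lt_le_trans ee0 e01.
have kp : 10 < kappa by rewrite -[ltLHS]invrK ltf_pV2 ?posrE ?invr_gt0 ?ltr0n.
have k3 : 3 <= kappa by move: kp; clear; lra.
have k1 : 1 < kappa by move: kp; clear; lra.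
have D2k : D2 * (kappa + 1) / (kappa - 1) < D.
  rewrite ltr_pdivrMr ?subr_gt0//.
  have : kappa * (e * (2 * (D + D2))) <= kappa * (D - D2).
    by rewrite ler_wpM2l// ltW// (lt_trans _ k1).
  rewrite mulrA mulVf ?gt_eqF// mul1r; move: D20 Dp; clear; lra.
have gap : forall L0 : R, 0 < L0 -> exists (L : R) (s : seq R), [/\ L0 <= L, uniq s,
     {in s, forall d, `|d| < 1 /\ F (kappa * L + L * d)%:C = 0} &
     K * L <= \sum_(d <- s) Num.sqrt (1 - d ^+ 2)].
  move=> L0 L00.
  have [L [N [LL0 h]]] := semicircle_sum_large om0 omS omX k1 (ltW D20) D2k Dom L00.
  have Lp : 0 < L by exact: lt_le_trans LL0.
  pose t i := om i.+1 / L - kappa.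
  exists L, [seq d <- [seq t i | i <- iota 0 N] | `|d| < 1]; split => //.
  - apply: filter_uniq; rewrite map_inj_uniq ?iota_uniq// => m n.
    have Li : L^-1 != 0 by rewrite invr_neq0// gt_eqF.
    move=> /addIr/(mulIf Li) mn; apply/eqP; rewrite eqn_leq leqNgt andbC leqNgt.
    apply/andP; split; apply/negP => lt.
      by have := omS m.+1 n.+1 isT lt; rewrite mn ltxx.
    by have := omS n.+1 m.+1 isT lt; rewrite mn ltxx.
  - move=> d; rewrite mem_filter => /andP[d1 /mapP[i _ dE]]; split => //.
    rewrite dE (_ : kappa * L + L * t i = om i.+1) ?Fom//.
    by rewrite /t; field; rewrite gt_eqF.
  - apply: le_trans h _; rewrite big_filter big_map.
    rewrite -(big_mkord xpredT (fun i => semicircle (t i))) /index_iota subn0 [leRHS]big_mkcond /=.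
    apply: ler_sum => i _; case: ltP => // ti.
    by rewrite semicircle_eq0.
pose tau' (m : nat) : R := tau - m%:R * c.
have low m : 0 <= tau' m ->
    forall z, nm (F z) <= C0 * expR (tau' m * `|Im z|).
  elim: m => [|m IH] tm z; first by rewrite /tau' mul0r subr0.
  have tE : tau' m.+1 = tau' m - c by rewrite /tau' -addn1 natrD; ring.
  have tm0 : 0 <= tau' m by move: tm; rewrite tE; move: c0; clear; lra.
  have [z0|z0] := eqVneq (Im z) 0.
    by have := FC z; rewrite z0 normr0 !mulr0.
  rewrite tE; apply: (type_lowering eF k3 K0 rho01 cZ gap _ (IH tm0)) => //.
  rewrite tm0 /tau' lerBlDr lerDl; apply: mulr_ge0 => //; exact: ltW.
(* After [m] reductions the type is below [c]; one more makes it negative off the real axis. There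
   [F] is then bounded and tends to 0 along the imaginary axis, while on the real axis the original
   bound is [C0]. *)
pose m := Num.trunc (tau / c).
have tc0 : 0 <= tau / c by apply: divr_ge0 => //; exact: ltW.
have /andP[m1 m2] := truncn_itv tc0.
have tm0 : 0 <= tau' m by rewrite subr_ge0 -ler_pdivlMr.
have tmc : tau' m < c.
  by move: m2; rewrite -/m ltr_pdivrMr// -addn1 natrD mulrDl mul1r /tau' ltrBlDl.
have tmtau : 0 <= tau' m <= tau.
  rewrite tm0 /tau' lerBlDr lerDl; apply: mulr_ge0 => //; exact: ltW.
have last := type_lowering eF k3 K0 rho01 cZ gap tmtau (low m tm0).
have FM z : nm (F z) <= C0.
  have [z0|z0] := eqVneq (Im z) 0.
    by have := FC z; rewrite z0 normr0 mulr0 expR0 mulr1.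
  apply: le_trans (last z z0) _; rewrite -[leRHS]mulr1 ler_wpM2l// -expR0 ler_expR.
  by rewrite nmulr_rle0 ?subr_lt0.
apply: (liouville0 eF FM) => e1 e1p.
pose y : R := C0 / e1 / (c - tau' m) + 1.
have ct : 0 < c - tau' m by rewrite subr_gt0.
have y0 : 0 < y.
  by apply: ltr_wpDl => //; apply: divr_ge0; [apply: divr_ge0|]; rewrite // ltW.
exists (y *i); apply: le_trans (last _ _) _; first by rewrite /= gt_eqF.
rewrite /= gtr0_norm// -opprB mulNr expRN ler_pdivrMr ?expR_gt0//.
apply: le_trans (_ : C0 <= e1 * (1 + (c - tau' m) * y)) _.
  have -> : (c - tau' m) * y = C0 / e1 + (c - tau' m).
    by rewrite /y; field; rewrite !gt_eqF.
  rewrite mulrDr mulrDr mulr1 mulrCA divff ?mulr1 ?gt_eqF//.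
  by have : 0 <= e1 * (c - tau' m) by [apply: mulr_ge0; exact: ltW]; move: e1p; clear; lra.
by rewrite ler_pM2l// expR_ge1Dx.
Qed.

End DenseZeros.

(** * Fourier transforms of compactly supported functions *)

Section ComplexIntegral.
Variable R : realType.
Implicit Types (f g u : R -> R[i]).

Definition cmeasurable f : Prop :=
  measurable_fun [set: R] (fun x => Re (f x)) /\
  measurable_fun [set: R] (fun x => Im (f x)).

Lemma ReD (z w : R[i]) : Re (z + w) = Re z + Re w.
Proof. by case: z w => ? ? []. Qed.

Lemma ImD (z w : R[i]) : Im (z + w) = Im z + Im w.
Proof. by case: z w => ? ? []. Qed.

Lemma ReM (z w : R[i]) : Re (z * w) = Re z * Re w - Im z * Im w.
Proof. by case: z w => ? ? []. Qed.

Lemma ImM (z w : R[i]) : Im (z * w) = Re z * Im w + Im z * Re w.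
Proof. by case: z w => ? ? []. Qed.

Lemma cmeasurableD f g : cmeasurable f -> cmeasurable g ->
  cmeasurable (fun x => f x + g x).
Proof.
move=> [f1 f2] [g1 g2]; split.
  rewrite (_ : (fun x => _) = (fun x => Re (f x)) \+ (fun x => Re (g x))).
    exact: measurable_funD.
  by apply/funext => x /=; rewrite ReD.
rewrite (_ : (fun x => _) = (fun x => Im (f x)) \+ (fun x => Im (g x))).
  exact: measurable_funD.
by apply/funext => x /=; rewrite ImD.
Qed.

Lemma cmeasurableM f g : cmeasurable f -> cmeasurable g ->
  cmeasurable (fun x => f x * g x).
Proof.
move=> [f1 f2] [g1 g2]; split.
  rewrite (_ : (fun x => _) = (fun x => Re (f x) * Re (g x)) \- (fun x => Im (f x) * Im (g x))).
    by apply: measurable_funB; apply: measurable_funM.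
  by apply/funext => x /=; rewrite ReM.
rewrite (_ : (fun x => _) = (fun x => Re (f x) * Im (g x)) \+ (fun x => Im (f x) * Re (g x))).
  by apply: measurable_funD; apply: measurable_funM.
by apply/funext => x /=; rewrite ImM.
Qed.

Lemma cmeasurable_cst (c : R[i]) : cmeasurable (fun=> c).
Proof. by split; exact: measurable_cst. Qed.

Lemma cmeasurable_conj f : cmeasurable f -> cmeasurable (fun x => (f x)^*).
Proof.
move=> [f1 f2]; split.
  by rewrite (_ : (fun x => _) = (fun x => Re (f x)))//; apply/funext => x; case: (f x).
rewrite (_ : (fun x => _) = (fun x => - Im (f x))); first exact: measurableT_comp.
by apply/funext => x; case: (f x).
Qed.

Lemma cmeasurable_comp f (t : R -> R) : cmeasurable f ->
  measurable_fun [set: R] t -> cmeasurable (fun x => f (t x)).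
Proof.
by move=> [f1 f2] mt; split; [exact: measurableT_comp f1 mt|exact: measurableT_comp f2 mt].
Qed.

Lemma measurable_nm f : cmeasurable f -> measurable_fun [set: R] (fun x => nm (f x)).
Proof.
move=> [f1 f2].
have sqrtm : measurable_fun [set: R] (@Num.sqrt R).
  by apply: continuous_measurable_fun; exact: sqrt_continuous.
rewrite (_ : (fun x => _) = Num.sqrt \o (fun x => Re (f x) ^+ 2 + Im (f x) ^+ 2)).
  apply: measurableT_comp => //.
  exact: measurable_funD (measurable_funM f1 f1) (measurable_funM f2 f2).
by apply/funext => x /=; case: (f x).
Qed.

Lemma cmeasurable_cexp (z w : R[i]) : cmeasurable (fun s : R => cexp (z + s%:C * w)).
Proof.
have lin (a b : R) : measurable_fun [set: R] (fun s : R => a + s * b).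
  apply: measurable_funD; first exact: measurable_cst.
  by apply: measurable_funM; [exact: measurable_id|exact: measurable_cst].
have ReE s : Re (z + s%:C * w) = Re z + s * Re w by rewrite ReD ReM /= mul0r subr0.
have ImE s : Im (z + s%:C * w) = Im z + s * Im w by rewrite ImD ImM /= mul0r addr0.
split.
  rewrite (_ : (fun s => _) = (fun s => expR (Re z + s * Re w) * cos (Im z + s * Im w))).
    apply: measurable_funM; apply: measurableT_comp => //.
    by apply: continuous_measurable_fun; exact: continuous_cos.
  by apply/funext => s; rewrite -ReE -ImE.
rewrite (_ : (fun s => _) = (fun s => expR (Re z + s * Re w) * sin (Im z + s * Im w))).
  apply: measurable_funM; apply: measurableT_comp => //.
  by apply: continuous_measurable_fun; exact: continuous_sin.
by apply/funext => s; rewrite -ReE -ImE.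
Qed.

Definition cut (A : set R) f : R -> R[i] := fun x => if x \in A then f x else 0.

Lemma cmeasurable_cut f (A : set R) : measurable A -> cmeasurable f ->
  cmeasurable (cut A f).
Proof.
move=> mA [f1 f2]; split.
  rewrite (_ : (fun x => _) = (fun x => Re (f x)) \_ A).
    by apply/(measurable_restrictT _ mA); exact: measurable_funTS.
  by apply/funext => x; rewrite patchE /cut; case: ifP.
rewrite (_ : (fun x => _) = (fun x => Im (f x)) \_ A).
  by apply/(measurable_restrictT _ mA); exact: measurable_funTS.
by apply/funext => x; rewrite patchE /cut; case: ifP.
Qed.

Lemma L1_measurable f : L1 f -> cmeasurable f.
Proof.
move=> [/measurable_int m1 /measurable_int m2].
by split; apply/measurable_EFinP.
Qed.

Lemma L1_nm f : L1 f -> mu.-integrable setT (EFin \o (fun x => nm (f x))).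
Proof.
move=> Lf; have mf := L1_measurable Lf; move: Lf => [i1 i2].
apply: (le_integrable _ _ _ (integrableD _ (integrable_abse i1) (integrable_abse i2))) => //.
  by apply/measurable_EFinP; exact: measurable_nm.
move=> x _ /=; rewrite lee_fin [leLHS]ger0_norm ?nm_ge0// [leRHS]ger0_norm ?addr_ge0//.
exact: nm_le_ReIm.
Qed.

Lemma L1_dominated f (g : R -> R) : cmeasurable f -> (forall x, nm (f x) <= g x) ->
  mu.-integrable setT (EFin \o g) -> L1 f.
Proof.
move=> [m1 m2] fg ig; split.
  apply: (le_integrable _ _ _ ig) => //; first by apply/measurable_EFinP.
  move=> x _ /=; rewrite lee_fin (le_trans (Re_le_nm _))// (le_trans (fg x))//.
  exact: ler_norm.
apply: (le_integrable _ _ _ ig) => //; first by apply/measurable_EFinP.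
move=> x _ /=; rewrite lee_fin (le_trans (Im_le_nm _))// (le_trans (fg x))//.
exact: ler_norm.
Qed.

(** The factor 2 comes from estimating real and imaginary parts separately; the value of the
    constant does not matter in the growth bounds. *)
Lemma nm_cintegral_le f (g : R -> R) : cmeasurable f -> (forall x, nm (f x) <= g x) ->
  mu.-integrable setT (EFin \o g) ->
  nm (cintegral setT f) <= 2 * \int[mu]_x g x.
Proof.
move=> mf fg ig; have [i1 i2] := L1_dominated mf fg ig.
rewrite (le_trans (nm_le_ReIm _))// mulr_natl mulr2n /cintegral /= lerD//.
  rewrite (le_trans (le_normr_Rintegral _ i1))//.
  apply: le_Rintegral => //; first exact: integrable_abse i1.
  by move=> x _; exact: le_trans (Re_le_nm _) (fg x).
rewrite (le_trans (le_normr_Rintegral _ i2))//.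
apply: le_Rintegral => //; first exact: integrable_abse i2.
by move=> x _; exact: le_trans (Im_le_nm _) (fg x).
Qed.

Lemma L1D f g : L1 f -> L1 g -> L1 (fun x => f x + g x).
Proof.
move=> [f1 f2] [g1 g2]; split.
  rewrite (_ : _ \o _ = (EFin \o (fun x => Re (f x))) \+ (EFin \o (fun x => Re (g x))))%E.
    exact: integrableD.
  by apply/funext => x /=; rewrite ReD.
rewrite (_ : _ \o _ = (EFin \o (fun x => Im (f x))) \+ (EFin \o (fun x => Im (g x))))%E.
  exact: integrableD.
by apply/funext => x /=; rewrite ImD.
Qed.

Lemma L1Zl (c : R[i]) f : L1 f -> L1 (fun x => c * f x).
Proof.
move=> Lf; apply: (@L1_dominated _ (fun x => nm c * nm (f x))).
- by apply: cmeasurableM; [exact: cmeasurable_cst|exact: L1_measurable].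
- by move=> x; rewrite nmM.
- by have := integrableZl measurableT (nm c) (L1_nm Lf).
Qed.

Lemma L1_cut (A : set R) f : measurable A -> L1 f -> L1 (cut A f).
Proof.
move=> mA Lf; apply: (L1_dominated _ _ (L1_nm Lf)).
  by apply: cmeasurable_cut => //; exact: L1_measurable.
by move=> x; rewrite /cut; case: ifP => // _; rewrite nm0 nm_ge0.
Qed.

Lemma L1_conj f : L1 f -> L1 (fun x => (f x)^*).
Proof.
move=> Lf; apply: (L1_dominated _ _ (L1_nm Lf)) => [|x].
  exact: cmeasurable_conj (L1_measurable Lf).
by rewrite nm_conj.
Qed.

Lemma cintegralD f g : L1 f -> L1 g ->
  cintegral setT (fun x => f x + g x) = cintegral setT f + cintegral setT g.
Proof.
move=> [f1 f2] [g1 g2]; apply/eqP; rewrite eq_complex /cintegral /=.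
under eq_Rintegral do rewrite ReD.
rewrite RintegralD// eqxx/=.
by under eq_Rintegral do rewrite ImD; rewrite RintegralD.
Qed.

Lemma cintegralZl (c : R[i]) f : L1 f ->
  cintegral setT (fun x => c * f x) = c * cintegral setT f.
Proof.
move=> [f1 f2]; apply/eqP; rewrite eq_complex ReM ImM /cintegral /=.
have i1 (k : R) : mu.-integrable setT (EFin \o (fun x => k * Re (f x))).
  by have := integrableZl measurableT k f1.
have i2 (k : R) : mu.-integrable setT (EFin \o (fun x => k * Im (f x))).
  by have := integrableZl measurableT k f2.
apply/andP; split; apply/eqP.
  under eq_Rintegral do rewrite ReM.
  rewrite (RintegralB _ (i1 _) (i2 _))//.
  by rewrite (RintegralZl _ _ f1)// (RintegralZl _ _ f2).
under eq_Rintegral do rewrite ImM.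
rewrite (RintegralD _ (i2 _) (i1 _))//.
by rewrite (RintegralZl _ _ f1)// (RintegralZl _ _ f2).
Qed.

Lemma cintegral_conj f : L1 f ->
  cintegral setT (fun x => (f x)^*) = (cintegral setT f)^*.
Proof.
move=> [f1 f2]; apply/eqP; rewrite eq_complex /cintegral /=; apply/andP; split; apply/eqP.
  by apply: eq_Rintegral => x _; case: (f x).
rewrite -mulN1r -RintegralZl//; apply: eq_Rintegral => x _; rewrite mulN1r.
by case: (f x).
Qed.

Lemma cintegral_sum n (c : 'I_n -> R[i]) (h : 'I_n -> R -> R[i]) :
  (forall i, L1 (h i)) -> L1 (fun x => \sum_(i < n) c i * h i x) /\
  cintegral setT (fun x => \sum_(i < n) c i * h i x) = \sum_(i < n) c i * cintegral setT (h i).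
Proof.
elim: n c h => [|n IH] c h Lh.
  rewrite big_ord0; have -> : (fun x => \sum_(i < 0) c i * h i x) = (fun=> 0).
    by apply/funext => x; rewrite big_ord0.
  split; first by split; exact: integrable0.
  by rewrite /cintegral /= !Rintegral_cst//= !mul0r.
have [I1 I2] := IH (fun i => c (lift ord0 i)) (fun i => h (lift ord0 i)) (fun i => Lh _).
have -> : (fun x => \sum_(i < n.+1) c i * h i x) = (fun x => c ord0 * h ord0 x +
    \sum_(i < n) c (lift ord0 i) * h (lift ord0 i) x).
  by apply/funext => x; rewrite big_ord_recl.
split; first by apply: L1D => //; exact: L1Zl.
by rewrite big_ord_recl cintegralD ?cintegralZl ?I2//; exact: L1Zl.
Qed.

Lemma ae_imp (P Q : R -> Prop) : (forall x, P x -> Q x) ->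
  {ae mu, forall x, P x} -> {ae mu, forall x, Q x}.
Proof. by move=> PQ; apply: negligibleS => x /= nQ Px; apply: nQ; exact: PQ. Qed.

Lemma ae_and (P Q : R -> Prop) : {ae mu, forall x, P x} -> {ae mu, forall x, Q x} ->
  {ae mu, forall x, P x /\ Q x}.
Proof.
move=> nP nQ; apply: negligibleS (negligibleU nP nQ) => x /= nPQ.
by have [Px|] := pselect (P x); [right=> Qx; exact: nPQ|left].
Qed.

Lemma ae_all (P : nat -> R -> Prop) : (forall n, {ae mu, forall x, P n x}) ->
  {ae mu, forall x, forall n, P n x}.
Proof.
move=> nP; apply: negligibleS (negligible_bigcup nP) => x /= nall.
by apply: contrapT => h; apply: nall => n; apply: contrapT => nPn; apply: h; exists n.
Qed.

Lemma ae_true (P : R -> Prop) : (forall x, P x) -> {ae mu, forall x, P x}.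
Proof.
by move=> Px; apply: negligibleS (negligible_set0 mu) => x /= /(_ (Px x)).
Qed.

Lemma cintegral_ae f g : cmeasurable f -> cmeasurable g ->
  {ae mu, forall x, f x = g x} -> cintegral setT f = cintegral setT g.
Proof.
move=> [f1 f2] [g1 g2] fg; apply/eqP; rewrite eq_complex /cintegral /=.
apply/andP; split; apply/eqP; rewrite /Rintegral; congr fine; apply: ae_eq_integral => //.
- by apply/measurable_EFinP.
- by apply/measurable_EFinP.
- by apply: ae_imp fg => x /= -> .
- by apply/measurable_EFinP.
- by apply/measurable_EFinP.
- by apply: ae_imp fg => x /= -> .
Qed.

End ComplexIntegral.

(** * Fourier transforms in the complex plane *)

Section FourierTransform.
Variable R : realType.
Implicit Types (f g u v : R -> R[i]).

(** Dominated convergence: the set where the exponent does not decay carries no mass of [g]. *)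
Lemma integral_exp_decay (g theta : R -> R) (e : R) :
  mu.-integrable setT (EFin \o g) -> measurable_fun [set: R] theta ->
  (forall s, 0 <= g s) -> (forall s, g s != 0 -> 0 <= theta s) ->
  {ae mu, forall s, g s != 0 -> 0 < theta s} -> 0 < e ->
  \forall n \near \oo, \int[mu]_s (g s * expR (- (n%:R * theta s))) <= e.
Proof.
move=> ig mt g0 t0 tae e0.
have mg : measurable_fun [set: R] g by apply/measurable_EFinP; exact: measurable_int ig.
have mf n : measurable_fun [set: R] (fun s => g s * expR (- (n%:R * theta s))).
  apply: measurable_funM => //; apply: measurableT_comp => //.
  by apply: measurableT_comp => //; apply: measurable_funM => //; exact: measurable_cst.
have mf' n : measurable_fun [set: R] (fun s => (g s * expR (- (n%:R * theta s)))%:E).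
  by apply/measurable_EFinP.
have pw : {ae mu, forall s, setT s ->
    (g s * expR (- (n%:R * theta s)))%:E @[n --> \oo] --> 0%E}.
  apply: ae_imp tae => s ts _.
  apply/cvg_EFin; first by near=> n.
  have [gs|gs] := eqVneq (g s) 0.
    rewrite (_ : _ \o _ = cst 0); first exact: cvg_cst.
    by apply/funext => n /=; rewrite gs mul0r.
  rewrite (_ : _ \o _ = (fun n => g s * expR (- theta s) ^+ n)); last first.
    by apply/funext => n /=; rewrite -expRM_natl mulrN.
  rewrite -[X in _ --> X](mulr0 (g s)).
  apply: cvgM; first exact: cvg_cst.
  apply: cvg_expr; rewrite ger0_norm ?expR_ge0//.
  by rewrite -expR0 ltr_expR oppr_lt0; exact: ts.
have dom : {ae mu, forall s, forall n, setT s ->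
    (`|(g s * expR (- (n%:R * theta s)))%:E| <= (EFin \o g) s)%E}.
  apply: ae_true => s n _ /=; rewrite lee_fin ger0_norm ?mulr_ge0 ?expR_ge0//.
  have [->|gs] := eqVneq (g s) 0; first by rewrite mul0r.
  rewrite -[leRHS]mulr1 ler_wpM2l// -expR0 ler_expR oppr_le0 mulr_ge0//.
  exact: t0.
have [_ _] := @dominated_convergence _ _ R mu setT measurableT
  (fun n s => (g s * expR (- (n%:R * theta s)))%:E) (cst 0%E) (EFin \o g)
  mf' (measurable_cst _) pw ig dom.
rewrite integral0 => /fine_cvg /cvgr_le /(_ e e0); exact.
Unshelve. all: by end_near. Qed.

Variables (B : R) (B0 : 0 <= B).

(** With this sign and scale the frequency omega corresponds to z = - 2 pi omega. *)
Definition fourier u (z : R[i]) : R[i] :=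
  cintegral setT (fun s => u s * cexp (s%:C * ('i * z))).

(** Vanishing is required at every point, not almost everywhere; [windowed] achieves this by cutting
    off. *)
Definition supported u : Prop := forall s, B < `|s| -> u s = 0.

Lemma fourier_kernel_le (s : R) z : Re (s%:C * ('i * z)) = - (s * Im z).
Proof. by case: z => a b /=; ring. Qed.

Lemma fourier_dominated u z s : supported u ->
  nm (u s * cexp (s%:C * ('i * z))) <= expR (B * `|Im z|) * nm (u s).
Proof.
move=> su; rewrite nmM mulrC; have [sB|sB] := ltP B `|s|.
  by rewrite su// nm0 !mulr0.
rewrite ler_wpM2r ?nm_ge0// nm_cexp fourier_kernel_le ler_expR.
by rewrite (le_trans (ler_norm _))// normrN normrM ler_wpM2r.
Qed.

Lemma L1_fourier u z : L1 u -> supported u -> L1 (fun s => u s * cexp (s%:C * ('i * z))).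
Proof.
move=> Lu su; apply: (L1_dominated (g := fun s => expR (B * `|Im z|) * nm (u s))).
- apply: cmeasurableM; first exact: L1_measurable.
  have := cmeasurable_cexp 0 ('i * z).
  by rewrite (_ : (fun s => _) = (fun s => cexp (s%:C * ('i * z))))//; apply/funext => s; rewrite add0r.
- by move=> s; exact: fourier_dominated.
- by have := integrableZl measurableT (expR (B * `|Im z|)) (L1_nm Lu).
Qed.

Lemma fourier_bound u z : L1 u -> supported u ->
  nm (fourier u z) <= 2 * \int[mu]_s nm (u s) * expR (B * `|Im z|).
Proof.
move=> Lu su.
have iu : mu.-integrable setT (EFin \o (fun s => expR (B * `|Im z|) * nm (u s))).
  by have := integrableZl measurableT (expR (B * `|Im z|)) (L1_nm Lu).
have := nm_cintegral_le (L1_measurable (L1_fourier z Lu su))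
  (fun s => fourier_dominated z s su) iu.
by rewrite (RintegralZl _ _ (L1_nm Lu))// -mulrA [X in _ <= _ * X]mulrC.
Qed.

(** The exponential is expanded around [z] under the integral. On the support |s| <= B, so the
    Taylor remainder is uniformly of order |h|^(m+1), which is what [taylor_smooth] asks for. *)
Lemma entire_fourier u : L1 u -> supported u -> entire (fourier u).
Proof.
move=> Lu su z m.
pose a k : R[i] := cintegral setT
  (fun s => u s * cexp (s%:C * ('i * z)) * ((s%:C * 'i) ^+ k / k`!%:R)).
pose U s : R := expR (B * `|Im z|) * nm (u s).
have iU : mu.-integrable setT (EFin \o U).
  by have := integrableZl measurableT (expR (B * `|Im z|)) (L1_nm Lu).
have mlin (k : nat) : cmeasurable (fun s : R => (s%:C * 'i) ^+ k / k`!%:R).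
  apply: cmeasurableM; last exact: cmeasurable_cst.
  elim: k => [|k IH]; first exact: cmeasurable_cst.
  have mid : cmeasurable (fun s : R => s%:C * 'i).
    apply: cmeasurableM; last exact: cmeasurable_cst.
    by split; [exact: measurable_id|exact: measurable_cst].
  rewrite (_ : (fun s => _) = (fun s : R => s%:C * 'i * (s%:C * 'i) ^+ k)).
    exact: cmeasurableM.
  by apply/funext => s; rewrite exprS.
have mk := L1_measurable (L1_fourier z Lu su).
have La k : L1 (fun s => u s * cexp (s%:C * ('i * z)) * ((s%:C * 'i) ^+ k / k`!%:R)).
  apply: (L1_dominated (g := fun s => B ^+ k * U s)).
  - exact: cmeasurableM.
  - move=> s; rewrite nmM mulrC; have [sB|sB] := ltP B `|s|.
      by rewrite su// mul0r nm0 mulr0 mulr_ge0 ?exprn_ge0// mulr_ge0 ?expR_ge0 ?nm_ge0.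
    rewrite ler_pM ?nm_ge0// ?fourier_dominated//.
    rewrite nmM nmV nmX nmM nm_real nm_i mulr1.
    rewrite (_ : nm k`!%:R = k`!%:R); last first.
      by rewrite -(rmorph_nat (real_complex R)) nm_real ger0_norm.
    rewrite ler_pdivrMr ?ltr0n ?fact_gt0// -[leLHS]mulr1 ler_pM ?exprn_ge0//.
      by rewrite lerXn2r ?nnegrE.
    by rewrite ler1n fact_gt0.
  - by have := integrableZl measurableT (B ^+ k) iU.
apply: (@taylor_smooth R m _ z a (2 * ((2 * B) ^+ m.+1 * expR B * \int[mu]_s U s))) => h h1.
have [S1 S2] := cintegral_sum (fun k : 'I_m.+1 => h ^+ k) (fun k : 'I_m.+1 => La k).
have -> : fourier u (z + h) - \sum_(k < m.+1) a k * h ^+ k = cintegral setT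
   (fun s => u s * cexp (s%:C * ('i * z)) *
     (cexp (s%:C * ('i * h)) - \sum_(k < m.+1) (s%:C * ('i * h)) ^+ k / k`!%:R)).
  under eq_bigr do rewrite mulrC.
  rewrite -S2 -mulN1r -cintegralZl// -cintegralD//; last 2 first.
  - exact: L1_fourier.
  - exact: L1Zl.
  congr (cintegral _ _); apply/funext => s.
  rewrite (_ : s%:C * ('i * (z + h)) = s%:C * ('i * z) + s%:C * ('i * h)); last by ring.
  rewrite mulN1r cexpD [RHS]mulrBr mulrA; congr (_ - _).
  rewrite mulr_sumr; apply: eq_bigr => k _; rewrite [X in _ = _ * (X ^+ k / _)]mulrA.
  by rewrite [(_ * h) ^+ k]exprMn; ring.
rewrite mulrAC -mulrA.
have iV (c : R) : mu.-integrable setT (EFin \o (fun s => c * U s)).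
  by have := integrableZl measurableT c iU.
have := @nm_cintegral_le R (fun s => u s * cexp (s%:C * ('i * z)) *
     (cexp (s%:C * ('i * h)) - \sum_(k < m.+1) (s%:C * ('i * h)) ^+ k / k`!%:R))
   (fun s => (2 * B) ^+ m.+1 * nm h ^+ m.+1 * expR B * U s).
rewrite (RintegralZl _ _ iU)// => H.
rewrite (_ : nm h ^+ m.+1 * _ = (2 * B) ^+ m.+1 * nm h ^+ m.+1 * expR B * \int[mu]_x U x); last by ring.
apply: H => //.
- apply: cmeasurableM => //.
  have -> : (fun s : R => cexp (s%:C * ('i * h)) - \sum_(k < m.+1) (s%:C * ('i * h)) ^+ k / k`!%:R)
    = (fun s : R => cexp (0 + s%:C * ('i * h)) + (-1) * \sum_(k < m.+1) h ^+ k * ((s%:C * 'i) ^+ k / k`!%:R)).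
    apply/funext => s; rewrite add0r mulN1r; congr (_ - _).
    by apply: eq_bigr => k _; rewrite [s%:C * ('i * h)]mulrA [(_ * h) ^+ k]exprMn; ring.
  apply: cmeasurableD; first exact: cmeasurable_cexp.
  apply: cmeasurableM; first exact: cmeasurable_cst.
  elim: (m.+1) => [|n IH].
    by rewrite (_ : (fun s => _) = (fun=> 0)); [exact: cmeasurable_cst|apply/funext => s; rewrite big_ord0].
  rewrite (_ : (fun s => _) = (fun s : R => (\sum_(k < n) h ^+ k * ((s%:C * 'i) ^+ k / k`!%:R)) +
     h ^+ n * ((s%:C * 'i) ^+ n / n`!%:R))).
    apply: cmeasurableD => //; apply: cmeasurableM => //; exact: cmeasurable_cst.
  by apply/funext => s; rewrite big_ord_recr.
- move=> s; rewrite nmM [leRHS]mulrC; have [sB|sB] := ltP B `|s|.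
    rewrite su// mul0r nm0 mul0r.
    have B2 : 0 <= 2 * B by rewrite mulr_ge0.
    by rewrite /U !mulr_ge0 ?exprn_ge0 ?expR_ge0 ?nm_ge0.
  apply: ler_pM; rewrite ?nm_ge0// ?fourier_dominated//.
  have sh : nm (s%:C * ('i * h)) <= B * nm h.
    by rewrite !nmM nm_i mul1r nm_real ler_wpM2r// nm_ge0.
  rewrite (le_trans (cexp_taylor _ _))//; apply: ler_pM; rewrite ?expR_ge0 ?exprn_ge0 ?mulr_ge0 ?nm_ge0//.
    rewrite -exprMn lerXn2r ?nnegrE ?mulr_ge0 ?nm_ge0// -mulrA.
    by rewrite ler_wpM2l.
  by rewrite ler_expR (le_trans sh)// ler_piMr.
Qed.

End FourierTransform.

Section FourierInjectivity.
Variable R : realType.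
Implicit Types (f g u v : R -> R[i]).

Lemma ae_neq (a : R) : {ae mu, forall s : R, s != a}.
Proof.
apply: (@negligibleS _ _ _ mu [set a]).
  by move=> s /= /negP; rewrite negbK => /eqP.
by apply/negligibleP => //; exact: lebesgue_measure_set1.
Qed.

Lemma measurable_linear (a b : R) : measurable_fun [set: R] (fun s : R => a + s * b).
Proof.
apply: measurable_funD; first exact: measurable_cst.
by apply: measurable_funM; [exact: measurable_id|exact: measurable_cst].
Qed.

(** Relative to exp(B |t| n) the kernel at s is exp(- n (B |t| + s t)), whose exponent vanishes at a
    single endpoint of [-B, B]. That endpoint is a null set, which gives the o(...) instead of
    O(...). *)
Lemma fourier_decay (B : R) u (t e : R) : 0 <= B -> L1 u -> supported B u ->
  t != 0 -> 0 < e ->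
  \forall n \near \oo, nm (fourier u ((t * n%:R) *i)) <= e * expR (B * `|t| * n%:R).
Proof.
move=> B0 Lu su t0 e0.
have t0' : 0 < `|t| by rewrite normr_gt0.
have e20 : 0 < e / 2 by rewrite divr_gt0.
have supp s : nm (u s) != 0 -> `|s| <= B.
  by apply: contraR; rewrite -ltNge => /su ->; rewrite nm0 eqxx.
have dec := integral_exp_decay (L1_nm Lu) (measurable_linear (B * `|t|) t) (fun s => nm_ge0 (u s)) _ _ e20.
have H : \forall n \near \oo, \int[mu]_s (nm (u s) * expR (- (n%:R * (B * `|t| + s * t)))) <= e / 2.
  apply: dec => [s /supp sB|].
    rewrite -lerBlDl sub0r lerNl (le_trans (ler_norm _))// normrN normrM ler_wpM2r//.
  apply: ae_imp (ae_neq (- (B * `|t| / t))) => s sB /supp sB'.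
  rewrite lt_neqAle; apply/andP; split.
    rewrite eq_sym addrC addr_eq0; apply: contra sB => /eqP st.
    by rewrite -mulNr -st mulfK.
  rewrite -lerBlDl sub0r lerNl (le_trans (ler_norm _))// normrN normrM ler_wpM2r//.
near=> n.
have E s : nm (u s * cexp (s%:C * ('i * ((t * n%:R) *i)))) <=
    expR (B * `|t| * n%:R) * (nm (u s) * expR (- (n%:R * (B * `|t| + s * t)))).
  rewrite nmM nm_cexp fourier_kernel_le /= [leRHS]mulrCA -expRD ler_wpM2l ?nm_ge0// ler_expR.
  by rewrite le_eqVlt; apply/orP; left; apply/eqP; ring.
pose q (n : nat) s := nm (u s) * expR (- (n%:R * (B * `|t| + s * t))).
have iq : mu.-integrable setT (EFin \o q n).
  have := L1_nm (L1_fourier ((t * n%:R) *i) Lu su).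
  move=> /(integrableZl measurableT (expR (- (B * `|t| * n%:R)))).
  rewrite (_ : (fun _ => _)%E = EFin \o q n)//; apply/funext => s /=; congr EFin.
  rewrite /q nmM nm_cexp fourier_kernel_le /= [LHS]mulrCA -expRD; congr (_ * expR _); ring.
have := @nm_cintegral_le R _ _ _ E.
rewrite (RintegralZl _ _ iq)// => /(_ _ _)/le_trans; apply => //.
- exact: L1_measurable (L1_fourier _ Lu su).
- by have := integrableZl measurableT (expR (B * `|t| * n%:R)) iq.
- rewrite mulrCA mulrC ler_wpM2r ?expR_ge0// mulrC -ler_pdivlMr//.
  by near: n.
Unshelve. all: by end_near. Qed.

Lemma ae_eq0_primitive (g : R -> R) : mu.-integrable setT (EFin \o g) ->
  (forall a : R, \int[mu]_(s in `]-oo, a]) g s = 0) -> {ae mu, forall s, g s = 0}.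
Proof.
move=> ig g0.
have ig' y : mu.-integrable `]-oo, y] (EFin \o g).
  by apply: integrableS ig => //.
have lg : locally_integrable [set: R] g.
  by apply: (open_integrable_locally _ ig); exact: openT.
have := @FTC1Ny R g ig' lg.
rewrite (_ : (fun x : R => _) = cst 0); last by apply/funext => x; exact: g0.
apply: ae_imp => x [_]; rewrite derive1_cst => <- //.
Qed.

Lemma shifted_fourier_le (B : R) w (a : R) z : L1 w -> supported B w ->
  nm (cexp (- (a%:C * ('i * z))) * fourier w z) <=
  2 * \int[mu]_s (nm (w s) * expR (- ((s - a) * Im z))) /\
  mu.-integrable setT (EFin \o (fun s => nm (w s) * expR (- ((s - a) * Im z)))).
Proof.
move=> Lw sw.
have Lh := L1Zl (cexp (- (a%:C * ('i * z)))) (L1_fourier z Lw sw).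
have nmh s : nm (cexp (- (a%:C * ('i * z))) * (w s * cexp (s%:C * ('i * z)))) =
    nm (w s) * expR (- ((s - a) * Im z)).
  rewrite !nmM mulrCA; congr (_ * _); rewrite !nm_cexp -expRD; congr expR.
  by rewrite fourier_kernel_le -mulNr -(rmorphN (real_complex R)) fourier_kernel_le; ring.
have iq : mu.-integrable setT (EFin \o (fun s => nm (w s) * expR (- ((s - a) * Im z)))).
  rewrite (_ : (fun s => nm (w s) * _) = fun s =>
    nm (cexp (- (a%:C * ('i * z))) * (w s * cexp (s%:C * ('i * z))))); first exact: L1_nm.
  by apply/funext => s; rewrite nmh.
split=> //; rewrite /fourier -cintegralZl; last exact: (L1_fourier _ Lw sw).
by apply: nm_cintegral_le => // [|s]; [exact: L1_measurable|rewrite nmh].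
Qed.

(** Split u at [a] into [u1] and [u2]. Then exp(- i a z) times the transform of [u1] is bounded for
    Im z <= 0; for Im z > 0 it is minus the same expression for [u2], hence bounded too. It tends to
    0 along the negative imaginary axis, so it is 0 by Liouville. At z = 0 this says that the
    integral of u up to [a] vanishes, and [a] is arbitrary. *)
Lemma fourier_inj (B : R) u : 0 <= B -> L1 u -> supported B u ->
  (forall z, fourier u z = 0) -> {ae mu, forall s, u s = 0}.
Proof.
move=> B0 Lu su u0.
suff H a : cintegral setT (cut `]-oo, a] u) = 0.
  have Hr : {ae mu, forall s, Re (u s) = 0}.
    apply: ae_eq0_primitive (Lu.1) _ => a.
    rewrite -[RHS](congr1 Re (H a)) /cintegral /= Rintegral_mkcond.
    by apply: eq_Rintegral => x _; rewrite patchE /cut; case: ifP.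
  have Hi : {ae mu, forall s, Im (u s) = 0}.
    apply: ae_eq0_primitive (Lu.2) _ => a.
    rewrite -[RHS](congr1 Im (H a)) /cintegral /= Rintegral_mkcond.
    by apply: eq_Rintegral => x _; rewrite patchE /cut; case: ifP.
  by apply: ae_imp (ae_and Hr Hi) => s; case: (u s) => x y /= [-> ->].
pose u1 := cut `]-oo, a] u; pose u2 := cut `]a, +oo[ u.
have L1u1 : L1 u1 by apply: L1_cut Lu.
have L1u2 : L1 u2 by apply: L1_cut Lu.
have su1 : supported B u1 by move=> s /su us; rewrite /u1 /cut us; case: ifP.
have su2 : supported B u2 by move=> s /su us; rewrite /u2 /cut us; case: ifP.
have u1a s : nm (u1 s) != 0 -> s <= a.
  rewrite /u1 /cut; case: ifPn => [/[!inE]|_]; first by rewrite /= in_itv.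
  by rewrite nm0 eqxx.
have u2a s : nm (u2 s) != 0 -> a <= s.
  rewrite /u2 /cut; case: ifPn => [/[!inE]|_]; last by rewrite nm0 eqxx.
  by rewrite /= in_itv /= andbT => /ltW.
have u12 z : fourier u1 z = - fourier u2 z.
  apply/eqP; rewrite -addr_eq0 /fourier -cintegralD; [|exact: (L1_fourier _ L1u1 su1)|exact: (L1_fourier _ L1u2 su2)].
  apply/eqP; rewrite -(u0 z); congr cintegral; apply/funext => s.
  rewrite -mulrDl; congr (_ * _); rewrite /u1 /u2 /cut.
  have [sa|sa] := leP s a.
    rewrite mem_set ?memNset ?addr0//= in_itv/= ?andbT//.
    by rewrite ltNge sa.
  rewrite memNset ?mem_set ?add0r//= in_itv/= ?andbT//.
  by rewrite leNgt sa.
pose G z := cexp (- (a%:C * ('i * z))) * fourier u1 z.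
have eG : entire G.
  move=> z m; apply: smoothM; last exact: (entire_fourier B0).
  apply: smooth_comp; last exact: smooth_cexp.
  by apply: smoothN; do 2 apply: smoothM (smooth_cst _ _ _) _; exact: smooth_id.
suff : forall z, G z = 0.
  move=> /(_ 0); rewrite /G !mulr0 oppr0 cexp0 mul1r => <-.
  by congr cintegral; apply/funext => s; rewrite !mulr0 cexp0 mulr1.
have le1 (A : set R) s : nm (cut A u s) <= nm (u s).
  by rewrite /cut; case: ifP => // _; rewrite nm0 nm_ge0.
have bnd w z : L1 w -> supported B w -> (forall s, nm (w s) <= nm (u s)) ->
    (forall s, nm (w s) != 0 -> 0 <= (s - a) * Im z) ->
    nm (cexp (- (a%:C * ('i * z))) * fourier w z) <= 2 * \int[mu]_s nm (u s).
  move=> Lw sw wu w0; have [h1 h2] := shifted_fourier_le a z Lw sw.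
  apply: (le_trans h1); rewrite ler_wpM2l//.
  apply: le_Rintegral => //; first exact: L1_nm.
  move=> s _; apply: le_trans (wu s).
  have [->|ws] := eqVneq (nm (w s)) 0; first by rewrite mul0r.
  by rewrite ler_piMr ?nm_ge0// -expR0 ler_expR oppr_le0 w0.
apply: (liouville0 (M := 2 * \int[mu]_s nm (u s)) eG).
  move=> z; have [z0|z0] := leP (Im z) 0.
    apply: bnd => // [s|s /u1a sa]; first exact: le1.
    by rewrite mulr_le0// subr_le0.
  rewrite /G u12 mulrN nmN; apply: bnd => // [s|s /u2a sa]; first exact: le1.
  by rewrite mulr_ge0 ?subr_ge0 ?(ltW z0).
move=> e e0; have e20 : 0 < e / 2 by rewrite divr_gt0.
have := @integral_exp_decay R (fun s => nm (u1 s)) (fun s => a + s * (-1)) (e / 2)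
  (L1_nm L1u1) (measurable_linear _ _) (fun s => nm_ge0 _) _ _ e20.
case=> [s /u1a sa||N _ HN].
- by rewrite mulrN1 subr_ge0.
- apply: ae_imp (ae_neq a) => s sa /u1a sa'.
  by rewrite mulrN1 subr_gt0 lt_neqAle sa.
- exists ((- N%:R) *i); have [h1 _] := shifted_fourier_le a ((- N%:R) *i) L1u1 su1.
  apply: (le_trans h1); rewrite mulrC -ler_pdivlMr//.
  apply: le_trans (HN N _); last by rewrite /=.
  rewrite le_eqVlt; apply/orP; left; apply/eqP; apply: eq_Rintegral => s _.
  by congr (_ * expR _) => /=; ring.
Qed.

End FourierInjectivity.

(** * Translations and reflections of the line *)

Section MeasurePreserving.
Variable R : realType.
Implicit Types (f g u v : R -> R[i]) (T : R -> R).

Definition preserving T : Prop :=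
  measurable_fun [set: R] T /\ forall A : set R, measurable A -> mu (T @^-1` A) = mu A.

Lemma preserving_comp T T' : preserving T -> preserving T' -> preserving (T \o T').
Proof.
move=> [mT pT] [mT' pT']; split; first exact: measurableT_comp.
move=> A mA; rewrite comp_preimage pT' ?pT//.
by rewrite -[X in measurable X]setTI; exact: mT.
Qed.

Lemma preserving_opp : preserving -%R.
Proof.
split; first by apply: continuous_measurable_fun; exact: opp_continuous.
by move=> A mA; exact: lebesgue_measureN.
Qed.

Lemma preserving_shift (t : R) : preserving (fun x => x + t).
Proof.
have mt : measurable_fun [set: R] (fun x : R => x + t).
  by apply: measurable_funD => //; exact: measurable_cst.
split=> // A mA.
rewrite -[LHS]/(pushforward mu ((fun x : R => x + t) : R -> measurableTypeR R) A).
apply/esym/lebesgue_measure_unique => //= _ [[a b]] _ <-.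
rewrite /pushforward (_ : _ @^-1` _ = `]a - t, b - t]%classic); last first.
  by apply/funext => x; rewrite /= !in_itv /= ltrBlDr lerBrDr.
by rewrite !lebesgue_measure_itv/= !lte_fin ltrD2r; case: ifP => // _; congr EFin; ring.
Qed.

Lemma preserving_reflection (c : R) : preserving (fun x => c - x).
Proof.
have := preserving_comp (preserving_shift c) preserving_opp.
by congr preserving; apply/funext => x /=; rewrite addrC.
Qed.

Lemma ae_preserving T (P : R -> Prop) : preserving T ->
  {ae mu, forall x, P x} -> {ae mu, forall x, P (T x)}.
Proof.
move=> [mT pT] [A [mA A0 PA]]; exists (T @^-1` A); split.
- by rewrite -[X in measurable X]setTI; exact: mT.
- by rewrite pT.
- by move=> x /= nP; exact: PA.
Qed.

Lemma cmeasurable_preserving T f : preserving T -> cmeasurable f ->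
  cmeasurable (fun x => f (T x)).
Proof. by move=> [mT _] mf; exact: (cmeasurable_comp mf). Qed.

Lemma integrable_preserving T (h : R -> R) : preserving T ->
  mu.-integrable setT (EFin \o h) -> mu.-integrable setT (EFin \o (h \o T)) /\
  \int[mu]_x h (T x) = \int[mu]_x h x.
Proof.
move=> [mT pT] ih; have mh := measurable_int _ ih.
pose T' := T : measurableTypeR R -> measurableTypeR R.
have E (k : R -> \bar R) : (\int[pushforward mu T']_x k x = \int[mu]_x k x)%E.
  by apply: eq_measure_integral => A mA _; rewrite /= /pushforward pT.
have ihT : mu.-integrable setT (EFin \o (h \o T)).
  move/integrableP: ih => [_ fin]; apply/integrableP; split.
    exact: (measurableT_comp mh mT).
  have <- := @ge0_integral_pushforward _ _ _ _ R T' mT mu setT (fun x => `|(h x)%:E|%E).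
    by rewrite E.
  - by [].
  - exact: measurableT_comp.
  - by move=> x _ /=; rewrite lee_fin.
split=> //; rewrite /Rintegral; congr fine.
have <- := @integral_pushforward _ _ _ _ R T' mT mu setT (EFin \o h) mh ihT measurableT.
by rewrite E.
Qed.

Lemma L1_preserving T f : preserving T -> L1 f -> L1 (fun x => f (T x)).
Proof.
by move=> pT [/(integrable_preserving pT)[? _] /(integrable_preserving pT)[? _]]; split.
Qed.

Lemma cintegral_preserving T f : preserving T -> L1 f ->
  cintegral setT (fun x => f (T x)) = cintegral setT f.
Proof.
move=> pT [/(integrable_preserving pT)[_ e1] /(integrable_preserving pT)[_ e2]].
by rewrite /cintegral e1 e2.
Qed.

End MeasurePreserving.

(** * Uniqueness from samples of the modulus *)

Section Sampling.
Variable R : realType.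
Implicit Types (f g u v : R -> R[i]).

Lemma conjM (z w : R[i]) : (z * w)^*%C = z^*%C * w^*%C.
Proof.
by case: z w => a b [c d]; complex_ring.
Qed.

Lemma supported_conj (B : R) u : supported B u -> supported B (fun s => (u s)^*%C).
Proof. by move=> su s /su ->; rewrite conjc0. Qed.

Lemma fourier_conj (B : R) u z : L1 u -> supported B u ->
  fourier (fun s => (u s)^*%C) z = (fourier u (- z^*%C))^*%C.
Proof.
move=> Lu su; rewrite /fourier -cintegral_conj; last exact: (L1_fourier _ Lu su).
congr cintegral; apply/funext => s; rewrite conjM cexp_conj; congr (_ * cexp _).
by case: z => a b; complex_ring.
Qed.

(* On the real axis this is [|fourier u (-x)|^2]. *)
Definition power u (z : R[i]) : R[i] := fourier u (- z) * fourier (fun s => (u s)^*%C) z.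

Lemma power_real (B : R) u (x : R) : L1 u -> supported B u ->
  power u x%:C = (nm (fourier u (- x)%:C) ^+ 2)%:C.
Proof.
move=> Lu su; rewrite /power (fourier_conj _ Lu su).
rewrite -(rmorphN (real_complex R)) (_ : - (x%:C)^*%C = (- x)%:C); last first.
  by apply/eqP; rewrite eq_complex /= !oppr0 !eqxx.
by rewrite mulcc.
Qed.

Lemma entire_power (B : R) u : 0 <= B -> L1 u -> supported B u -> entire (power u).
Proof.
move=> B0 Lu su z m; apply: smoothM.
  apply: (@smooth_comp _ _ -%R (fourier u)); first by apply: smoothN; exact: smooth_id.
  exact: (entire_fourier B0 Lu su).
exact: (entire_fourier B0 (L1_conj Lu) (supported_conj su)).
Qed.

Lemma power_bound (B : R) u z : L1 u -> supported B u ->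
  nm (power u z) <= (2 * \int[mu]_s nm (u s)) ^+ 2 * expR (2 * B * `|Im z|).
Proof.
move=> Lu su; rewrite /power nmM expr2 (_ : 2 * B * _ = B * `|Im z| + B * `|Im z|); last by ring.
rewrite expRD mulrACA.
apply: ler_pM; rewrite ?nm_ge0//.
  have := fourier_bound (- z) Lu su.
  by rewrite (_ : Im (- z) = - Im z) ?normrN//; case: (z).
have := fourier_bound z (L1_conj Lu) (supported_conj su).
by under eq_Rintegral do rewrite nm_conj.
Qed.

Lemma power_decay (B : R) u e : 0 <= B -> L1 u -> supported B u -> 0 < e ->
  \forall n \near \oo, nm (power u (n%:R *i)) <= e * expR (2 * B * n%:R).
Proof.
move=> B0 Lu su e0; pose I := 2 * \int[mu]_s nm (u s).
have I0 : 0 <= I.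
  by apply: mulr_ge0 => //; apply: Rintegral_ge0 => // x _; exact: nm_ge0.
have eI : 0 < e / (I + 1) by rewrite divr_gt0// ltr_wpDl.
have N1 : (-1 : R) != 0 by rewrite oppr_eq0 oner_eq0.
apply: filterS (fourier_decay B0 Lu su N1 eI) => n h1.
have := fourier_bound (n%:R *i) (L1_conj Lu) (supported_conj su).
under eq_Rintegral do rewrite nm_conj.
rewrite -/I [Im _]/= normr_nat => h2.
rewrite /power nmM (_ : - (n%:R *i) = (-1 * n%:R) *i); last first.
  by apply/eqP; rewrite eq_complex /= oppr0 mulN1r !eqxx.
apply: (le_trans (ler_pM (nm_ge0 _) (nm_ge0 _) h1 h2)).
rewrite normrN normr1 mulr1 mulrACA -expRD.
rewrite (_ : 2 * B * n%:R = B * n%:R + B * n%:R); last by ring.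
rewrite ler_wpM2r ?expR_ge0// mulrAC ler_pdivrMr ?ltr_wpDl//.
by rewrite ler_wpM2l ?(ltW e0)// lerDl.
Qed.

Lemma dense_frequencies_density (B : R) (om : nat -> R) : 0 < B -> dense_frequencies B om ->
  exists2 r : R, 4 * B < r & forall N, exists2 n, (N <= n)%N & r * om n < n%:R.
Proof.
move=> B0 [om0 _ hl].
have [r r1 r2] : exists2 r : R, 4 * B < r &
    (r%:E < limn_esup (fun n => (n%:R / om n)%:E))%E.
  move: hl; case: (limn_esup _) => [l| |].
  - rewrite lte_fin => hl; exists ((4 * B + l) / 2); first by lra.
    by rewrite lte_fin; lra.
  - by move=> _; exists (4 * B + 1); [rewrite ltrDl|rewrite ltry].
  - by rewrite ltNge leNye.
exists r => // N.
(* The index is kept at least 1, since nothing is known about [om 0]. *)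
have : (r%:E < ereal_sup ((fun n : nat => (n%:R / om n)%:E) @` [set n | (maxn N 1 <= n)%N]))%E.
  apply: (lt_le_trans r2); apply: ereal_inf_lbound.
  exists [set n | (maxn N 1 <= n)%N] => //.
  exact: nbhs_infty_ge.
move=> /ereal_sup_gt[_ [n /= + <-]]; rewrite geq_max lte_fin => /andP[nN n1] rn.
by exists n => //; rewrite -ltr_pdivlMr ?om0.
Qed.

(** [power] has type 2 B. In the variable 2 pi omega the lattice has spacing 2 pi / (4 B), and the
    product of the two is exactly pi; density r > 4 B in omega becomes r / (2 pi), and pi times this
    is r / 2 > 2 B. *)
Lemma sampling (B : R) (om : nat -> R) u v : 0 < B ->
  lattice_frequencies B om \/ dense_frequencies B om ->
  L1 u -> supported B u -> L1 v -> supported B v ->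
  (forall n, (1 <= n)%N -> nm (fourier u (- (2 * pi * om n))%:C) =
                           nm (fourier v (- (2 * pi * om n))%:C)) ->
  forall z, power u z = power v z.
Proof.
move=> B0 freq Lu su Lv sv uv z; apply/eqP; rewrite -subr_eq0; apply/eqP; move: z.
have B0' := ltW B0.
have pi0 := pi_gt0 R; have pin0 : pi != 0 :> R by rewrite gt_eqF.
pose F z := power u z - power v z; rewrite -/(forall z, F z = 0).
have eF : entire F.
  by move=> z m; apply: smoothB; apply: (entire_power B0').
pose I (w : R -> R[i]) := (2 * \int[mu]_s nm (w s)) ^+ 2.
have FC z : nm (F z) <= (I u + I v) * expR (2 * B * `|Im z|).
  by rewrite (le_trans (nmB _ _))// mulrDl lerD// power_bound.
have F0 n : (1 <= n)%N -> F (2 * pi * om n)%:C = 0.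
  by move=> n1; rewrite /F (power_real _ Lu su) (power_real _ Lv sv) uv// subrr.
case: freq => [lat|dns].
  apply: (@lattice_zero _ F (I u + I v) (2 * B) (2 * pi / (4 * B)) 0) => //.
  - by rewrite divr_gt0// mulr_gt0.
  - by rewrite mulr_ge0.
  - by rewrite le_eqVlt; apply/orP; left; apply/eqP; field; rewrite gt_eqF.
  - move=> k; have : range (fun k : int => k%:~R / (4 * B)) (k%:~R / (4 * B)) by exists k.
    rewrite -lat => -[n n1 nk]; rewrite add0r.
    by rewrite (_ : k%:~R * (2 * pi / (4 * B)) = 2 * pi * om n) ?F0// nk; ring.
  - move=> e e0; have e20 : 0 < e / 2 by rewrite divr_gt0.
    near=> n; rewrite (le_trans (nmB _ _))// [e]splitr mulrDl lerD//.
      by near: n; exact: power_decay.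
    by near: n; exact: power_decay.
have fld (p x : R) : p != 0 -> p * (x / (2 * p)) = x / 2 by move=> p0; field.
have [r r1 r2] := dense_frequencies_density B0 dns; have [om0 omS _] := dns.
apply: (@dense_zeros _ F (I u + I v) (2 * B) (r / (2 * pi)) (fun n => 2 * pi * om n)) => //.
- by rewrite mulr_ge0.
- rewrite (_ : pi * (r / (2 * pi)) = r / 2); last by rewrite fld.
  by move: r1; clear; lra.
- by move=> n n1; rewrite !mulr_gt0 ?om0.
- by move=> m n m1 mn; rewrite ltr_pM2l ?omS ?mulr_gt0.
- move=> N; have [n n1 n2] := r2 N; exists n => //.
  by rewrite mulrA divfK// mulf_neq0.
Unshelve. all: by end_near. Qed.

End Sampling.

(** * Recovery of one windowed piece *)

Section Phase.
Variable R : realType.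
Implicit Types (f g u v : R -> R[i]) (z : R[i]).

Lemma entire_neq0_near (F : R[i] -> R[i]) a : entire F -> F a != 0 ->
  exists2 d : R, 0 < d & forall w, nm (w - a) < d -> F w != 0.
Proof.
move=> eF Fa; have /nm_nbhs_continuous cF := smooth_continuous (eF a 0%N).
have Fa0 : 0 < nm (F a) by rewrite nm_gt0.
have /cnbhsP[d d0 dF] := cF _ Fa0; exists d => // w /dF.
by apply: contraTneq => ->; rewrite sub0r nmN ltxx.
Qed.

Lemma entire_mul_eq0 (F G : R[i] -> R[i]) : entire F -> entire G ->
  (forall z, F z * G z = 0) -> (forall z, F z = 0) \/ (forall z, G z = 0).
Proof.
move=> eF eG FG; have [|/existsNP[a /eqP Fa]] := pselect (forall z, F z = 0); first by left.
right; have [d d0 dF] := entire_neq0_near eF Fa.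
apply: (@identity_theorem _ G a eG) => e e0; pose t := Num.min d e / 2.
have m0 : 0 < Num.min d e by rewrite lt_min d0.
have t0 : 0 < t by rewrite divr_gt0.
have tm : t < Num.min d e by rewrite /t; move: m0; clear; lra.
move: (tm); rewrite lt_min => /andP[td te].
have nt : nm (a + t%:C - a) = t by rewrite addrAC subrr add0r nm_real gtr0_norm.
exists (a + t%:C); split.
- by rewrite -subr_eq0 -nm_gt0 nt.
- by rewrite nt.
- apply/eqP; have /eqP := FG (a + t%:C); rewrite mulf_eq0 => /orP[|//].
  by move=> F0; have := dF (a + t%:C); rewrite nt F0 => /(_ td).
Qed.

(** Zeros of a nonzero entire function are isolated, hence countably many on the line. *)
Lemma entire_ae_neq0 (F : R[i] -> R[i]) : entire F -> ~ (forall z, F z = 0) ->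
  {ae mu, forall x : R, F x%:C != 0}.
Proof.
move=> eF nF; pose Z := [set x : R | F x%:C = 0].
suff ZZ : Z `<=` isolated Z.
  apply: (@negligibleS _ _ _ mu Z); first by move=> x /= /negP; rewrite negbK => /eqP.
  have cZ : countable Z by apply: sub_countable (countable_isolated Z); exact: subset_card_le.
  apply/negligibleP; last exact: countable_lebesgue_measure0.
  by apply: countable_measurable => // t; exact: measurable_set1.
move=> x Zx; split; first by rewrite inE.
apply: contrapT => nV; apply: nF; apply: (@identity_theorem _ F x%:C eF) => e e0.
apply: contrapT => h; apply: nV; exists (ball x e); first exact: nbhsx_ballx.
apply/seteqP; split => y /=; last by move=> ->; split => //; exact: ballxx.
move=> [xy Zy]; apply: contrapT => yx; apply: h; exists y%:C.
rewrite -(rmorphB (real_complex R)) nm_real distrC; split=> //.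
by apply/eqP => -[].
Qed.

Lemma ae_nonempty (P : R -> Prop) : {ae mu, forall x, P x} -> exists x, P x.
Proof.
move=> aeP; apply: contrapT => nP.
have : {ae mu, forall x : R, False} by apply: ae_imp aeP => x Px; apply: nP; exists x.
move=> [A [mA A0 AT]]; have : (mu `[0%R, 1%R]%classic <= mu A)%E.
  by apply: le_measure; rewrite ?inE// => x _; exact: AT.
by rewrite A0 lebesgue_measure_itv/= lte_fin ltr01 oppr0 adde0 lee_fin ler10.
Qed.

Lemma int_shift_ind (P : int -> Prop) : P 0 -> (forall k, P k <-> P (k + 1)) ->
  forall k, P k.
Proof.
move=> P0 PS; elim/int_rect => // n IH; first by rewrite -addn1 PoszD; exact: (PS _).1 IH.
by apply: (PS _).2; rewrite -addn1 PoszD opprD subrK.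
Qed.

Lemma nonvanishing_lattice (F : R[i] -> R[i]) (beta : R) : entire F ->
  ~ (forall z, F z = 0) -> exists a : R, forall k : int, F (a + k%:~R * beta)%:C != 0.
Proof.
move=> eF nF; have aF := entire_ae_neq0 eF nF; apply: ae_nonempty.
have aN n : {ae mu, forall x : R, F (x + n%:R * beta)%:C != 0 /\ F (x + - (n%:R * beta))%:C != 0}.
  by apply: ae_and; apply: (ae_preserving (preserving_shift _) aF).
apply: ae_imp (ae_all aN) => x Fx k; case: (intP k) => [|n|n].
- by have [] := Fx 0%N; rewrite !mul0r.
- by have [] := Fx n.+1.
- by have [_] := Fx n.+1; rewrite mulrNz mulNr.
Qed.

(** It is applied with beta = 2 pi b, for which the condition [B * beta <= pi] is the bound b <=
    1/(2B). *)
Lemma fourier_eq0_lattice (B beta a : R) u : 0 <= B -> 0 < beta -> B * beta <= pi ->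
  L1 u -> supported B u -> (forall k : int, fourier u (- (a + k%:~R * beta)%:C) = 0) ->
  {ae mu, forall s, u s = 0}.
Proof.
move=> B0 b0 Bb Lu su uk; apply: (fourier_inj B0 Lu su) => z; rewrite -[z]opprK.
move: (- z) => {}z; move: z.
apply: (@lattice_zero _ (fun z => fourier u (- z)) (2 * \int[mu]_s nm (u s)) B beta a) => //.
- move=> z m; apply: (@smooth_comp _ _ -%R (fourier u)); first by apply: smoothN; exact: smooth_id.
  exact: (entire_fourier B0 Lu su).
- move=> z; have := fourier_bound (- z) Lu su.
  by rewrite (_ : Im (- z) = - Im z) ?normrN//; case: (z).
- move=> e e0; have N1 : (-1 : R) != 0 by rewrite oppr_eq0 oner_eq0.
  apply: filterS (fourier_decay B0 Lu su N1 e0) => n.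
  rewrite normrN normr1 mulr1 (_ : (-1 * n%:R) *i = - (n%:R *i))//.
  by apply/eqP; rewrite eq_complex /= oppr0 mulN1r !eqxx.
Qed.

(** The effect of the second window: the minus sign in the exponent comes from the conjugation of
    the window in the transform. *)
Definition modulated_difference (beta : R) u : R -> R[i] :=
  fun s => u s * (expi (- (s * beta)) - 1).

Lemma cmeasurable_expi (beta : R) : cmeasurable (fun s : R => expi (- (s * beta))).
Proof.
have := @cmeasurable_cexp R 0 ((- beta) *i).
rewrite (_ : (fun s => _) = (fun s : R => expi (- (s * beta))))//; apply/funext => s.
rewrite add0r -cexp_expi; congr cexp; apply/eqP; rewrite eq_complex /=.
by apply/andP; split; apply/eqP; ring.
Qed.

Lemma nm_expi (x : R) : nm (expi x) = 1.
Proof. by rewrite -cexp_expi nm_cexp /= expR0. Qed.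

Lemma L1_modulated (beta : R) u : L1 u -> L1 (modulated_difference beta u).
Proof.
move=> Lu; apply: (@L1_dominated _ _ (fun s => 2 * nm (u s))).
- apply: cmeasurableM; first exact: L1_measurable.
  by apply: cmeasurableD; [exact: cmeasurable_expi|exact: cmeasurable_cst].
- move=> s; rewrite nmM mulrC ler_wpM2r ?nm_ge0// (le_trans (nmB _ _))//.
  by rewrite nm_expi nm1.
- by have := integrableZl measurableT 2 (L1_nm Lu).
Qed.

Lemma supported_modulated (B beta : R) u : supported B u ->
  supported B (modulated_difference beta u).
Proof. by move=> su s /su us; rewrite /modulated_difference us mul0r. Qed.

Lemma fourier_modulated (B beta : R) u z : L1 u -> supported B u ->
  fourier (modulated_difference beta u) z = fourier u (z - beta%:C) - fourier u z.
Proof.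
move=> Lu su; rewrite -[- fourier u z]mulN1r /fourier -cintegralZl; last exact: (L1_fourier _ Lu su).
rewrite -cintegralD; [|exact: (L1_fourier _ Lu su)|exact/L1Zl/(L1_fourier _ Lu su)].
congr cintegral; apply/funext => s; rewrite /modulated_difference -cexp_expi.
rewrite (_ : s%:C * ('i * (z - beta%:C)) = (- (s * beta)) *i + s%:C * ('i * z)).
  by rewrite cexpD; ring.
by case: z => x y; complex_ring.
Qed.

Lemma power_modulated (B beta : R) u z : L1 u -> supported B u ->
  power (modulated_difference beta u) z =
  (fourier u (- (z + beta%:C)) - fourier u (- z)) *
  (fourier (fun s => (u s)^*%C) (z + beta%:C) - fourier (fun s => (u s)^*%C) z).
Proof.
move=> Lu su; rewrite /power.
rewrite (fourier_conj _ (L1_modulated _ Lu) (supported_modulated _ su)).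
rewrite !(fourier_modulated _ _ Lu su) !(fourier_conj _ Lu su) opprD.
congr (_ * _); rewrite -[RHS](rmorphB conjc); congr (conjc (fourier u _ - _)).
by case: z => x y; complex_ring.
Qed.

(** The entire function that on the real axis is U(- x - beta) times the conjugate of U(- x), for U
    the transform of u. *)
Definition cross u (beta : R) z : R[i] :=
  fourier u (- (z + beta%:C)) * fourier (fun s => (u s)^*%C) z.

Lemma power_neq0 (B : R) u (x : R) : L1 u -> supported B u ->
  fourier u (- x%:C) != 0 -> fourier (fun s => (u s)^*%C) x%:C != 0.
Proof.
move=> Lu su u0; have := power_real x Lu su; rewrite /power => e.
have : (nm (fourier u (- x)%:C) ^+ 2)%:C != 0 :> R[i].
  rewrite -nm_gt0 nm_real normr_gt0 sqrf_eq0 nm_eq0.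
  by rewrite (rmorphN (real_complex R)).
by rewrite -e mulf_eq0 negb_or => /andP[].
Qed.

(** Dividing equal cross terms by equal powers gives A(k+1) / A(k) = V(k+1) / V(k) along a lattice
    without zeros of the transform of u. So A = c V on the lattice, and [fourier_eq0_lattice]
    applies to u - c v. *)
Lemma cross_eq_phase (B beta : R) u v : 0 <= B -> 0 < beta -> B * beta <= pi ->
  L1 u -> supported B u -> L1 v -> supported B v -> ~ {ae mu, forall s, u s = 0} ->
  (forall z, power u z = power v z) -> (forall z, cross u beta z = cross v beta z) ->
  exists c : R[i], nm c = 1 /\ {ae mu, forall s, u s = c * v s}.
Proof.
move=> B0 b0 Bb Lu su Lv sv u0 uv cuv.
have nu : ~ (forall z, fourier u (- z) = 0).
  move=> h; apply: u0; apply: (fourier_inj B0 Lu su) => z.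
  by rewrite -[z]opprK.
have eu : entire (fun z => fourier u (- z)).
  move=> z m; apply: (@smooth_comp _ _ -%R (fourier u)); first by apply: smoothN; exact: smooth_id.
  exact: (entire_fourier B0 Lu su).
have [a ak] := nonvanishing_lattice beta eu nu.
pose A (k : int) := fourier u (- (a + k%:~R * beta)%:C).
pose A' (k : int) := fourier (fun s => (u s)^*%C) (a + k%:~R * beta)%:C.
pose V (k : int) := fourier v (- (a + k%:~R * beta)%:C).
pose V' (k : int) := fourier (fun s => (v s)^*%C) (a + k%:~R * beta)%:C.
have A'0 k : A' k != 0 by exact: (power_neq0 Lu su (ak k)).
have AV k : A k * A' k = V k * V' k by exact: uv.
have V0 k : V k != 0.
  have := mulf_neq0 (ak k) (A'0 k); rewrite -/(A k) AV mulf_eq0 negb_or.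
  by case/andP.
have AVS k : A (k + 1) * A' k = V (k + 1) * V' k.
  have := cuv (a + k%:~R * beta)%:C; rewrite /cross.
  rewrite -(rmorphD (real_complex R)) (_ : a + k%:~R * beta + beta = a + (k + 1)%:~R * beta)//.
  by rewrite intrD; ring.
pose c : R[i] := A 0 / V 0.
have Ac0 : A 0 = c * V 0 by rewrite /c divfK.
have cstep k : A k = c * V k -> A (k + 1) = c * V (k + 1).
  move=> e; apply: (mulIf (A'0 k)); rewrite AVS.
  have -> : V' k = c * A' k by apply: (mulfI (V0 k)); rewrite -AV e; ring.
  by ring.
have cback k : A (k + 1) = c * V (k + 1) -> A k = c * V k.
  move=> e; apply: (mulIf (A'0 k)); rewrite AV.
  have -> : V' k = c * A' k by apply: (mulfI (V0 (k + 1))); rewrite -AVS e; ring.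
  by ring.
have Ac k : A k = c * V k.
  apply: (@int_shift_ind (fun k => A k = c * V k) Ac0) => {}k.
  by split; [exact: cstep|exact: cback].
exists c; split.
  have nAV : nm (A 0) = nm (V 0).
    have := uv (a + 0 * beta)%:C; rewrite (power_real _ Lu su) (power_real _ Lv sv).
    move=> /(congr1 Re)/eqP; rewrite /= eqrXn2 ?nm_ge0// => /eqP.
    by rewrite /A /V !(rmorphN (real_complex R)).
  by rewrite /c nmM nmV nAV divff// nm_eq0.
have Lw := L1D Lu (L1Zl (- c) Lv).
have sw : supported B (fun s => u s + - c * v s).
  by move=> s sB; rewrite su// sv// mulr0 addr0.
apply: ae_imp (fourier_eq0_lattice B0 b0 Bb Lw sw (a := a) _) => [s /eqP|k].
  by rewrite mulNr subr_eq0 => /eqP.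
rewrite /fourier (_ : (fun s => _) = (fun s => u s * cexp (s%:C * ('i * - (a + k%:~R * beta)%:C)) +
   - c * (v s * cexp (s%:C * ('i * - (a + k%:~R * beta)%:C))))); last first.
  by apply/funext => s; ring.
rewrite cintegralD; [|exact: (L1_fourier _ Lu su)|exact/L1Zl/(L1_fourier _ Lv sv)].
rewrite cintegralZl; last exact: (L1_fourier _ Lv sv).
by have /eqP := Ac k; rewrite -subr_eq0 -mulNr => /eqP.
Qed.

(** On the real axis its transform is the conjugate of that of v; this is the ambiguity left by the
    moduli. *)
Definition reflected v : R -> R[i] := fun s => (v (- s))^*%C.

Lemma L1_reflected v : L1 v -> L1 (reflected v).
Proof. by move=> Lv; apply: L1_conj; exact: (L1_preserving (@preserving_opp R) Lv). Qed.

Lemma supported_reflected (B : R) v : supported B v -> supported B (reflected v).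
Proof. by move=> sv s sB; rewrite /reflected sv ?conjc0 ?normrN. Qed.

Lemma fourier_reflected (B : R) v z : L1 v -> supported B v ->
  fourier (reflected v) z = fourier (fun s => (v s)^*%C) (- z).
Proof.
move=> Lv sv; rewrite /fourier.
rewrite -(cintegral_preserving (@preserving_opp R) (L1_fourier _ (L1_conj Lv) (supported_conj sv))).
congr cintegral; apply/funext => s; rewrite /reflected; congr (_ * cexp _).
by rewrite (rmorphN (real_complex R)); ring.
Qed.

Lemma fourier_reflected_conj (B : R) v z : L1 v -> supported B v ->
  fourier (fun s => (reflected v s)^*%C) z = fourier v (- z).
Proof.
move=> Lv sv; rewrite /fourier.
rewrite -(cintegral_preserving (@preserving_opp R) (L1_fourier _ Lv sv)).
congr cintegral; apply/funext => s; rewrite /reflected conjcK; congr (_ * cexp _).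
by rewrite (rmorphN (real_complex R)); ring.
Qed.

(* With X, Y the cross terms of u, v and X', Y' those of the reflections,
   the hypotheses say that X + X' = Y + Y' and X X' = Y Y', so that
   (X - Y) (X - Y') = 0. *)
Lemma phase_retrieval (B beta : R) u v : 0 <= B -> 0 < beta -> B * beta <= pi ->
  L1 u -> supported B u -> L1 v -> supported B v -> ~ {ae mu, forall s, u s = 0} ->
  (forall z, power u z = power v z) ->
  (forall z, power (modulated_difference beta u) z = power (modulated_difference beta v) z) ->
  exists c : R[i], nm c = 1 /\ ({ae mu, forall s, u s = c * v s} \/
    {ae mu, forall s, u s = c * reflected v s}).
Proof.
move=> B0 b0 Bb Lu su Lv sv u0 uv duv.
have Lr := L1_reflected Lv; have sr := supported_reflected sv.
have powr z : power (reflected v) z = power v z.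
  rewrite /power (fourier_reflected _ Lv sv) (fourier_reflected_conj _ Lv sv).
  by rewrite opprK mulrC.
have crossr z : cross (reflected v) beta z =
    fourier v (- z) * fourier (fun s => (v s)^*%C) (z + beta%:C).
  rewrite /cross (fourier_reflected _ Lv sv) (fourier_reflected_conj _ Lv sv).
  by rewrite opprK mulrC.
have ecross w : L1 w -> supported B w -> entire (cross w beta).
  move=> Lw sw z m; apply: smoothM; last first.
    exact: (entire_fourier B0 (L1_conj Lw) (supported_conj sw)).
  apply: (@smooth_comp _ _ (fun z => - (z + beta%:C)) (fourier w)).
    by apply: smoothN; apply: smoothD; [exact: smooth_id|exact: smooth_cst].
  exact: (entire_fourier B0 Lw sw).
have H z : (cross u beta z - cross v beta z) * (cross u beta z - cross (reflected v) beta z) = 0.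
  have := duv z; rewrite (power_modulated _ _ Lu su) (power_modulated _ _ Lv sv).
  have := uv z; have := uv (z + beta%:C); rewrite crossr /power /cross.
  move: (fourier u (- (z + beta%:C))) (fourier u (- z)) => p q.
  move: (fourier v (- (z + beta%:C))) (fourier v (- z)) => r s.
  move: (fourier (fun s => (u s)^*%C) (z + beta%:C)) (fourier (fun s => (u s)^*%C) z) => p' q'.
  move: (fourier (fun s => (v s)^*%C) (z + beta%:C)) (fourier (fun s => (v s)^*%C) z) => r' s'.
  move=> e1 e2 e3.
  have e4 : p * q' + q * p' = r * s' + s * r'.
    have : p * p' + q * q' - (p - q) * (p' - q') = r * r' + s * s' - (r - s) * (r' - s').
      by rewrite e1 e2 e3.
    by move=> e; transitivity (p * p' + q * q' - (p - q) * (p' - q')); [ring|rewrite e; ring].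
  transitivity (p * q' * (p * q' - (r * s' + s * r')) + (r * r') * (s * s')); first by ring.
  by rewrite -e4 -e1 -e2; ring.
have eD w : L1 w -> supported B w -> entire (fun z => cross u beta z - cross w beta z).
  by move=> Lw sw z m; apply: smoothB; apply: ecross.
have [h|h] := entire_mul_eq0 (eD _ Lv sv) (eD _ Lr sr) H.
  have [|c [c1 cu]] := cross_eq_phase B0 b0 Bb Lu su Lv sv u0 uv.
    by move=> z; apply/eqP; rewrite -subr_eq0 h.
  by exists c; split=> //; left.
have [||c [c1 cu]] := cross_eq_phase B0 b0 Bb Lu su Lr sr u0.
- by move=> z; rewrite powr.
- by move=> z; apply/eqP; rewrite -subr_eq0 h.
- by exists c; split=> //; right.
Qed.

End Phase.

(** * From the windowed transform to Fourier transforms *)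

Section Window.
Variable R : realType.
Implicit Types (f g u v w phi : R -> R[i]) (z : R[i]).

(** Points outside the support have neighbourhoods on which [phi] vanishes almost everywhere;
    countably many balls with rational centre and radius suffice to cover these points. *)
Lemma ae_ess_support phi (B : R) : ess_support phi `<=` `[- B, B] ->
  {ae mu, forall x, B < `|x| -> phi x = 0}.
Proof.
move=> supp.
pose good (p : rat * rat) := {ae mu, forall y : R, ball (ratr p.1 : R) (ratr p.2) y -> phi y = 0}.
have H n : {ae mu, forall y, forall p, unpickle n = Some p -> good p ->
    ball (ratr p.1 : R) (ratr p.2) y -> phi y = 0}.
  case: (unpickle n) => [p|]; last by apply: ae_true.
  have [gp|gp] := pselect (good p).
    by apply: ae_imp gp => y py _ [<-].
  by apply: ae_true => y _ [<-].
apply: ae_imp (ae_all H) => x Hx Bx.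
have : ~ ess_support phi x.
  by move=> /supp; rewrite /= in_itv /= -ler_norml leNgt Bx.
move=> /existsNP[U /not_implyP[nU /contrapT aeU]].
have /nbhs_ballP[e /= e0 eU] := nU.
have [r] : exists r : rat, ratr r \in `]0, (e / 2)[ by apply: rat_in_itvoo; rewrite divr_gt0.
rewrite in_itv /= => /andP[r0 re].
have [q] : exists q : rat, ratr q \in `](x - ratr r), (x + ratr r)[.
  by apply: rat_in_itvoo; move: r0; clear; lra.
rewrite in_itv /= => /andP[q1 q2].
apply: (Hx (pickle (q, r)) (q, r)); first by rewrite pickleK.
  apply: ae_imp aeU => y phiy yqr; apply/phiy/eU.
  move: yqr; rewrite /ball /= !ltr_norml; move: re q1 q2 r0; clear => ? ? ? ? /andP[? ?].
  by apply/andP; split; lra.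
by rewrite /ball /= ltr_norml; apply/andP; split; move: q1 q2; clear; lra.
Qed.

Lemma ae_integrable (h k : R -> R) : measurable_fun setT h ->
  mu.-integrable setT (EFin \o k) -> {ae mu, forall x, h x = k x} ->
  mu.-integrable setT (EFin \o h).
Proof.
move=> mh ik hk; have mk := measurable_int _ ik.
have mh' : measurable_fun setT (EFin \o h) by apply/measurable_EFinP.
apply/integrableP; split=> //; have /integrableP[_] := ik; apply: le_lt_trans.
apply: ae_ge0_le_integral => //.
- exact: measurableT_comp.
- exact: measurableT_comp.
- by apply: ae_imp hk => x /= -> _.
Qed.

Lemma ae_L1 f g : cmeasurable f -> L1 g -> {ae mu, forall x, f x = g x} -> L1 f.
Proof.
move=> [f1 f2] [g1 g2] fg; split.
  by apply: ae_integrable g1 _ => //; apply: ae_imp fg => x -> .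
by apply: ae_integrable g2 _ => //; apply: ae_imp fg => x -> .
Qed.

Lemma cmeasurable_L1loc f : L1loc f -> cmeasurable f.
Proof.
move=> Lf; split; rewrite -(bigcup_itvT true false); apply/measurable_fun_bigcup => // n.
  by have [/measurable_int m _] := Lf (- n%:R) n%:R; exact/measurable_EFinP.
by have [_ /measurable_int m] := Lf (- n%:R) n%:R; exact/measurable_EFinP.
Qed.

Lemma L1loc_cut f (a b : R) : L1loc f -> L1 (cut `[a, b] f).
Proof.
move=> Lf; have [f1 f2] := Lf a b; split.
  rewrite (_ : _ \o _ = (EFin \o (fun x => Re (f x))) \_ `[a, b]).
    by apply/integrable_restrict => //; rewrite setTI.
  by apply/funext => x; rewrite patchE /cut /=; case: ifP.
rewrite (_ : _ \o _ = (EFin \o (fun x => Im (f x))) \_ `[a, b]).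
  by apply/integrable_restrict => //; rewrite setTI.
by apply/funext => x; rewrite patchE /cut /=; case: ifP.
Qed.

Lemma ae_L1_convolution f phi : L1 f -> L1 phi ->
  {ae mu, forall t, L1 (fun s => f (s + t) * (phi s)^*%C)}.
Proof.
move=> Lf Lphi.
have mf := measurable_nm (L1_measurable Lf); have mphi := measurable_nm (L1_measurable Lphi).
pose h (p : R * R) : \bar R := (nm (f (p.2 + p.1)) * nm (phi p.2))%:E.
have mh : measurable_fun setT h.
  apply/measurable_EFinP; apply: measurable_funM.
    by apply: (measurableT_comp mf); apply: measurable_funD.
  by apply: (measurableT_comp mphi).
have : (mu \x mu)%E.-integrable setT h.
  apply/integrable21ltyP => //.
  have E s : (\int[mu]_t `|h (t, s)| = (nm (phi s) * \int[mu]_t nm (f t))%:E)%E.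
    transitivity (\int[mu]_t (nm (phi s) * nm (f (t + s)))%:E)%E.
      apply: eq_integral => t _; rewrite /h /= ger0_norm ?mulr_ge0 ?nm_ge0//.
      by rewrite mulrC addrC.
    have [i1 i2] := integrable_preserving (preserving_shift s) (L1_nm Lf).
    rewrite -i2 -RintegralZl// /Rintegral fineK//.
    apply: integrable_fin_num => //.
    by have := integrableZl measurableT (nm (phi s)) i1.
  under eq_integral do rewrite E.
  rewrite ltey_eq; apply/orP; left; apply: integrable_fin_num => //.
  have := integrableZl measurableT (\int[mu]_t nm (f t)) (L1_nm Lphi).
  by under eq_fun do rewrite -EFinM mulrC.
move=> /ae_integrable1; apply: ae_imp => t /= it.
apply: (L1_dominated _ _ it); last by move=> s; rewrite nmM nm_conj.
apply: cmeasurableM; last exact/cmeasurable_conj/L1_measurable.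
exact: cmeasurable_preserving (preserving_shift t) (L1_measurable Lf).
Qed.

(** The piece is centred at 0, s = x - t. The cut makes the support condition hold at every point,
    while [phi] vanishes outside only almost everywhere. *)
Definition windowed (B : R) w f (t : R) : R -> R[i] :=
  cut `[- B, B] (fun s => f (s + t) * (w s)^*%C).

Lemma supported_windowed (B : R) w f t : supported B (windowed B w f t).
Proof.
move=> s sB; rewrite /windowed /cut memNset//= in_itv /= -ler_norml.
by apply/negP; rewrite -ltNge.
Qed.

(** For a given t the window meets only a bounded part of [f], so the integrable functions [f] cut
    to [-n, n] can be used, for all n at once. *)
Lemma ae_L1_windowed (B : R) w f : 0 <= B -> L1loc f -> L1 w ->
  {ae mu, forall t, L1 (windowed B w f t)}.
Proof.
move=> B0 Lf Lw.
have H (n : nat) := ae_L1_convolution (L1loc_cut (- n%:R) n%:R Lf) Lw.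
apply: ae_imp (ae_all H) => t Ht.
have [n tn] : exists n : nat, `|t| + B <= n%:R.
  by exists (Num.truncn (`|t| + B)).+1; rewrite ltW// truncnS_gt.
rewrite (_ : windowed B w f t = cut `[- B, B] (fun s => cut `[- n%:R, n%:R] f (s + t) * (w s)^*%C)).
  by apply: L1_cut => //; exact: Ht.
apply/funext => s; rewrite /windowed {1 2}/cut; case: ifPn => // /[!inE] /=.
rewrite in_itv /= -ler_norml => sB; congr (_ * _).
rewrite /cut mem_set//= in_itv /= -ler_norml (le_trans (ler_normD _ _))//.
by rewrite addrC (le_trans _ tn)// lerD2l.
Qed.

(** The substitution x = s + t splits off the factor exp(- 2 pi i t omega) of modulus 1. *)
Lemma stft_fourier (B : R) w f t (om : R) : cmeasurable w -> cmeasurable f ->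
  {ae mu, forall x, B < `|x| -> w x = 0} -> L1 (windowed B w f t) ->
  nm (stft w f t om) = nm (fourier (windowed B w f t) (- (2 * pi * om))%:C).
Proof.
move=> mw mf w0 Lu.
pose k x := f x * (w (x - t))^*%C * expi (- (2 * pi * x * om)).
pose K s := expi (- (2 * pi * t * om)) *
  (windowed B w f t s * cexp (s%:C * ('i * (- (2 * pi * om))%:C))).
have sh c : preserving (fun x : R => x + c) := preserving_shift c.
have mk : cmeasurable k.
  apply: cmeasurableM.
    by apply: cmeasurableM => //; apply: cmeasurable_conj; exact: (cmeasurable_preserving (sh (- t)) mw).
  rewrite (_ : (fun x : R => _) = fun x => expi (- (x * (2 * pi * om)))).
    exact: cmeasurable_expi.
  by apply/funext => x; congr expi; ring.
have LK : L1 K.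
  by apply: L1Zl; apply: L1_fourier Lu _; exact: supported_windowed.
have kK : {ae mu, forall s, k (s + t) = K s}.
  apply: ae_imp w0 => s ws; rewrite /k /K addrK.
  rewrite (_ : 2 * pi * (s + t) * om = s * (2 * pi * om) + 2 * pi * t * om); last by ring.
  rewrite opprD -[expi (_ + _)]cexp_expi.
  rewrite (_ : (_ + _) *i = (- (s * (2 * pi * om))) *i + (- (2 * pi * t * om)) *i); last first.
    by apply/eqP; rewrite eq_complex /= addr0 !eqxx.
  rewrite cexpD [cexp (- (2 * pi * t * om)) *i]cexp_expi.
  rewrite (_ : s%:C * _ = (- (s * (2 * pi * om))) *i); last first.
    by complex_ring.
  rewrite /windowed /cut; case: ifPn => [_|/negP]; first by ring.
  rewrite inE /= in_itv /= -ler_norml => /negP; rewrite -ltNge => /ws ->.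
  by rewrite conjc0 !(mulr0, mul0r).
have mkt : cmeasurable (fun s => k (s + t)) := cmeasurable_preserving (sh t) mk.
have Lk : L1 k.
  have := L1_preserving (sh (- t)) (ae_L1 mkt LK kK).
  by under eq_fun do rewrite subrK.
rewrite -[stft _ _ _ _]/(cintegral setT k) -(cintegral_preserving (sh t) Lk).
rewrite (cintegral_ae mkt (L1_measurable LK) kK) cintegralZl.
  by rewrite nmM nm_expi mul1r.
by apply: L1_fourier Lu _; exact: supported_windowed.
Qed.

Lemma windowed_second (B b : R) phi f t :
  windowed B (second_window phi b) f t =
  modulated_difference (2 * pi * b) (windowed B phi f t).
Proof.
apply/funext => s; rewrite /modulated_difference /windowed /cut.
case: ifP => _; last by rewrite mul0r.
rewrite /second_window conjM mulrA; congr (_ * _); rewrite /expi.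
apply/eqP; rewrite eq_complex /= cosN sinN (_ : s * (2 * pi * b) = 2 * pi * s * b); last by ring.
by apply/andP; split; apply/eqP; ring.
Qed.

End Window.

(** * Patching the pieces *)

Section Gluing.
Variable R : realType.
Local Notation mu := (@lebesgue_measure R).
Implicit Types (f g u v w phi : R -> R[i]) (z : R[i]).

(** Reflection in t is x -> s - x for s = 2 t; this lemma passes from almost every t to almost every
    s. *)
Lemma ae_half (P : R -> Prop) : {ae mu, forall t, P t} -> {ae mu, forall s, P (s / 2)}.
Proof.
have mT : measurable_fun [set: R] (fun s : R => s / 2).
  by apply: measurable_funM => //; exact: measurable_cst.
move=> [A [mA A0 PA]]; exists ((fun s : R => s / 2) @^-1` A); split.
- by rewrite -[X in measurable X]setTI; exact: mT.
- have half0 : (0 : R) <= 1 / 2 by rewrite divr_ge0.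
  have h : mscale (NngNum half0)
      (pushforward mu ((fun s : R => s / 2) : R -> measurableTypeR R)) A = mu A.
    move=> m; apply/esym/lebesgue_measure_unique => //= _ [[a b]] _ <-.
    rewrite /mscale /= /pushforward (_ : _ @^-1` _ = `]2 * a, 2 * b]%classic); last first.
      by apply/funext => x; rewrite /= !in_itv /= ltr_pdivlMr// ler_pdivrMr// !(mulrC 2).
    rewrite !lebesgue_measure_itv/= !lte_fin ltr_pM2l//; case: ifP => _; last by rewrite mule0.
    by rewrite -EFinB -EFinM; congr EFin; field.
  move: (h mT); rewrite A0 /mscale /= /pushforward => /eqP.
  by rewrite mule_eq0 eqe gt_eqF//= => /eqP.
- by move=> s /= nP; exact: PA.
Qed.

Lemma ae_exists_itv (P : R -> Prop) (c d : R) : {ae mu, forall x, P x} -> c < d ->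
  exists x, [/\ c < x, x < d & P x].
Proof.
move=> [A [mA A0 PA]] cd; apply: contrapT => nP.
have : (mu `]c, d[%classic <= mu A)%E.
  apply: le_measure; rewrite ?inE// => x; rewrite /= in_itv /= => /andP[xc xd].
  by apply: PA => Px; apply: nP; exists x.
by rewrite A0 lebesgue_measure_itv/= lte_fin cd lee_fin subr_le0 leNgt cd.
Qed.

Lemma ae_swap (d : measurableTypeR R * measurableTypeR R -> R) : measurable_fun setT d ->
  {ae mu, forall t, {ae mu, forall x, d (t, x) = 0}} ->
  {ae mu, forall x, {ae mu, forall t, d (t, x) = 0}}.
Proof.
move=> md dtx; pose e (p : measurableTypeR R * measurableTypeR R) : \bar R := (`|d p|)%:E.
have me : measurable_fun setT e by apply/measurable_EFinP; exact: measurableT_comp.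
have e0 p : (0 <= e p)%E by rewrite lee_fin.
have mF : measurable_fun setT (fubini_F mu e) by exact: measurable_fun_fubini_tonelli_F.
have mG : measurable_fun setT (fubini_G mu e) by exact: measurable_fun_fubini_tonelli_G.
have F0 : (\int[mu]_t \int[mu]_x e (t, x) = 0)%E.
  transitivity (\int[mu]_t cst 0%E t)%E; last by rewrite integral0.
  apply: ae_eq_integral => //.
  apply: ae_imp dtx => t dt _; transitivity (\int[mu]_x cst 0%E x)%E; last by rewrite integral0.
  apply: ae_eq_integral => //; first exact: measurable_fun_pair2 me.
  by apply: ae_imp dt => x dx _; rewrite /e dx normr0.
have G0 : (\int[mu]_x \int[mu]_t e (t, x) = 0)%E by rewrite -fubini_tonelli.
have : ae_eq mu setT (fubini_G mu e) (cst 0%E).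
  apply/ae_eq_integral_abs => //; rewrite -[RHS]G0; apply: eq_integral => x _.
  by rewrite gee0_abs//; exact: integral_ge0.
apply: ae_imp => x /(_ I) ex.
have : ae_eq mu setT (fun t => e (t, x)) (cst 0%E).
  apply/ae_eq_integral_abs => //; first exact: measurable_fun_pair1 me.
  by rewrite -[RHS]ex; apply: eq_integral => t _; rewrite gee0_abs.
by apply: ae_imp => t /(_ I)[/eqP]; rewrite normr_eq0 => /eqP.
Qed.

(** Two reflections compose to a translation: if y = s - x = s' - x', then H2 x = H1 y = H2 x'. So
    H2 agrees at good points that are close together, and a chain of such points joins any two in
    the window. *)
Lemma reflection_constant (H1 H2 : R -> R) (B a b s0 : R) :
  measurable_fun [set: R] H1 -> measurable_fun [set: R] H2 ->
  0 < B -> a < s0 -> s0 < b ->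
  {ae mu, forall s, a < s < b ->
     {ae mu, forall x, `|2 * x - s| < 2 * B -> H2 x = H1 (s - x)}} ->
  exists k, {ae mu, forall x, `|2 * x - s0| < 2 * B -> H2 x = k}.
Proof.
move=> mH1 mH2 B0 as0 s0b aeH.
(* Twice the positive part. Products of [c] serve as measurable weights that vanish off the region
   where the hypothesis applies, so that the whole condition becomes [d = 0] and [ae_swap] can
   exchange the two quantifiers. *)
pose c (y : R) : R := y + `|y|.
have c_gt0 y : 0 < y -> c y != 0 by move=> y0; rewrite /c gt_eqF// ltr_wpDr.
have c_le0 y : ~ 0 < y -> c y = 0.
  by move=> /negP; rewrite -leNgt => y0; rewrite /c ler0_norm// subrr.
pose d (p : measurableTypeR R * measurableTypeR R) : R :=
  c (p.1 - a) * c (b - p.1) * c (2 * B - `|2 * p.2 - p.1|) * (H2 p.2 - H1 (p.1 - p.2)).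
have md : measurable_fun setT d.
  have mc (h : measurableTypeR R * measurableTypeR R -> R) :
      measurable_fun setT h -> measurable_fun setT (fun p => c (h p)).
    by move=> mh; apply: measurable_funD => //; exact: measurableT_comp.
  have m1 : measurable_fun setT (fun p : measurableTypeR R * measurableTypeR R => p.1 : R).
    exact: measurable_fst.
  have m2 : measurable_fun setT (fun p : measurableTypeR R * measurableTypeR R => p.2 : R).
    exact: measurable_snd.
  apply: measurable_funM; last first.
    apply: measurable_funB; first exact: (measurableT_comp mH2 m2).
    by apply: (measurableT_comp mH1); exact: measurable_funB.
  apply: measurable_funM; last first.
    apply: mc; apply: measurable_funB; first exact: measurable_cst.
    apply: measurableT_comp => //; apply: measurable_funB => //.
    by apply: measurable_funM => //; exact: measurable_cst.
  apply: measurable_funM; apply: mc; apply: measurable_funB => //; exact: measurable_cst.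
have swap := ae_swap md _.
have {swap}good : {ae mu, forall x, {ae mu, forall s, a < s -> s < b ->
    `|2 * x - s| < 2 * B -> H2 x = H1 (s - x)}}.
  apply: ae_imp (swap _) => [x dx|].
    apply: ae_imp dx => s /eqP; rewrite /d /= !mulf_eq0 => + as_ sb xs.
    rewrite !(negbTE (c_gt0 _ _)) ?subr_gt0//=.
    by rewrite subr_eq0 => /eqP.
  apply: ae_imp aeH => s hs; have [asb|asb] := boolP (a < s < b).
    apply: ae_imp (hs asb) => x hx; rewrite /d /=.
    have [h|h] := ltP `|2 * x - s| (2 * B); first by rewrite hx// subrr mulr0.
    by rewrite [c (2 * B - _)]c_le0 ?mulr0 ?mul0r// subr_gt0 ltNge h.
  apply: ae_true => x; rewrite /d /=; move: asb; rewrite negb_and => /orP[asb|asb].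
    by rewrite [c (s - a)]c_le0 ?mul0r// subr_gt0; exact/negP.
  by rewrite [c (b - s)]c_le0 ?mul0r ?mulr0 ?mul0r// subr_gt0; exact/negP.
pose G x := {ae mu, forall s, a < s -> s < b -> `|2 * x - s| < 2 * B -> H2 x = H1 (s - x)}.
(* Here s = x + y; the two inner minima keep s in ]a, b[, and the margin [eta] keeps |2 x - s| below
   2 B. *)
have near_eq (eta x : R) : 0 < eta -> G x -> `|2 * x - s0| < 2 * B - eta ->
    {ae mu, forall y, `|y + x - s0| < Num.min eta (Num.min (s0 - a) (b - s0)) -> H2 x = H1 y}.
  move=> eta0 Gx xs; apply: ae_imp (ae_preserving (preserving_shift x) Gx) => y.
  rewrite addrK !lt_min => hy /andP[y1 /andP[y2 y3]]; apply: hy.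
  - by move: y2; rewrite ltr_norml => /andP[+ _]; clear; lra.
  - by move: y3; rewrite ltr_norml => /andP[_]; clear; lra.
  - have := ler_normB (2 * x - s0) (y + x - s0).
    rewrite (_ : _ - (y + x - s0) = 2 * x - (y + x)); last by ring.
    by move: xs y1; clear; lra.
have step (eta x x' : R) : 0 < eta -> G x -> `|2 * x - s0| < 2 * B - eta ->
    G x' -> `|2 * x' - s0| < 2 * B - eta -> x <= x' ->
    x' < x + 2 * Num.min eta (Num.min (s0 - a) (b - s0)) -> H2 x = H2 x'.
  move=> eta0 Gx xs Gx' xs' xx'.
  have := near_eq _ _ eta0 Gx xs; have := near_eq _ _ eta0 Gx' xs'.
  set rho := Num.min _ _ => h' h xrho.
  have [|y [y1 y2 [e e']]] := ae_exists_itv (c := s0 - x - rho) (d := s0 - x' + rho) (ae_and h h').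
    by move: xrho; clear; lra.
  rewrite e ?e'// ltr_norml; apply/andP; split; move: y1 y2 xx'; clear; lra.
have chain (eta : R) : 0 < eta -> forall n (x x' : R), G x -> `|2 * x - s0| < 2 * B - eta ->
    G x' -> `|2 * x' - s0| < 2 * B - eta -> x <= x' ->
    x' < x + n%:R * Num.min eta (Num.min (s0 - a) (b - s0)) -> H2 x = H2 x'.
  move=> eta0; have rho0 : 0 < Num.min eta (Num.min (s0 - a) (b - s0)).
    by rewrite !lt_min eta0 !subr_gt0 as0.
  elim=> [|n IH] x x' Gx xs Gx' xs' xx'.
    by rewrite mul0r addr0 ltNge xx'.
  have stepx := step eta x x' eta0 Gx xs Gx' xs' xx'.
  move: IH stepx rho0; set rho := Num.min _ _ => IH stepx rho0 hn.
  have [|far] := ltP x' (x + 2 * rho); first exact: stepx.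
  (* A good point between rho and 2 rho before x': near enough for one step, and far enough to use
     up one unit of n. *)
  have [|y [y1 y2 Gy]] := ae_exists_itv (c := x' - 2 * rho) (d := x' - rho) good.
    by move: rho0; clear; lra.
  have ys : `|2 * y - s0| < 2 * B - eta.
    rewrite ltr_norml; apply/andP; split.
      by move: xs; rewrite ltr_norml => /andP[+ _]; move: far y1; clear; lra.
    by move: xs'; rewrite ltr_norml => /andP[_]; move: rho0 y2; clear; lra.
  rewrite (IH x y)//.
  - apply: (step eta) => //; first by move: y2 rho0; clear; lra.
    by rewrite -/rho; move: y1; clear; lra.
  - by move: far y1; clear; lra.
  - by move: hn y2; rewrite -natr1 mulrDl mul1r; clear; lra.
have all_eq (x x' : R) : G x -> `|2 * x - s0| < 2 * B -> G x' -> `|2 * x' - s0| < 2 * B ->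
    H2 x = H2 x'.
  wlog xx' : x x' / x <= x'.
    by move=> H Gx xs Gx' xs'; have [|/ltW] := leP x x' => ?; [|symmetry]; exact: H.
  move=> Gx xs Gx' xs'.
  pose eta : R := Num.min (2 * B - `|2 * x - s0|) (2 * B - `|2 * x' - s0|) / 2.
  have m0 : 0 < Num.min (2 * B - `|2 * x - s0|) (2 * B - `|2 * x' - s0|).
    by rewrite lt_min !subr_gt0 xs.
  have eta0 : 0 < eta by rewrite divr_gt0.
  have : eta < Num.min (2 * B - `|2 * x - s0|) (2 * B - `|2 * x' - s0|).
    by rewrite /eta; move: m0; clear; lra.
  rewrite lt_min => /andP[e1 e2].
  have rho0 : 0 < Num.min eta (Num.min (s0 - a) (b - s0)).
    by rewrite !lt_min eta0 !subr_gt0 as0.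
  apply: (chain eta eta0 (Num.truncn ((x' - x) / Num.min eta (Num.min (s0 - a) (b - s0)))).+1) => //.
  - by move: e1; clear; lra.
  - by move: e2; clear; lra.
  - by rewrite -ltrBlDl -ltr_pdivrMr// truncnS_gt.
have [|x0 [x1 x2 Gx0]] := ae_exists_itv (c := (s0 - 2 * B) / 2) (d := (s0 + 2 * B) / 2) good.
  by move: B0; clear; lra.
exists (H2 x0); apply: ae_imp good => x Gx xs; apply: all_eq => //.
by rewrite ltr_norml; apply/andP; split; move: x1 x2; clear; lra.
Qed.
End Gluing.

Section Patching.
Variable R : realType.
Implicit Types (f g : R -> R[i]) (c : R[i]).

Definition agree f g c (a b : R) : Prop :=
  {ae mu, forall x, a <= x <= b -> f x = c * g x}.

Definition agree_reflected f g c (t B : R) : Prop :=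
  {ae mu, forall x, t - B <= x <= t + B -> f x = c * (g (2 * t - x))^*%C}.

(* If the reflected alternative holds for almost every centre near t, then
   |f| and f (conj g) are constant around t, and so is f / g. *)
Lemma agree_somewhere f g (B a b : R) : cmeasurable f -> cmeasurable g ->
  0 < B -> a < b -> nonseparable_signal (2 * B) f ->
  {ae mu, forall t, exists c, nm c = 1 /\
     (agree f g c (t - B) (t + B) \/ agree_reflected f g c t B)} ->
  exists t, [/\ a < t, t < b & exists c, nm c = 1 /\ agree f g c (t - B) (t + B)].
Proof.
move=> mf mg B0 ab nsep aeP; apply: contrapT => none.
have refl : {ae mu, forall s, a < s / 2 < b -> exists c, nm c = 1 /\ agree_reflected f g c (s / 2) B}.
  apply: ae_imp (ae_half aeP) => s [c [c1 [h|h]]] /andP[as_ sb]; last by exists c.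
  by exfalso; apply: none; exists (s / 2); split=> //; exists c.
have win (s x : R) : `|2 * x - s| < 2 * B -> s / 2 - B <= x <= s / 2 + B.
  by rewrite ltr_norml => /andP[h1 h2]; apply/andP; split; move: h1 h2; clear; lra.
have dbl (s x : R) : 2 * (s / 2) - x = s - x by field.
have [|s0 [s0a s0b Ps0]] := ae_exists_itv (c := 2 * a) (d := 2 * b) refl.
  by rewrite ltr_pM2l.
have [|c0 [c01 aeF]] := Ps0; first by apply/andP; split; move: s0a s0b; clear; lra.
pose h x := f x * (g x)^*%C.
have mh : cmeasurable h by apply: cmeasurableM => //; exact: cmeasurable_conj.
have const (H1 H2 : R -> R) : measurable_fun [set: R] H1 -> measurable_fun [set: R] H2 ->
    (forall s x c, nm c = 1 -> f x = c * (g (s - x))^*%C ->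
       f (s - x) = c * (g x)^*%C -> H2 x = H1 (s - x)) ->
    exists k, {ae mu, forall x, `|2 * x - s0| < 2 * B -> H2 x = k}.
  move=> mH1 mH2 H; apply: (reflection_constant mH1 mH2 B0 s0a s0b).
  apply: ae_imp refl => s hs /andP[s1 s2].
  have [|c [c1 aes]] := hs; first by apply/andP; split; move: s1 s2; clear; lra.
  apply: ae_imp (ae_and aes (ae_preserving (preserving_reflection s) aes)) => x [e1 e2] xs.
  apply: (H s x c) => //; first by rewrite e1 ?dbl// win.
  rewrite e2 ?dbl ?subKr// win//.
  by rewrite (_ : 2 * (s - x) - s = - (2 * x - s)) ?normrN//; ring.
have [r aer] : exists k, {ae mu, forall x, `|2 * x - s0| < 2 * B -> nm (f x) = k}.
  apply: (const (fun x => nm (g x))); [exact: measurable_nm|exact: measurable_nm|].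
  by move=> s x c c1 -> _; rewrite nmM c1 mul1r nm_conj.
have hsym s x c : f x = c * (g (s - x))^*%C -> f (s - x) = c * (g x)^*%C -> h x = h (s - x).
  by rewrite /h => -> ->; ring.
have [k1 aek1] : exists k, {ae mu, forall x, `|2 * x - s0| < 2 * B -> Re (h x) = k}.
  apply: (const (fun x => Re (h x))); [exact: mh.1|exact: mh.1|].
  by move=> s x c _ e1 e2; rewrite (hsym s x c).
have [k2 aek2] : exists k, {ae mu, forall x, `|2 * x - s0| < 2 * B -> Im (h x) = k}.
  apply: (const (fun x => Im (h x))); [exact: mh.2|exact: mh.2|].
  by move=> s x c _ e1 e2; rewrite (hsym s x c).
(* The reflection in s0 / 2 maps the window to itself and carries |g| to |f|. *)
have aeg : {ae mu, forall x, `|2 * x - s0| < 2 * B -> nm (g x) = r}.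
  apply: ae_imp (ae_and (ae_preserving (preserving_reflection s0) aer)
    (ae_preserving (preserving_reflection s0) aeF)) => x [e1 e2] xs.
  have xs' : `|2 * (s0 - x) - s0| < 2 * B.
    by rewrite (_ : 2 * (s0 - x) - s0 = - (2 * x - s0)) ?normrN//; ring.
  by rewrite -(e1 xs') e2 ?dbl ?subKr ?win// nmM c01 mul1r nm_conj.
have aeh : {ae mu, forall x, `|2 * x - s0| < 2 * B -> h x = k1 +i* k2}.
  apply: ae_imp (ae_and aek1 aek2) => x [e1 e2] xs.
  by rewrite -(e1 xs) -(e2 xs); case: (h x).
have openw (P : R -> Prop) : {ae mu, forall x, `|2 * x - s0| < 2 * B -> P x} ->
    {ae mu, forall x, s0 / 2 - B <= x <= s0 / 2 + B -> P x}.
  move=> aP; apply: ae_imp (ae_and aP (ae_and (ae_neq (s0 / 2 - B)) (ae_neq (s0 / 2 + B)))).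
  move=> x [Px [x1 x2]] /andP[x3 x4]; apply: Px; rewrite ltr_norml.
  have : s0 / 2 - B < x by rewrite lt_neqAle eq_sym x1.
  have : x < s0 / 2 + B by rewrite lt_neqAle x2.
  by move=> y1 y2; apply/andP; split; move: y1 y2; clear; lra.
have r0 : r != 0.
  apply/eqP => r0; apply: nsep; exists (s0 / 2 - B).
  rewrite (_ : s0 / 2 - B + 2 * B = s0 / 2 + B); last by ring.
  apply: ae_imp (openw (fun x => f x = 0) _) => [x fx|]; first by rewrite in_itv.
  by apply: ae_imp aer => x fx /fx; rewrite r0 => /eqP; rewrite nm_eq0 => /eqP.
have [|x [x1 x2 [e1 [e2 e3]]]] := ae_exists_itv (c := s0 / 2 - B) (d := s0 / 2 + B)
  (ae_and aer (ae_and aeg aeh)); first by move: B0; clear; lra.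
have xs : `|2 * x - s0| < 2 * B.
  by rewrite ltr_norml; apply/andP; split; move: x1 x2; clear; lra.
apply: none; exists (s0 / 2); split; [by move: s0a; clear; lra|by move: s0b; clear; lra|].
(* From f = (f conj(g)) g / |g|^2 with f conj(g) and |g| constant on the window. *)
exists ((k1 +i* k2) / (r ^+ 2)%:C); split.
  rewrite nmM nmV nm_real -(e3 xs) /h nmM nm_conj (e1 xs) (e2 xs).
  by rewrite -expr2 normrX -normrX ger0_norm ?sqr_ge0// divff// sqrf_eq0.
apply: openw; apply: ae_imp (ae_and aeg aeh) => y [e4 e5] ys.
have r2 : (r ^+ 2)%:C != 0 :> R[i] by rewrite -nm_gt0 nm_real normr_gt0 sqrf_eq0.
apply: (mulIf r2); rewrite mulrAC divfK// -(e5 ys) -(e4 ys) -mulcc /h; ring.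
Qed.

(** Let X be the end of the largest interval of agreement. Since f is not 0 on [X - 2 B, X], a
    window centred just to the right of X - B overlaps the interval where f is not 0. There both
    constants apply, so they are equal, and the window reaches beyond X. *)
Lemma agree_extend f g (B t0 : R) c0 : 0 < B -> nonseparable_signal (2 * B) f ->
  (forall a b, a < b -> exists t, [/\ a < t, t < b & exists c, agree f g c (t - B) (t + B)]) ->
  agree f g c0 (t0 - B) (t0 + B) -> forall x, agree f g c0 (t0 - B) x.
Proof.
move=> B0 nsep dense ag0; apply: contrapT => /existsNP[y0 ny].
pose S := [set x | agree f g c0 (t0 - B) x].
have S0 : S (t0 + B) by [].
have Sdown x y : S x -> y <= x -> S y.
  move=> Sx yx; apply: ae_imp Sx => z h /andP[z1 z2]; apply: h.
  by rewrite z1 (le_trans z2).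
have supS : has_sup S.
  split; first by exists (t0 + B).
  exists y0 => x Sx; rewrite leNgt; apply/negP => /ltW xy; exact: ny (Sdown _ _ Sx xy).
pose X := sup S.
have tX : t0 + B <= X by apply: ub_le_sup => //; exact: supS.2.
have SX : S X.
  have h n : agree f g c0 (t0 - B) (X - n.+1%:R^-1).
    have n0 : 0 < n.+1%:R^-1 :> R by rewrite invr_gt0.
    have [x Sx xX] := sup_adherent n0 supS.
    exact: Sdown Sx (ltW xX).
  apply: ae_imp (ae_and (ae_neq X) (ae_all h)) => x [xX hx] /andP[x1 x2].
  have xX' : 0 < X - x by rewrite subr_gt0 lt_neqAle xX.
  have [n nx] : exists n : nat, n.+1%:R^-1 <= X - x.
    exists (Num.truncn (X - x)^-1); rewrite -[leRHS]invrK lef_pV2 ?posrE ?invr_gt0//.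
    by rewrite ltW// truncnS_gt.
  by apply: (hx n); rewrite x1 /= lerBrDr -lerBrDl.
(* A window centred to the right of X - B misses a little of [X - 2 B, X]; [e] bounds how much may
   be missed. *)
have [e e0 nz] : exists2 e : R, 0 < e &
    ~ {ae mu, forall x, X - 2 * B + e <= x <= X -> f x = 0}.
  apply: contrapT => h; apply: nsep; exists (X - 2 * B); rewrite subrK.
  have h' n : {ae mu, forall x, X - 2 * B + n.+1%:R^-1 <= x <= X -> f x = 0}.
    by apply: contrapT => hn; apply: h; exists n.+1%:R^-1; rewrite ?invr_gt0.
  apply: ae_imp (ae_and (ae_neq (X - 2 * B)) (ae_all h')) => x [xX hx].
  rewrite in_itv /= => /andP[x1 x2].
  have xX' : 0 < x - (X - 2 * B) by rewrite subr_gt0 lt_neqAle eq_sym xX.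
  have [n nx] : exists n : nat, n.+1%:R^-1 <= x - (X - 2 * B).
    exists (Num.truncn (x - (X - 2 * B))^-1); rewrite -[leRHS]invrK lef_pV2 ?posrE ?invr_gt0//.
    by rewrite ltW// truncnS_gt.
  by apply: (hx n); rewrite x2 andbT -lerBrDl.
have [|t [t1 + [c ag]]] := dense (X - B) (X - B + Num.min e B).
  by rewrite ltrDl lt_min e0.
rewrite -ltrBlDl lt_min => /andP[t2 t3].
have [cc|cc] := eqVneq c c0; last first.
  apply: nz; apply: ae_imp (ae_and SX ag) => x [h1 h2] /andP[x1 x2].
  have fx0 : f x = c0 * g x.
    by apply: h1; rewrite x2 andbT; move: x1 tX e0; clear; lra.
  have fx : f x = c * g x.
    by apply: h2; apply/andP; split; move: x1 x2 t1 t2; clear; lra.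
  have /eqP : (c - c0) * g x = 0 by rewrite mulrBl -fx -fx0 subrr.
  by rewrite mulf_eq0 subr_eq0 (negbTE cc) /= => /eqP g0; rewrite fx g0 mulr0.
have : S (t + B).
  apply: ae_imp (ae_and SX ag) => x [h1 h2] /andP[x1 x2].
  have [xX|Xx] := leP x X; first by apply: h1; rewrite x1.
  by rewrite -cc; apply: h2; rewrite x2 andbT; move: Xx t3 B0; clear; lra.
move=> /(ub_le_sup supS.2); rewrite -/X leNgt; apply/negP; rewrite negbK.
by move: t1; clear; lra.
Qed.

Lemma patching f g (B : R) : cmeasurable f -> cmeasurable g ->
  0 < B -> nonseparable_signal (2 * B) f ->
  {ae mu, forall t, exists c, nm c = 1 /\
     (agree f g c (t - B) (t + B) \/ agree_reflected f g c t B)} ->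
  exists c, nm c = 1 /\ {ae mu, forall x, f x = c * g x}.
Proof.
move=> mf mg B0 nsep aeP.
have dense a b (ab : a < b) := agree_somewhere mf mg B0 ab nsep aeP.
have [t0 [_ _ [c [c1 ag]]]] := dense 0 1 ltr01.
exists c; split=> //.
have right : forall x, agree f g c (t0 - B) x.
  apply: agree_extend ag => // a b /dense[t [ta tb [c' [_ agt]]]].
  by exists t; split=> //; exists c'.
(* The interval is extended to the left by extending it to the right for the reflected signals. *)
pose f' x := f (- x); pose g' x := g (- x).
have flip a b d : agree f g d a b -> agree f' g' d (- b) (- a).
  move=> /(ae_preserving (@preserving_opp R)); apply: ae_imp => x h /andP[x1 x2].
  by apply: h; rewrite lerNr x2 lerNl x1.
have left : forall x, agree f' g' c (- t0 - B) x.
  apply: (@agree_extend f' g' B (- t0) c B0).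
  - move=> [a /(ae_preserving (@preserving_opp R)) h]; apply: nsep.
    exists (- (a + 2 * B)); apply: ae_imp h => x; rewrite /f' opprK => h.
    rewrite in_itv /= => /andP[x1 x2]; apply: h; rewrite in_itv /=.
    by move: x1 x2; clear => *; apply/andP; split; lra.
  - move=> a b ab; have [|t [ta tb [c' [_ agt]]]] := dense (- b) (- a); first by rewrite ltrN2.
    exists (- t); split; [by rewrite ltrNr|by rewrite ltrNl|exists c'].
    by have := flip _ _ _ agt; rewrite opprD opprB addrC [B - t]addrC.
  - by have := flip _ _ _ ag; rewrite opprD opprB addrC [B - t0]addrC.
have right' (n : nat) := right n%:R.
have left' (n : nat) := ae_preserving (@preserving_opp R) (left n%:R).
apply: ae_imp (ae_and (ae_all right') (ae_all left')) => x [h1 h2].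
have [n xn] : exists n : nat, `|x| <= n%:R.
  by exists (Num.truncn `|x|).+1; rewrite ltW// truncnS_gt.
have [x1|x1] := leP (t0 - B) x.
  by apply: (h1 n); rewrite x1 (le_trans (ler_norm _) xn).
have := h2 n; rewrite /f' /g' opprK; apply; apply/andP; split; last first.
  by rewrite (le_trans (ler_norm _))// normrN.
by move: x1 B0; clear; lra.
Qed.

End Patching.

(** The pieces are compared by [phase_retrieval], and the window factor is cancelled where it is not
    0. In the reflected case the window becomes [phi (- s)], which the symmetry of [phi] identifies
    with the conjugate of [phi s], so the same factor cancels. *)
Lemma local_phase (R : realType) (B b : R) (phi : R -> R[i]) (omega : nat -> R)
    (f g : R -> R[i]) (t : R) : 0 < B -> 0 < b -> b <= 1 / (2 * B) ->
  {ae mu, forall x : R, (phi (- x))^*%C = phi x} ->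
  {ae mu, forall x : R, x \in `[- B, B] -> phi x <> 0} ->
  lattice_frequencies B omega \/ dense_frequencies B omega ->
  nonseparable_signal (2 * B) f ->
  L1 (windowed B phi f t) -> L1 (windowed B phi g t) ->
  (forall n, (1 <= n)%N ->
     nm (fourier (windowed B phi f t) (- (2 * pi * omega n))%:C) =
     nm (fourier (windowed B phi g t) (- (2 * pi * omega n))%:C) /\
     nm (fourier (modulated_difference (2 * pi * b) (windowed B phi f t))
       (- (2 * pi * omega n))%:C) =
     nm (fourier (modulated_difference (2 * pi * b) (windowed B phi g t))
       (- (2 * pi * omega n))%:C)) ->
  exists c, nm c = 1 /\ (agree f g c (t - B) (t + B) \/ agree_reflected f g c t B).
Proof.
move=> B0 b0 bB sym neq0 freq nsep Lu Lv meas.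
have su := @supported_windowed R B phi f t; have sv := @supported_windowed R B phi g t.
have itvB (s : R) : (s \in `[- B, B]) = (`|s| <= B) by rewrite in_itv /= -ler_norml.
have cutE h (s : R) : `|s| <= B -> windowed B phi h t s = h (s + t) * (phi s)^*%C.
  by move=> sB; rewrite /windowed /cut mem_set//= itvB.
have conj0 (z : R[i]) : z <> 0 -> z^*%C != 0.
  by move=> /eqP; rewrite -!nm_eq0 nm_conj.
have cent (P : R -> Prop) : {ae mu, forall s, `|s| <= B -> P (s + t)} ->
    {ae mu, forall x, t - B <= x <= t + B -> P x}.
  move=> /(ae_preserving (preserving_shift (- t))); apply: ae_imp => x + xB.
  rewrite subrK; apply; rewrite ler_norml; move: xB; clear => /andP[? ?].
  by apply/andP; split; lra.
have u0 : ~ {ae mu, forall s, windowed B phi f t s = 0}.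
  move=> h; apply: nsep; exists (t - B).
  rewrite (_ : t - B + 2 * B = t + B); last by ring.
  apply: ae_imp (cent (fun x => f x = 0) _) => [x fx|]; first by rewrite in_itv.
  apply: ae_imp (ae_and h neq0) => s [us ps] sB.
  move/eqP: us; rewrite cutE// mulf_eq0 (negbTE (conj0 _ _)) ?orbF; last first.
    by apply: ps; rewrite itvB.
  by move=> /eqP.
have pi0 := pi_gt0 R.
have [||||c [c1 h]] := @phase_retrieval R B (2 * pi * b) _ _ (ltW B0) _ _ Lu su Lv sv u0.
- by rewrite !mulr_gt0.
- rewrite (_ : B * (2 * pi * b) = b * (2 * B) * pi); last by ring.
  by rewrite ler_piMl ?(ltW pi0)// -ler_pdivlMr// mulr_gt0.
- by apply: sampling freq Lu su Lv sv _ => // n /meas[].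
- apply: (sampling B0 freq) => [||||n /meas[]//].
  + exact: L1_modulated.
  + exact: supported_modulated.
  + exact: L1_modulated.
  + exact: supported_modulated.
exists c; split=> //; case: h => h; [left|right].
  apply: cent; apply: ae_imp (ae_and h neq0) => s [us ps] sB.
  apply: (mulIf (conj0 _ (ps _))); first by rewrite itvB.
  by rewrite -mulrA -!cutE.
apply: (cent (fun x => f x = c * (g (2 * t - x))^*%C)).
apply: ae_imp (ae_and h (ae_and neq0 sym)) => s [us [ps sy]] sB.
apply: (mulIf (conj0 _ (ps _))); first by rewrite itvB.
rewrite -cutE// us /reflected cutE ?normrN// conjM conjcK -sy conjcK mulrA.
by congr (_ * (g _)^*%C * _); ring.
Qed.

Theorem theorem3p4 (R : realType) (B b : R) (phi : R -> R[i])
    (omega : nat -> R) (f : R -> R[i])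
    (B_gt0 : 0 < B)
    (phi_L1 : L1 phi)
    (phi_supp : ess_support phi `<=` `[- B, B])
    (phi_sym : {ae @lebesgue_measure R, forall x : R, (phi (- x))^* = phi x})
    (phi_neq0 : {ae @lebesgue_measure R, forall x : R,
       x \in `[- B, B] -> phi x <> 0})
    (b_gt0 : 0 < b) (b_le : b <= 1 / (2 * B))
    (omega_freq : lattice_frequencies B omega \/ dense_frequencies B omega)
    (f_L1loc : L1loc f)
    (f_nonsep : nonseparable_signal (2 * B) f) :
  determined_up_to_global_phase phi (second_window phi b) omega f.
Proof.
move=> g g_L1loc same.
have norm_eq (z w : R[i]) : `|z| = `|w| -> nm z = nm w.
  by move=> /(congr1 (@complex.Re R)).
have mphi := L1_measurable phi_L1.
have mf := cmeasurable_L1loc f_L1loc; have mg := cmeasurable_L1loc g_L1loc.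
(* This applies the modulation to the window itself, without conjugation, hence the sign opposite to
   [windowed_second]; it serves to obtain measurability. *)
have psi_mod : second_window phi b = modulated_difference (- (2 * pi * b)) phi.
  by apply/funext => x; congr (_ * (expi _ - 1)); ring.
have mpsi : cmeasurable (second_window phi b).
  by rewrite psi_mod; exact: L1_measurable (L1_modulated _ phi_L1).
have phi0 := ae_ess_support phi_supp.
have psi0 : {ae mu, forall x, B < `|x| -> second_window phi b x = 0}.
  by apply: ae_imp phi0 => x px /px; rewrite /second_window => ->; rewrite mul0r.
have Lf := ae_L1_windowed (ltW B_gt0) f_L1loc phi_L1.
have Lg := ae_L1_windowed (ltW B_gt0) g_L1loc phi_L1.
have [|c [c1 fg]] := patching mf mg B_gt0 f_nonsep; last first.
- by exists c; split=> //; rewrite nmE c1.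
- apply: ae_imp (ae_and same (ae_and Lf Lg)) => t [eq_t [Lu Lv]].
  apply: (local_phase B_gt0 b_gt0 b_le phi_sym phi_neq0 omega_freq f_nonsep Lu Lv) => n n1.
  have [/norm_eq e1 /norm_eq e2] := eq_t n n1; split.
    by move: e1; rewrite (stft_fourier _ mphi mf phi0 Lu) (stft_fourier _ mphi mg phi0 Lv).
  have Lu' : L1 (windowed B (second_window phi b) f t) by rewrite windowed_second; exact: L1_modulated.
  have Lv' : L1 (windowed B (second_window phi b) g t) by rewrite windowed_second; exact: L1_modulated.
  move: e2; rewrite (stft_fourier _ mpsi mf psi0 Lu') (stft_fourier _ mpsi mg psi0 Lv').
  by rewrite !windowed_second.
Qed.
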